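(* Let $n\ge1$ and $X=\mathbb C^n/(\mathbb Z^n+i\mathbb Z^n)$. Suppose that $\phi(t)$, $t\in[0,\infty)$, is a solution of the Calabi flow in $\mathcal H_{T^n}$ existing for all time, and that its curvature is uniformly bounded, i.e. $\sup_{t\ge0}\max_X|Rm(t,\cdot)|<\infty$. Then as $t\to\infty$ the metrics $\omega_{\phi(t)}$ converge (smoothly on $X$) to the flat metric $\omega_0$.
   Context: Setting. $X=\mathbb C^n/(\mathbb Z^n+i\mathbb Z^n)$ with coordinates $z=\xi+i\eta$, $\xi,\eta\in\mathbb R^n$ periodic; $T^n$ acts by translation in $\eta$. Let $\omega_0=\sum_\alpha d\xi_\alpha\wedge d\eta_\alpha$ be the flat metric. $\mathcal H_{T^n}$ is the set of smooth $\mathbb Z^n$-periodic functions $\phi(\xi)$ on $\mathbb R^n$ (equivalently, smooth $T^n$-invariant functions on $X$) such that $v(\xi)=\frac12|\xi|^2+\phi(\xi)$ has positive definite real Hessian; the corresponding $T^n$-invariant Kähler metric $\omega_\phi$ in the class $[\omega_0]$ is $\omega_\phi=\sum_{i,j} v_{ij}\,d\xi_i\wedge d\eta_j$. Its scalar curvature is $S=-\sum_{i,j}v^{i\bar j}(\log\det(v_{a\bar b}))_{i\bar j}$. Calabi flow in $\mathcal H_{T^n}$. A smooth family $\phi(t)\in\mathcal H_{T^n}$ solving $\partial_t\phi=S-\underline S$, where $S$ is the scalar curvature of $\omega_{\phi(t)}$ and the average $\underline S$ is $0$. In terms of the Legendre transform $u(t,x)=x\cdot\xi-v(t,\xi)$,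 $x=\nabla v(t,\xi)$, it reads $\partial_t u=\sum_{i,j}\frac{\partial^2u^{ij}}{\partial x_i\partial x_j}$, where $(u^{ij})=(u_{ij})^{-1}$. Curvature norm. $|Rm|^2=\sum_{i,j,k,l}u^{ij}{}_{kl}\,u^{kl}{}_{ij}$, where $u^{ij}{}_{kl}=\partial^2u^{ij}/\partial x_k\partial x_l$. *)

(* Defs.v *)
From mathcomp Require Import all_boot all_order all_algebra.
From mathcomp Require Import all_classical all_reals all_analysis.

Set Implicit Arguments.
Unset Strict Implicit.
Unset Printing Implicit Defensive.

Import Order.TTheory GRing.Theory Num.Theory.
Import numFieldNormedType.Exports.

Local Open Scope classical_set_scope.
Local Open Scope ring_scope.

Section Calculus.
Context {R : realType}.

Fixpoint iter_derive {V : normedModType R} (vs : seq V) (f : V -> R) : V -> R :=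
  if vs is w :: vs' then 'D_w (iter_derive vs' f) else f.

Definition smooth {V : normedModType R} (f : V -> R) : Prop :=
  forall vs : seq V,
    continuous (iter_derive vs f) /\
    forall x w, derivable (iter_derive vs f) x w.

Definition partial {n} (i : 'I_n) (f : 'rV[R]_n -> R) : 'rV[R]_n -> R :=
  'D_(delta_mx 0 i) f.

Definition grad {n} (f : 'rV[R]_n -> R) (x : 'rV[R]_n) : 'rV[R]_n :=
  \row_i partial i f x.

Definition hessian {n} (f : 'rV[R]_n -> R) (x : 'rV[R]_n) : 'M[R]_n :=
  \matrix_(i, j) partial i (partial j f) x.

Definition dot {n} (x y : 'rV[R]_n) : R := \sum_i x 0 i * y 0 i.

Definition posdef {n} (A : 'M[R]_n) : Prop :=
  forall w : 'rV[R]_n, w != 0 -> 0 < (w *m A *m w^T) 0 0.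

(* Derivative at [t] of a function of time that is only meaningful on
   [0, +oo[; it is the one-sided derivative at [t = 0]. *)
Definition has_time_derivative (f : R -> R) (t d : R) : Prop :=
  (f s - f t) / (s - t) @[s --> within `[0, +oo[ t^'] --> d.

(* Smoothness on the closed half space [0, +oo[ * R^n: being the restriction
   of a smooth function on R * R^n. *)
Definition smooth_family {n} (phi : R -> 'rV[R]_n -> R) : Prop :=
  exists Phi : R * 'rV[R]_n -> R,
    smooth Phi /\ forall t x, 0 <= t -> phi t x = Phi (t, x).

End Calculus.

(* T^n-invariant functions on X are functions of xi on R^n. *)
Section ToricPotentials.
Context {R : realType} {n : nat}.
Implicit Types (phi v : 'rV[R]_n -> R) (xi x : 'rV[R]_n).

Definition periodic phi : Prop :=
  forall (m : 'rV[int]_n) xi, phi (xi + map_mx intr m) = phi xi.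

Definition kahler_potential phi xi : R := 2^-1 * dot xi xi + phi xi.

Definition in_H phi : Prop :=
  [/\ smooth phi, periodic phi & forall xi, posdef (hessian (kahler_potential phi) xi)].

(* The matrix f_{i \bar j} = d^2 f / dz_i d\bar z_j, where z = xi + i eta and
   f depends on xi only. *)
Definition ddbar (f : 'rV[R]_n -> R) xi : 'M[R]_n := 4^-1 *: hessian f xi.

Definition scalar_curvature phi xi : R :=
  let v := kahler_potential phi in
  - \sum_i \sum_j invmx (ddbar v xi) i j *
      ddbar (fun y => ln (\det (ddbar v y))) xi i j.

(* The average of the scalar curvature, which is subtracted in the Calabi flow
   equation, vanishes on X. *)
Definition calabi_flow (phi : R -> 'rV[R]_n -> R) : Prop :=
  [/\ smooth_family phi,
      forall t, 0 <= t -> in_H (phi t) &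
      forall t xi, 0 <= t ->
        has_time_derivative (phi ^~ xi) t (scalar_curvature (phi t) xi)].

(* u(x) = x . xi - v(xi) where x = grad v(xi); for v = kahler_potential phi with
   phi in H, grad v is a bijection of R^n. *)
Definition legendre v x : R :=
  let xi := xget 0 [set xi | grad v xi = x] in dot x xi - v xi.

Definition inv_hessian (u : 'rV[R]_n -> R) (i j : 'I_n) x : R :=
  invmx (hessian u x) i j.

Definition Rm_sq_symplectic (u : 'rV[R]_n -> R) x : R :=
  \sum_i \sum_j \sum_k \sum_l
    partial k (partial l (inv_hessian u i j)) x *
    partial i (partial j (inv_hessian u k l)) x.

(* |Rm| at the points of X lying over xi, i.e. at x = grad v(xi). *)
Definition Rm_norm phi xi : R :=
  let v := kahler_potential phi in
  Num.sqrt (Rm_sq_symplectic (legendre v) (grad v xi)).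

End ToricPotentials.

(* The universal cover R^n * R^n of X has coordinates (xi, eta); tensors on X
   are Z^n * Z^n-periodic tensors on it. *)
Section Forms.
Context {R : realType} {n : nat}.
Notation E := ('rV[R]_n * 'rV[R]_n)%type.

(* [alpha p a b] is the value at the point p on the tangent vectors a and b. *)
Definition form2 := E -> E -> E -> R.

(* d xi_i /\ d eta_j *)
Definition dxi_deta (i j : 'I_n) (a b : E) : R :=
  a.1 0 i * b.2 0 j - b.1 0 i * a.2 0 j.

Definition omega0 : form2 := fun _ a b => \sum_i dxi_deta i i a b.

Definition omega (phi : 'rV[R]_n -> R) : form2 := fun p a b =>
  \sum_i \sum_j hessian (kahler_potential phi) p.1 i j * dxi_deta i j a b.

(* C^oo convergence as t -> +oo: all derivatives of the coefficients in the
   constant frames converge uniformly. *)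
Definition smoothly_converges (alpha : R -> form2) (beta : form2) : Prop :=
  forall (a b : E) (vs : seq E) (eps : R), 0 < eps ->
    \forall t \near +oo, forall p : E,
      `|iter_derive vs (fun q => alpha t q a b - beta q a b) p| < eps.

End Forms.

(* Main.v *)
(* Idea. With t = exp s, the flow becomes an equation on the whole of R * R^n.
   Put G = (u^{ij}) and U = G^-1 = 1 + H, where H is the Hessian in x of the
   periodic part h of u; then h_s = exp s * sum_ij d_i d_j G_ij.
   1. On a line in the direction x_b, f = w G w^T is positive, periodic and
      satisfies |f''| <= K f U_bb, where U_bb is the derivative of the b-th
      coordinate of xi, which grows by 1 per period. This Riccati inequality
      bounds max f / min f and f'/f by constants. As a periodic phi is not strictly
      convex along a line, w G w^T takes values on both sides of |w|^2, so G is
      uniformly pinched, and D_x G, hence D_x H, is bounded.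
   2. Let E_k be the mean of |D^k h|^2. Integration by parts gives
      E_k' <= - c exp s E_(k+2) plus terms at least cubic in H and its
      derivatives. For k = 1 there are none, so E_1 -> 0; as E_3 is bounded,
      E_2 -> 0, and sup |H| -> 0 because H is uniformly Lipschitz. For larger k
      Gagliardo-Nirenberg bounds the extra terms by C (sup |H|)^2 exp s E_(k+2),
      so every E_k -> 0, and all derivatives of H tend to 0 uniformly by Sobolev.
   3. D^2 v = G at x = grad v(xi), G - 1 = - G H, and each derivative in xi of a
      function of x = grad v(xi) is w G grad_x of it. *)
Require Import Defs.
From mathcomp Require Import all_boot all_order all_fingroup all_algebra.
From mathcomp Require Import all_classical all_reals all_analysis.
From mathcomp Require Import zify ring lra.

Set Implicit Arguments.
Unset Strict Implicit.
Unset Printing Implicit Defensive.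

Import Order.TTheory GRing.Theory Num.Theory.
Import numFieldNormedType.Exports.
Local Open Scope classical_set_scope.
Local Open Scope ring_scope.

(** * Smooth functions *)

Section DirectionalDerivatives.
Context {R : realType}.
Implicit Types V : normedModType R.

(** The curvature hypothesis measures second derivatives of G in the evolving metric itself, and no
    comparison of G with a fixed metric is known beforehand. The curvature is symmetric in its two
    pairs of indices, hence a quadratic form on pairs; in an orthonormal frame, Cauchy-Schwarz
    against the squares of w and of the coordinate vector e_b gives |f''| <= K f U_bb. The missing
    scale comes from the lattice: the coordinate xi_b gains exactly 1 per period, whatever the
    metric.

    The resulting bounds stop at D H, and no parabolic regularity is invoked beyond them. The order
    k = 1 is special because D G = - G (D H) G holds exactly; from order 2 on, the defect of this
    identity is quadratic in derivatives of H. The smallness of sup |H| won from k = 1 pays for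
    these defects at every order.

    Logarithmic time makes every statement global in s, so the one-sided derivative at t = 0 never
    enters; the factor exp s is at least 1 for s >= 0 and only helps dissipation. *)

Lemma is_deriveP V (f : V -> R) (p w : V) (d : R) :
  is_derive p w f d <->
  (forall e, 0 < e -> exists2 del, 0 < del & forall h, h != 0 -> `|h| < del ->
     `|h^-1 * (f (p + h *: w) - f p) - d| < e).
Proof.
split=> [[df <-] e e0|H].
  have /cvgrPdist_lt /(_ _ e0) := df.
  move=> /nbhs_ballP[del /= del0 hd]; exists del => // h h0 hh.
  have := hd h; rewrite /ball /= sub0r normrN => /(_ hh h0).
  by rewrite distrC /GRing.scale /= [p + _]addrC.
have cv : h^-1 *: ((f \o shift p) (h *: w) - f p) @[h --> 0^'] --> d.
  apply/cvgrPdist_lt => e e0; have [del del0 hd] := H e e0.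
  apply/nbhs_ballP; exists del => //= h; rewrite /ball /= sub0r normrN => hh h0.
  by rewrite distrC /GRing.scale /= [h *: w + p]addrC; exact: hd.
by split; [apply/cvg_ex; exists d|exact/cvg_lim].
Qed.

Lemma continuousP_lt V (f : V -> R) :
  continuous f <-> (forall p e, 0 < e -> exists2 del, 0 < del &
    forall v, `|v| < del -> `|f (p + v) - f p| < e).
Proof.
split=> [cf p e e0|H p].
  have /cvgrPdist_lt /(_ _ e0) /nbhs_ballP[del /= del0 hd] := cf p.
  exists del => // v hv; rewrite distrC; apply: hd.
  by rewrite -ball_normE /ball_ /= opprD addrA subrr sub0r normrN.
apply/cvgrPdist_lt => e e0; have [del del0 hd] := H p e e0.
apply/nbhs_ballP; exists del => //= q.
rewrite -ball_normE /ball_ /= => hq.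
by rewrite distrC -[q](subrK p) [q - p + p]addrC; apply: hd; rewrite distrC.
Qed.

Lemma is_derive_line V (f : V -> R) (p w : V) (t d : R) :
  is_derive (p + t *: w) w f d -> is_derive t 1 (fun s => f (p + s *: w)) d.
Proof.
move=> /is_deriveP H; apply/is_deriveP => e /H[del del0 hd].
by exists del => // h h0 hh; rewrite [h%:A]mulr1 scalerDl addrA; exact: hd.
Qed.

Lemma MVT_any (f df : R -> R) (a b : R) :
  (forall x : R, is_derive x (1 : R) f (df x)) ->
  exists2 c, Num.min a b <= c <= Num.max a b & f b - f a = df c * (b - a).
Proof.
move=> fd.
have fc x : {for x, continuous f}.
  by apply/differentiable_continuous/derivable1_diffP; have [] := fd x.
have [ab|/ltW ab] := leP a b.
  have [|c] := @MVT_segment _ f df a b ab (fun x _ => fd x).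
    by apply: continuous_subspaceT.
  by rewrite in_itv /= => hc ->; exists c.
have [|c] := @MVT_segment _ f df b a ab (fun x _ => fd x).
  by apply: continuous_subspaceT.
rewrite in_itv /= => hc E; exists c => //.
by rewrite -[LHS]opprB E -mulrN opprB.
Qed.

Lemma mvt_line V (f : V -> R) (p w : V) (h : R) :
  (forall q, derivable f q w) ->
  exists2 c, `|c| <= `|h| & f (p + h *: w) - f p = h * 'D_w f (p + c *: w).
Proof.
move=> fd.
have [c hc E] := @MVT_any (fun s => f (p + s *: w)) (fun s => 'D_w f (p + s *: w))
  0 h (fun s => is_derive_line (derivableP (fd _))).
exists c; last by rewrite -[in f p](addr0 p) -(scale0r w) E subr0 mulrC.
move: hc; have [h0|h0] := leP 0 h => /andP[c1 c2].
  by rewrite !ger0_norm.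
by rewrite ler0_norm // (ltr0_norm h0) lerN2.
Qed.

Lemma smooth_cont V (f : V -> R) : smooth f -> continuous f.
Proof. by move=> /(_ [::])[]. Qed.

Lemma smooth_derivable V (f : V -> R) p w : smooth f -> derivable f p w.
Proof. by move=> /(_ [::])[_ H]; exact: H. Qed.

Lemma smooth_is_derive V (f : V -> R) p w : smooth f -> is_derive p w f ('D_w f p).
Proof. by move=> sf; apply: derivableP; exact: smooth_derivable. Qed.

Lemma iter_derive_cat V (vs ws : seq V) (f : V -> R) :
  iter_derive (vs ++ ws) f = iter_derive vs (iter_derive ws f).
Proof. by elim: vs => //= v vs ->. Qed.

Lemma smooth_iter V (f : V -> R) vs : smooth f -> smooth (iter_derive vs f).
Proof. by move=> sf ws; rewrite -iter_derive_cat; exact: sf. Qed.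

Lemma smooth_derive V (f : V -> R) w : smooth f -> smooth ('D_w f).
Proof. by move=> sf; exact: (@smooth_iter _ f [:: w]). Qed.

Lemma derive_funE V (f g : V -> R) w :
  (forall p, is_derive p w f (g p)) -> 'D_w f = g.
Proof. by move=> H; apply/funext => p; have [_] := H p. Qed.

(** Smoothness quantifies over all lists of directions, so it is hard to propagate through inverses
    and compositions one derivative at a time. A class whose first derivatives are expressions of
    this kind in its own members is smooth at once. *)
Inductive ring_closure V (S : (V -> R) -> Prop) : (V -> R) -> Prop :=
| closure_gen f : S f -> ring_closure S f
| closure_cst c : ring_closure S (fun=> c)
| closure_add f g : ring_closure S f -> ring_closure S g ->
    ring_closure S (fun p => f p + g p)
| closure_mul f g : ring_closure S f -> ring_closure S g ->
    ring_closure S (fun p => f p * g p)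
| closure_inv f : ring_closure S f -> (forall p, f p != 0) ->
    ring_closure S (fun p => (f p)^-1).

Lemma is_derive_inv V (f : V -> R) p w d : f p != 0 -> is_derive p w f d ->
  is_derive p w (fun q => (f q)^-1) (- (f p)^-1 * (f p)^-1 * d).
Proof.
move=> f0 [df <-]; split; first exact: derivableV.
rewrite deriveV // /GRing.scale /= -exprVn; congr (_ * _).
by rewrite expr2 mulNr.
Qed.

Lemma is_derive_mul V (f g : V -> R) p w a b :
  is_derive p w f a -> is_derive p w g b ->
  is_derive p w (fun q => f q * g q) (f p * b + a * g p).
Proof.
move=> fa gb; have := @is_deriveM R V f g p w a b fa gb.
by rewrite /GRing.scale /= [g p * a]mulrC.
Qed.

Lemma is_derive_add V (f g : V -> R) p w a b :
  is_derive p w f a -> is_derive p w g b ->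
  is_derive p w (fun q => f q + g q) (a + b).
Proof. by move=> fa gb; exact: (@is_deriveD R V R^o f g p w a b fa gb). Qed.

(* Smoothness of a class of functions follows from its derivatives being
   ring expressions in the class. *)
Lemma ring_closure_smooth V (S : (V -> R) -> Prop) :
  (forall f, S f -> continuous f /\ forall w, (forall p, derivable f p w) /\
     ring_closure S ('D_w f)) ->
  forall f, ring_closure S f -> smooth f.
Proof.
move=> HS.
have key f : ring_closure S f -> continuous f /\ forall w, exists2 g,
    ring_closure S g & forall p, is_derive p w f (g p).
  elim=> {f} [f /HS[cf H]|c|f g Af [cf Hf] Ag [cg Hg]|f g Af [cf Hf] Ag [cg Hg]
             |f Af [cf Hf] f0].
  - split; first exact: cf.
    move=> w; have [df Af] := H w; exists ('D_w f); first exact: Af.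
    by move=> p; apply: derivableP; exact: df.
  - split; first by move=> p; exact: cvg_cst.
    by move=> w; exists (fun=> 0); [exact: closure_cst|move=> p; exact: is_derive_cst].
  - split; first by move=> p; apply: cvgD; [exact: cf|exact: cg].
    move=> w; have [f' Af' Hf'] := Hf w; have [g' Ag' Hg'] := Hg w.
    exists (fun p => f' p + g' p); first exact: closure_add.
    by move=> p; exact: is_derive_add.
  - split; first by move=> p; apply: cvgM; [exact: cf|exact: cg].
    move=> w; have [f' Af' Hf'] := Hf w; have [g' Ag' Hg'] := Hg w.
    exists (fun p => f p * g' p + f' p * g p).
      by apply: closure_add; apply: closure_mul.
    by move=> p; exact: is_derive_mul.
  - split; first by move=> p; apply: cvgV => //; exact: cf.
    move=> w; have [f' Af' Hf'] := Hf w.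
    exists (fun p => (-1 * (f p)^-1) * (f p)^-1 * f' p).
      apply: closure_mul => //; apply: closure_mul; last exact: closure_inv.
      by apply: closure_mul; [exact: closure_cst|exact: closure_inv].
    by move=> p; rewrite mulN1r; exact: is_derive_inv.
move=> f Af vs.
have : ring_closure S (iter_derive vs f).
  elim: vs => //= w vs /key[_ /(_ w)[g Ag /derive_funE ->]]; exact: Ag.
move=> /key[cf H]; split=> // p w.
by have [g _ Hg] := H w; have [] := Hg p.
Qed.

Lemma smooth_closure V (f : V -> R) : ring_closure smooth f -> smooth f.
Proof.
apply: ring_closure_smooth => g sg; split; first exact: smooth_cont.
move=> w; split; first by move=> p; exact: smooth_derivable.
by apply: closure_gen; exact: smooth_derive.
Qed.

Lemma smooth_cst V (c : R) : smooth (fun _ : V => c).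
Proof. by apply: smooth_closure; exact: closure_cst. Qed.

Lemma smoothD V (f g : V -> R) :
  smooth f -> smooth g -> smooth (fun p => f p + g p).
Proof.
by move=> sf sg; apply: smooth_closure; apply: closure_add; exact: closure_gen.
Qed.

Lemma smoothM V (f g : V -> R) :
  smooth f -> smooth g -> smooth (fun p => f p * g p).
Proof.
by move=> sf sg; apply: smooth_closure; apply: closure_mul; exact: closure_gen.
Qed.

Lemma smoothN V (f : V -> R) : smooth f -> smooth (fun p => - f p).
Proof.
move=> sf; have -> : (fun p => - f p) = (fun p => -1 * f p).
  by apply/funext => p; rewrite mulN1r.
by apply: smoothM; [exact: smooth_cst|exact: sf].
Qed.

Lemma smoothB V (f g : V -> R) :
  smooth f -> smooth g -> smooth (fun p => f p - g p).
Proof. by move=> sf sg; apply: smoothD; [exact: sf|exact: smoothN]. Qed.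

Lemma smoothV V (f : V -> R) :
  smooth f -> (forall p, f p != 0) -> smooth (fun p => (f p)^-1).
Proof.
by move=> sf f0; apply: smooth_closure; apply: closure_inv => //; exact: closure_gen.
Qed.

Lemma smooth_sum V (I : Type) (r : seq I) (P : pred I) (F : I -> V -> R) :
  (forall i, P i -> smooth (F i)) -> smooth (fun p => \sum_(i <- r | P i) F i p).
Proof.
move=> sF; elim: r => [|i r IH].
  have -> : (fun q => \sum_(i <- [::] | P i) F i q) = (fun=> 0).
    by apply/funext => q; rewrite big_nil.
  exact: smooth_cst.
have -> : (fun q => \sum_(j <- i :: r | P j) F j q) =
    (fun q => if P i then F i q + \sum_(j <- r | P j) F j q
              else \sum_(j <- r | P j) F j q).
  by apply/funext => q; rewrite big_cons.
case Pi: (P i); last exact: IH.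
by apply: smoothD; [exact: sF|exact: IH].
Qed.

Lemma smooth_prod V (I : Type) (r : seq I) (P : pred I) (F : I -> V -> R) :
  (forall i, P i -> smooth (F i)) -> smooth (fun p => \prod_(i <- r | P i) F i p).
Proof.
move=> sF; elim: r => [|i r IH].
  have -> : (fun q => \prod_(i <- [::] | P i) F i q) = (fun=> 1).
    by apply/funext => q; rewrite big_nil.
  exact: smooth_cst.
have -> : (fun q => \prod_(j <- i :: r | P j) F j q) =
    (fun q => if P i then F i q * \prod_(j <- r | P j) F j q
              else \prod_(j <- r | P j) F j q).
  by apply/funext => q; rewrite big_cons.
case Pi: (P i); last exact: IH.
by apply: smoothM; [exact: sF|exact: IH].
Qed.

Lemma is_derive_bigsum V (I : Type) (r : seq I) (P : pred I) (F : I -> V -> R)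
    (dF : I -> R) p w : (forall i, P i -> is_derive p w (F i) (dF i)) ->
  is_derive p w (fun q => \sum_(i <- r | P i) F i q) (\sum_(i <- r | P i) dF i).
Proof.
move=> H; elim: r => [|i r IH].
  have -> : (fun q => \sum_(i <- [::] | P i) F i q) = cst 0.
    by apply/funext => q; rewrite big_nil.
  by rewrite big_nil; exact: is_derive_cst.
have -> : (fun q => \sum_(j <- i :: r | P j) F j q) =
    (fun q => if P i then F i q + \sum_(j <- r | P j) F j q
              else \sum_(j <- r | P j) F j q).
  by apply/funext => q; rewrite big_cons.
rewrite big_cons.
by case Pi: (P i); [exact: (is_derive_add (H _ Pi) IH)|exact: IH].
Qed.

End DirectionalDerivatives.

Arguments smooth_derivable {R V f} p w.
Arguments smooth_is_derive {R V f} p w.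
Arguments smooth_derive {R V f} w.

(** * Frechet differentiability and the chain rule *)

Section Coordinates.
Context {R : realType}.

Lemma finite_delta (J : finType) (P : J -> R -> Prop) :
  (forall j, exists2 del, 0 < del & forall d, d < del -> P j d) ->
  exists2 del, 0 < del & forall j d, d < del -> P j d.
Proof.
move=> H.
suff [del del0 hd] : exists2 del, 0 < del &
    forall j, j \in enum J -> forall d, d < del -> P j d.
  by exists del => // j; apply: hd; rewrite mem_enum.
elim: (enum J) => [|j s [d1 d10 h1]]; first by exists 1.
have [d2 d20 h2] := H j.
exists (Num.min d1 d2); first by rewrite lt_min d10.
move=> i; rewrite inE => /predU1P[->|/h1 hi] d; rewrite lt_min => /andP[hd1 hd2].
  exact: h2.
exact: hi.
Qed.

(** A finite basis whose coordinate functionals are bounded by the norm, so that small vectors have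
    small coordinates. The chain rule is proved at this level, where time and space need not be
    distinguished. *)
Record coordinates (V : normedModType R) (J : finType) := Coordinates {
  cvec : J -> V;
  coord_of : J -> V -> R;
  coord_sum : forall v, v = \sum_j coord_of j v *: cvec j;
  coord_le : forall j v, `|coord_of j v| <= `|v|;
  coord_lin : forall j a u v, coord_of j (a *: u + v) = a * coord_of j u + coord_of j v }.

Variables (V : normedModType R) (J : finType) (C : coordinates V J).
Local Notation e := (cvec C).
Local Notation c := (coord_of C).

Lemma coordB j u v : c j (u - v) = c j u - c j v.
Proof. by rewrite addrC -scaleN1r coord_lin mulN1r addrC. Qed.

Lemma coordDZ j u v h : c j (u + h *: v) = c j u + h * c j v.
Proof. by rewrite addrC coord_lin addrC. Qed.

(** The increment is built up one coordinate at a time: each new coordinate costs one mean value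
    theorem, and continuity of that partial derivative at [q] makes its error at most half of
    [eps]. *)
Lemma frechet_list (f : V -> R) q (s : seq J) : smooth f ->
  forall eps, 0 < eps -> exists2 del, 0 < del & forall v, `|v| < del ->
  `|f (q + \sum_(j <- s) c j v *: e j) - f q - \sum_(j <- s) c j v * 'D_(e j) f q|
    <= eps * `|v|.
Proof.
move=> sf; elim: s => [|j s IH] eps eps0.
  exists 1 => // v _; rewrite !big_nil addr0 !subrr normr0.
  by rewrite mulr_ge0 // ltW.
have e20 : 0 < eps / 2 by rewrite divr_gt0.
have [d1 d10 h1] := IH _ e20.
have [d2 d20 h2] := (continuousP_lt _).1 (smooth_cont (smooth_derive (e j) sf)) q _ e20.
(* [K] bounds the partial increments per unit of [|v|]; the radius [d2 / (K + 1)] keeps the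
   mean-value point within [d2] of [q]. *)
pose K : R := \sum_(i <- j :: s) `|e i|.
have K0 : 0 <= K by apply: sumr_ge0.
exists (Num.min d1 (d2 / (K + 1))).
  by rewrite lt_min d10 divr_gt0 // ltr_wpDl.
move=> v; rewrite lt_min => /andP[v1 v2].
set S := \sum_(i <- s) c i v *: e i.
rewrite !big_cons addrCA [c j v *: e j + _]addrC -/S.
have [t tc E] := mvt_line (q + S) (c j v) (fun p => smooth_derivable p (e j) sf).
have -> : f (q + S + c j v *: e j) - f q - (c j v * 'D_(e j) f q +
    \sum_(i <- s) c i v * 'D_(e i) f q) =
  (f (q + S) - f q - \sum_(i <- s) c i v * 'D_(e i) f q) +
  c j v * ('D_(e j) f (q + (S + t *: e j)) - 'D_(e j) f q).
  by rewrite [q + (S + _)]addrA mulrBr -E; ring.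
apply: le_trans (ler_normD _ _) _; rewrite [eps]splitr mulrDl lerD //.
  exact: h1.
rewrite normrM mulrC ler_pM // ?coord_le // ltW //; apply: h2.
have: `|v| * (K + 1) < d2 by rewrite -ltr_pdivlMr // ltr_wpDl.
apply: le_lt_trans.
apply: (@le_trans _ _ (`|v| * K)); last by rewrite ler_wpM2l // lerDl.
rewrite /K big_cons mulrDr [leRHS]addrC (le_trans (ler_normD _ _)) // lerD //.
  rewrite (le_trans (ler_norm_sum _ _ _)) // mulr_sumr ler_sum // => i _.
  by rewrite normrZ ler_wpM2r // coord_le.
by rewrite normrZ ler_wpM2r // (le_trans tc) // coord_le.
Qed.

Lemma frechet (f : V -> R) q : smooth f ->
  forall eps, 0 < eps -> exists2 del, 0 < del & forall v, `|v| < del ->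
  `|f (q + v) - f q - \sum_j c j v * 'D_(e j) f q| <= eps * `|v|.
Proof.
move=> sf eps eps0; have [d d0 hd] := @frechet_list f q (index_enum J) sf _ eps0.
by exists d => // v /hd; rewrite -coord_sum.
Qed.

Lemma coord_norm (v : V) : `|v| <= \sum_j `|c j v| * `|e j|.
Proof.
rewrite {1}[v](coord_sum C) (le_trans (ler_norm_sum _ _ _)) //.
by apply: ler_sum => j _; rewrite normrZ.
Qed.

Lemma is_derive_scale_r (W : normedModType R) (g : W -> R) p w a k :
  is_derive p w g a -> is_derive p w (fun q => g q * k) (a * k).
Proof.
move=> ga; have := is_derive_mul ga (is_derive_cst k p w).
by rewrite mulr0 add0r.
Qed.

(** The linear part of the expansion of [f] at [Th p] is differentiated coordinate by coordinate.
    Its error is o(|h|) because differentiable coordinates force the increment of [Th] to be O(|h|),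
    with the constant [M] below. *)
Lemma chain_rule (W : normedModType R) (f : V -> R) (Th : W -> V) p w (a : J -> R) :
  smooth f -> (forall j, is_derive p w (fun q => c j (Th q)) (a j)) ->
  is_derive p w (fun q => f (Th q)) (\sum_j a j * 'D_(e j) f (Th p)).
Proof.
move=> sf H; apply/is_deriveP => eps eps0.
have Hsum : is_derive p w (fun q => \sum_j c j (Th q) * 'D_(e j) f (Th p))
    (\sum_j a j * 'D_(e j) f (Th p)).
  by apply: is_derive_bigsum => j _; exact: is_derive_scale_r.
have e20 : 0 < eps / 2 by rewrite divr_gt0.
have [d1 d10 h1] := (is_deriveP _ _ _ _).1 Hsum _ e20.
have [d2 d20 h2] : exists2 del, 0 < del & forall j d, d < del -> forall h, h != 0 ->
    `|h| <= d -> `|c j (Th (p + h *: w) - Th p)| <= (`|a j| + 1) * `|h|.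
  apply: finite_delta => j; have [d d0 hd] := (is_deriveP _ _ _ _).1 (H j) _ ltr01.
  exists d => // d' dd' h h0 hh; have := hd h h0 (le_lt_trans hh dd').
  rewrite -coordB => /ltW; rewrite -ler_pdivrMr ?normr_gt0 // mulrC -normfV -normrM.
  move=> Hj; rewrite -[X in `|X|](subrK (a j)) (le_trans (ler_normD _ _)) //.
  by rewrite addrC lerD2l.
pose M : R := \sum_j (`|a j| + 1) * `|e j|.
have M0 : 0 <= M by apply: sumr_ge0 => j _; rewrite mulr_ge0 // addr_ge0.
have HM h : h != 0 -> `|h| < d2 -> `|Th (p + h *: w) - Th p| <= M * `|h|.
  move=> h0 hh; rewrite (le_trans (coord_norm _)) // mulr_suml ler_sum // => j _.
  rewrite mulrAC ler_wpM2r //.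
  by apply: (h2 j `|h|).
have e3 : 0 < eps / 2 / (M + 1) by rewrite divr_gt0 // ltr_wpDl.
have [d3 d30 h3] := @frechet f (Th p) sf _ e3.
exists (Num.min (Num.min d1 d2) (d3 / (M + 1))).
  by rewrite !lt_min d10 d20 divr_gt0 // ltr_wpDl.
move=> h h0; rewrite !lt_min => /andP[/andP[hh1 hh2] hh3].
set v := Th (p + h *: w) - Th p.
have vM : `|v| <= M * `|h| by exact: HM.
have M10 : 0 < M + 1 by rewrite ltr_wpDl.
have vd : `|v| < d3.
  move: hh3; rewrite ltr_pdivlMr // => /(le_lt_trans _); apply.
  by rewrite (le_trans vM) // mulrC ler_wpM2l // lerDl.
have := h1 h h0 hh1; rewrite -sumrB.
rewrite (eq_bigr (fun j => c j v * 'D_(e j) f (Th p))); last first.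
  by move=> j _; rewrite -mulrBl -coordB.
have := h3 v vd; rewrite [Th p + v]addrC subrK.
set S := \sum_j c j v * _; set D := f _ - f _ => q1 q2.
have -> : h^-1 * D - \sum_j a j * 'D_(e j) f (Th p) =
  h^-1 * (D - S) + (h^-1 * S - \sum_j a j * 'D_(e j) f (Th p)) by ring.
rewrite [eps]splitr (le_lt_trans (ler_normD _ _)) // ler_ltD //.
rewrite normrM normfV mulrC ler_pdivrMr ?normr_gt0 // (le_trans q1) //.
rewrite -mulrA ler_wpM2l //; first exact: ltW.
rewrite mulrC ler_pdivrMr // (le_trans vM) // mulrC ler_wpM2l //.
by rewrite lerDl.
Qed.

Lemma is_derive_coord j q v : is_derive q v (c j) (c j v).
Proof.
apply/is_deriveP => eps eps0; exists 1 => // h h0 _.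
by rewrite coordDZ addrAC subrr add0r mulKf // subrr normr0.
Qed.

Lemma derive_coord (f : V -> R) q v : smooth f ->
  'D_v f q = \sum_j c j v * 'D_(e j) f q.
Proof.
move=> sf; have [_] := @chain_rule V f id q v (fun j => c j v) sf
  (fun j => is_derive_coord j q v); exact.
Qed.

End Coordinates.

(** * Symmetry of second derivatives *)

Section Schwarz.
Context {R : realType} (V : normedModType R).

(** Two mean value theorems: along [v] for the difference of [f] in direction [w], then along [w]
    for ['D_v f]. Both intermediate points stay at distance O(|h|) from [q]. *)
Lemma second_difference (f : V -> R) q v w h : smooth f ->
  exists2 z, `|z| <= `|h| * (`|v| + `|w|) &
  f (q + h *: v + h *: w) - f (q + h *: v) - (f (q + h *: w) - f q) =
    h * h * 'D_w ('D_v f) (q + z).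
Proof.
move=> sf; pose g y := f (y + h *: w) - f y.
have dg y : is_derive y v g ('D_v f (y + h *: w) - 'D_v f y).
  apply: is_derive_add; last first.
    by apply: is_deriveN; exact: smooth_is_derive.
  apply/is_deriveP => e e0.
  have [d d0 hd] := (is_deriveP _ _ _ _).1 (smooth_is_derive (y + h *: w) v sf) _ e0.
  by exists d => // k k0 hk; rewrite [y + k *: v + _]addrAC; exact: hd.
have [a ah Ea] := mvt_line q h (fun y => @ex_derive _ _ _ _ _ _ _ (dg y)).
have [b bh Eb] := mvt_line (q + a *: v) h
  (fun y => smooth_derivable y w (smooth_derive v sf)).
exists (a *: v + b *: w).
  by rewrite mulrDr (le_trans (ler_normD _ _)) // !normrZ lerD // ler_wpM2r.
move: Ea; rewrite /g => ->; rewrite (@derive_val _ _ _ _ _ _ _ (dg _)).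
by rewrite addrA -mulrA -Eb.
Qed.

(** The second difference is symmetric in [v] and [w], so the two mixed derivatives take a common
    value at two points near [q]; continuity at [q] does the rest. *)
Lemma derive_commute (f : V -> R) v w : smooth f -> 'D_v ('D_w f) = 'D_w ('D_v f).
Proof.
move=> sf; apply/funext => q.
have cont g z : smooth g -> forall eps, 0 < eps -> exists2 del, 0 < del &
    forall h x, 0 < h < del -> `|x| <= `|h| * z -> `|g (q + x) - g q| < eps.
  move=> sg eps eps0.
  have [d d0 hd] := (continuousP_lt g).1 (smooth_cont sg) q _ eps0.
  have z0 : 0 < `|z| + 1 by rewrite ltr_wpDl.
  exists (d / (`|z| + 1)) => [|h x /andP[h0 hh] hx]; first by rewrite divr_gt0.
  apply: hd; apply: le_lt_trans hx _; rewrite (gtr0_norm h0).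
  apply: (@le_lt_trans _ _ (h * (`|z| + 1))); last by rewrite -ltr_pdivlMr.
  by rewrite ler_pM2l // (le_trans (ler_norm z)) // lerDl.
have svw := smooth_derive v (smooth_derive w sf).
have swv := smooth_derive w (smooth_derive v sf).
apply/eqP; rewrite -subr_eq0 -normr_le0; apply/ler_addgt0Pr => eps eps0.
rewrite add0r; have e20 : 0 < eps / 2 by rewrite divr_gt0.
have [d1 d10 h1] := cont _ (`|w| + `|v|) svw _ e20.
have [d2 d20 h2] := cont _ (`|v| + `|w|) swv _ e20.
pose h : R := Num.min d1 d2 / 2.
have m0 : 0 < Num.min d1 d2 by rewrite lt_min d10.
have h0 : 0 < h by rewrite divr_gt0.
have : h < Num.min d1 d2 by rewrite ltr_pdivrMr // ltr_pMr // ltr1n.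
rewrite lt_min => /andP[hd1 hd2].
have [x xh E1] := second_difference q v w h sf.
have [y yh E2] := second_difference q w v h sf.
have := h1 h y; rewrite h0 hd1 => /(_ isT yh).
have := h2 h x; rewrite h0 hd2 => /(_ isT xh).
move: E1 E2; move: ('D_w ('D_v f) (q + x)) ('D_v ('D_w f) (q + y)) => X Y E1 E2.
have -> : X = Y.
  have hh0 : h * h != 0 by rewrite mulf_neq0 // gt_eqF.
  apply: (mulfI hh0); rewrite -E1 -E2 [q + h *: w + _]addrAC.
  by ring.
move: ('D_w ('D_v f) q) ('D_v ('D_w f) q) => A B q1 q2.
have -> : B - A = (Y - A) - (Y - B) by ring.
by rewrite [eps]splitr (le_trans (ler_normB _ _)) // lerD // ltW.
Qed.

End Schwarz.

(** * Functions of (s, x) *)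

Section SpaceTime.
Context {R : realType} {n : nat}.
Notation S := 'rV[R]_n.
Notation V := (R * 'rV[R]_n)%type.

Lemma norm_coord (x : S) i : `|x 0 i| <= `|x|.
Proof.
rewrite [leRHS]/Num.Def.normr /= mx_normrE.
by apply: (le_bigmax _ (fun ij : 'I_1 * 'I_n => `|x ij.1 ij.2|) (0, i)).
Qed.

Lemma norm_row_le (x : S) c : 0 <= c -> (forall i, `|x 0 i| <= c) -> `|x| <= c.
Proof.
move=> c0 H; rewrite [leLHS]/Num.Def.normr /= mx_normrE.
by apply: bigmax_le => //= -[i j] _ /=; rewrite (ord1 i).
Qed.

Lemma norm_delta (i : 'I_n) : `|delta_mx 0 i : S| = 1.
Proof.
apply/eqP; rewrite eq_le norm_row_le //=.
  by rewrite (le_trans _ (norm_coord _ i)) // mxE !eqxx normr1.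
by move=> j; rewrite mxE; case: (_ && _); rewrite ?normr1 ?normr0.
Qed.

Lemma norm_pair (p : V) : `|p| = Num.max `|p.1| `|p.2|.
Proof. by case: p. Qed.

Definition st_vec (j : option 'I_n) : V :=
  if j is Some i then (0, delta_mx 0 i) else (1, 0).

Definition st_coord (j : option 'I_n) (p : V) : R :=
  if j is Some i then p.2 0 i else p.1.

Lemma sum_option (E : zmodType) (F : option 'I_n -> E) :
  \sum_j F j = F None + \sum_i F (Some i).
Proof.
rewrite (bigD1 None) //=; congr (_ + _).
rewrite (reindex_omap Some id) //=; last by case.
by apply: eq_bigl => i; rewrite eqxx.
Qed.

Lemma sum_pair (I : finType) (F : I -> V) :
  \sum_i F i = (\sum_i (F i).1, \sum_i (F i).2).
Proof. by elim/big_rec3 : _ => // i a b c _ ->. Qed.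

Lemma st_sum (p : V) : p = \sum_j st_coord j p *: st_vec j.
Proof.
rewrite sum_option sum_pair /=; case: p => s x /=.
congr (_, _) => /=.
  rewrite big1 ?addr0; first by rewrite [s%:A]mulr1.
  by move=> i _; rewrite scaler0.
by rewrite scaler0 add0r -row_sum_delta.
Qed.

Lemma st_le j (p : V) : `|st_coord j p| <= `|p|.
Proof.
rewrite norm_pair le_max; case: j => [i|] /=; last by rewrite lexx.
by rewrite norm_coord orbT.
Qed.

Lemma st_lin j a (u v : V) : st_coord j (a *: u + v) = a * st_coord j u + st_coord j v.
Proof. by case: j => [i|] //=; rewrite !mxE. Qed.

Definition st_coordinates : coordinates V (option 'I_n) :=
  Coordinates st_sum st_le st_lin.

Definition dx (i : 'I_n) (f : V -> R) : V -> R := 'D_((0, delta_mx 0 i) : V) f.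
Definition dt (f : V -> R) : V -> R := 'D_((1, 0) : V) f.
Definition dxs (a : seq 'I_n) (f : V -> R) : V -> R := foldr dx f a.

Lemma st_chain (W : normedModType R) (f : V -> R) (Th : W -> V) p w a0
    (a : 'I_n -> R) : smooth f -> is_derive p w (fun q => (Th q).1) a0 ->
  (forall j, is_derive p w (fun q => (Th q).2 0 j) (a j)) ->
  is_derive p w (fun q => f (Th q)) (a0 * dt f (Th p) + \sum_j a j * dx j f (Th p)).
Proof.
move=> sf H0 H.
have := @chain_rule _ _ _ st_coordinates W f Th p w
  (fun j => if j is Some i then a i else a0) sf.
rewrite sum_option; apply; by case.
Qed.

Lemma derive_st (f : V -> R) p (w : V) : smooth f ->
  'D_w f p = w.1 * dt f p + \sum_j w.2 0 j * dx j f p.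
Proof.
move=> sf; rewrite (derive_coord st_coordinates) //.
by rewrite sum_option.
Qed.

Lemma smooth_dx i (f : V -> R) : smooth f -> smooth (dx i f).
Proof. exact: smooth_derive. Qed.

Lemma smooth_dt (f : V -> R) : smooth f -> smooth (dt f).
Proof. exact: smooth_derive. Qed.

Lemma smooth_dxs a (f : V -> R) : smooth f -> smooth (dxs a f).
Proof. by move=> sf; elim: a => [|i a IH]; [exact: sf|exact: smooth_dx IH]. Qed.

Lemma is_derive_dx i (f : V -> R) p : smooth f ->
  is_derive p ((0, delta_mx 0 i) : V) f (dx i f p).
Proof. exact: smooth_is_derive. Qed.

Lemma dxE i (f g : V -> R) :
  (forall p, is_derive p ((0, delta_mx 0 i) : V) f (g p)) -> dx i f = g.
Proof. exact: derive_funE. Qed.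

Lemma dx_comm i j (f : V -> R) : smooth f -> dx i (dx j f) = dx j (dx i f).
Proof. exact: derive_commute. Qed.

Lemma dx_dt i (f : V -> R) : smooth f -> dx i (dt f) = dt (dx i f).
Proof. exact: derive_commute. Qed.

Lemma dxs_cat a b (f : V -> R) : dxs (a ++ b) f = dxs a (dxs b f).
Proof. exact: foldr_cat. Qed.

Lemma dxs_dx a i (f : V -> R) : smooth f -> dxs a (dx i f) = dx i (dxs a f).
Proof.
move=> sf; elim: a => [|j a IH]; first by [].
by rewrite /= IH; apply: dx_comm; exact: smooth_dxs.
Qed.

Lemma dxs_dt a (f : V -> R) : smooth f -> dxs a (dt f) = dt (dxs a f).
Proof.
move=> sf; elim: a => [|j a IH]; first by [].
by rewrite /= IH; apply: dx_dt; exact: smooth_dxs.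
Qed.

Lemma dxD i (f g : V -> R) : smooth f -> smooth g ->
  dx i (fun p => f p + g p) = (fun p => dx i f p + dx i g p).
Proof. by move=> sf sg; apply: dxE => p; apply: is_derive_add; exact: is_derive_dx. Qed.

Lemma dxM i (f g : V -> R) : smooth f -> smooth g ->
  dx i (fun p => f p * g p) = (fun p => f p * dx i g p + dx i f p * g p).
Proof. by move=> sf sg; apply: dxE => p; apply: is_derive_mul; exact: is_derive_dx. Qed.

Lemma dx_sum i (I : Type) (r : seq I) (P : pred I) (F : I -> V -> R) :
  (forall k, P k -> smooth (F k)) ->
  dx i (fun p => \sum_(k <- r | P k) F k p) = (fun p => \sum_(k <- r | P k) dx i (F k) p).
Proof.
by move=> sF; apply: dxE => p; apply: is_derive_bigsum => k Pk; apply: is_derive_dx; exact: sF.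
Qed.

Lemma dx_cst i c : dx i (fun=> c) = (fun=> 0).
Proof. by apply: dxE => p; exact: is_derive_cst. Qed.

Lemma partial_slice i (f : V -> R) s x :
  partial i (fun y => f (s, y)) x = dx i f (s, x).
Proof.
rewrite /partial /dx /derive; set g1 := fun h : R => _; set g2 := fun h : R => _.
suff -> : g1 = g2 by []; apply/funext => h; rewrite /g1 /g2 /=.
congr (_ *: (f _ - _)).
by congr (_, _) => /=; rewrite scaler0 add0r.
Qed.

Lemma partial_sliceE i (f : V -> R) s :
  partial i (fun y => f (s, y)) = (fun x => dx i f (s, x)).
Proof. by apply/funext => x; exact: partial_slice. Qed.

Definition shift_dx (p : V) (i : 'I_n) (h : R) : V := (p.1, p.2 + h *: delta_mx 0 i).

Lemma shift_dxE p i h : p + h *: ((0, delta_mx 0 i) : V) = shift_dx p i h.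
Proof. by congr (_, _); rewrite /= scaler0 addr0. Qed.

Lemma line_dx (f : V -> R) i s x (t : R) : smooth f ->
  is_derive t (1 : R) (fun r => f (s, x + r *: delta_mx 0 i))
    (dx i f (s, x + t *: delta_mx 0 i)).
Proof.
move=> sf; have := @is_derive_line _ _ f (s, x) (0, delta_mx 0 i) t _
  (smooth_is_derive _ _ sf).
have -> : (fun r => f ((s, x) + r *: (0, delta_mx 0 i))) =
    (fun r => f (s, x + r *: delta_mx 0 i)).
  by apply/funext => r; rewrite shift_dxE.
by rewrite shift_dxE.
Qed.

Lemma line_dt (f : V -> R) s x : smooth f ->
  is_derive s (1 : R) (fun r => f (r, x)) (dt f (s, x)).
Proof.
move=> sf; have := @is_derive_line _ _ f (0, x) (1, 0) s _ (smooth_is_derive _ _ sf).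
have E r : (0, x) + r *: (1, 0) = (r, x) :> V.
  by congr (_, _) => /=; rewrite ?scaler0 ?addr0 ?add0r // [r%:A]mulr1.
have -> : (fun r => f ((0, x) + r *: (1, 0))) = (fun r => f (r, x)).
  by apply/funext => r; rewrite E.
by rewrite E.
Qed.

Lemma smooth_fst : smooth (fun p : V => p.1).
Proof.
have E w : 'D_w (fun p : V => p.1) = (fun=> w.1).
  apply: derive_funE => p; exact: (is_derive_coord st_coordinates None).
apply: (@ring_closure_smooth _ _ (eq (fun p : V => p.1))); last exact: closure_gen.
move=> _ <-; split; first by move=> p; exact: cvg_fst.
move=> w; split; last by rewrite E; exact: closure_cst.
by move=> p; have [] := is_derive_coord st_coordinates None p w.
Qed.

Lemma coord_continuous_st (i : 'I_n) : continuous (fun p : V => p.2 0 i).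
Proof.
apply/continuousP_lt => p e e0; exists e => // v hv /=.
by rewrite mxE addrAC subrr add0r (le_lt_trans _ hv) //; exact: (st_le (Some i)).
Qed.

Lemma smooth_coord (i : 'I_n) : smooth (fun p : V => p.2 0 i).
Proof.
have D p w := is_derive_coord st_coordinates (Some i) p w.
have E w : 'D_w (fun p : V => p.2 0 i) = (fun=> w.2 0 i).
  by apply: derive_funE => p; exact: D.
apply: (@ring_closure_smooth _ _ (eq (fun p : V => p.2 0 i))); last exact: closure_gen.
move=> _ <-; split; first exact: coord_continuous_st.
move=> w; split; last by rewrite E; exact: closure_cst.
by move=> p; have [] := D p w.
Qed.

Definition periodicx (f : V -> R) : Prop :=
  forall s, Defs.periodic (fun x => f (s, x)).

Lemma periodicx_derive (f : V -> R) w : periodicx f -> periodicx ('D_w f).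
Proof.
move=> pf s m x; rewrite /derive.
set g1 := fun h : R => _; set g2 := fun h : R => _.
suff -> : g1 = g2 by []; apply/funext => h; rewrite /g1 /g2 /=.
rewrite pf; have -> : h *: w + (s, x + map_mx intr m) =
    (h * w.1 + s, h *: w.2 + x + map_mx intr m) by congr (_, _); rewrite addrA.
by rewrite pf.
Qed.

Lemma periodicx_dxs (f : V -> R) a : periodicx f -> periodicx (dxs a f).
Proof. by move=> pf; elim: a => [|i a IH]; [exact: pf|exact: periodicx_derive IH]. Qed.

Lemma fundamental_domain (x : S) : exists2 m : 'rV[int]_n,
  forall i, 0 <= (x + map_mx intr m) 0 i <= 1 & True.
Proof.
exists (\row_i - Num.floor (x 0 i)) => // i; rewrite !mxE.
have /andP[h1 h2] := floor_itv (x 0 i).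
by move: h1 h2; rewrite rmorphN /= intrD; lra.
Qed.

(** The base point stays in [K] but the increment is free: on a torus [x + v] may leave the unit
    cell to which [x] has been moved. *)
Lemma heine (W : normedModType R) (K : set W) (f : W -> R) : compact K ->
  continuous f -> forall eps, 0 < eps -> exists2 del, 0 < del &
  forall x v, K x -> `|v| < del -> `|f (x + v) - f x| < eps.
Proof.
move=> /compact_near_coveringP cK cf eps eps0.
have : \forall v \near (0 : W), K `<=` (fun x => `|f (x + v) - f x| < eps).
  apply: cK.
  move=> x Kx; have e20 : 0 < eps / 2 by rewrite divr_gt0.
  have [d d0 hd] := (continuousP_lt f).1 cf x _ e20.
  have d20 : 0 < d / 2 by rewrite divr_gt0.
  exists (ball x (d / 2), ball 0 (d / 2)); first by split; exact: nbhsx_ballx.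
  move=> [y v] /= []; rewrite -!ball_normE /ball_ /= sub0r normrN => hy hv.
  have -> : y + v = x + ((y - x) + v) by rewrite addrA [x + _]addrC subrK.
  have -> : f y = f (x + (y - x)) by rewrite [x + _]addrC subrK.
  have -> : f (x + (y - x + v)) - f (x + (y - x)) =
    (f (x + (y - x + v)) - f x) - (f (x + (y - x)) - f x) by ring.
  rewrite [eps]splitr (le_lt_trans (ler_normB _ _)) // ltrD //.
    apply: hd; rewrite [d]splitr (le_lt_trans (ler_normD _ _)) // ltrD //.
    by rewrite distrC.
  by apply: hd; rewrite distrC (lt_le_trans hy) // ler_pdivrMr // ler_peMr ?ler1n // ltW.
move=> /nbhs_ballP[del /= d0 hd].
exists del => // x v Kx hv; apply: hd => //.
by rewrite -ball_normE /ball_ /= sub0r normrN.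
Qed.

Lemma compact_strip (a b : R) :
  compact (`[a, b]%classic `*` [set v : S | forall i, `[0, 1]%classic (v ord0 i)] : set V).
Proof.
apply: compact_setX; first exact: segment_compact.
have K2 : compact [set v : S | forall i, v ord0 i \in `[(0 : R), 1]].
  apply: (@rV_compact _ _ (fun=> `[(0 : R), 1]%classic)).
  by move=> _; exact: segment_compact.
exact: K2.
Qed.

(** An integer translation moves the base point into the unit cell; this is compactness of the torus
    times a time interval. *)
Lemma periodic_unif (f : V -> R) (a b : R) : continuous f -> periodicx f ->
  forall eps, 0 < eps -> exists2 del, 0 < del &
  forall s x v, a <= s <= b -> `|v| < del -> `|f ((s, x) + v) - f (s, x)| < eps.
Proof.
move=> cf pf eps eps0; have [d d0 hd] := heine (@compact_strip a b) cf eps0.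
exists d => // s x v hs hv; have [m hm _] := fundamental_domain x.
have -> : f ((s, x) + v) = f ((s, x + map_mx intr m) + v).
  have -> : (s, x + map_mx intr m) + v = (s + v.1, x + v.2 + map_mx intr m) :> V.
    by congr (_, _); rewrite addrAC.
  by rewrite pf.
rewrite -(pf s m x); apply: hd; last exact: hv.
split; first by rewrite /= in_itv.
by move=> i /=; rewrite in_itv; exact: hm.
Qed.

Lemma periodic_bounded (f : V -> R) (a b : R) : continuous f -> periodicx f ->
  exists2 C, 0 <= C & forall s x, a <= s <= b -> `|f (s, x)| <= C.
Proof.
move=> cf pf.
have /compact_bounded[M [_ hM]] :=
  continuous_compact (@continuous_subspaceT _ _ _ f cf) (@compact_strip a b).
exists (`|M| + 1); first by rewrite addr_ge0.
move=> s x hs; have [m hm _] := fundamental_domain x.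
rewrite -(pf s m x); apply: hM; first by rewrite (le_lt_trans (ler_norm M)) // ltrDl.
exists (s, x + map_mx intr m); last by [].
split; first by rewrite /= in_itv.
by move=> i /=; rewrite in_itv; exact: hm.
Qed.

End SpaceTime.

(** * Averages of periodic functions *)

Section UnitIntegral.
Context {R : realType}.
Implicit Types g h P Q : R -> R.

Definition int01 g : R := (\int[@lebesgue_measure R]_(x in `[0, 1]) g x)%R.

(** The primitive is the integral from [- N]. An open window containing [0, 1] suffices below and
    gives two-sided derivatives at both endpoints. *)
Lemma local_primitive g (N : R) : continuous g ->
  exists P, forall s : R, - N < s < N -> is_derive s (1 : R) P (g s).
Proof.
move=> cg; exists (fun x => \int[@lebesgue_measure R]_(t in `[- N, x]) g t)%R.
move=> s /andP[s1 s2].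
have ig : (@lebesgue_measure R).-integrable `[- N, N] (EFin \o g).
  apply: continuous_compact_integrable; first exact: segment_compact.
  exact: continuous_subspaceT.
have [d e] := @continuous_FTC1_closed R g (- N) s N s2 ig s1 (cg s).
by split; [exact: d|rewrite -derive1E].
Qed.

Lemma int01E g P : continuous g ->
  (forall s : R, -1 < s < 2 -> is_derive s (1 : R) P (g s)) -> int01 g = P 1 - P 0.
Proof.
move=> cg dP.
have cP s : -1 < s < 2 -> {for s, continuous P}.
  move=> hs; apply/differentiable_continuous/derivable1_diffP.
  by have [] := dP _ hs.
rewrite /int01 /Rintegral (@continuous_FTC2 R g P 0 1) //.
- exact: continuous_subspaceT.
- split.
  + move=> s; rewrite in_itv /= => /andP[s0 s1].
    by have [] : is_derive s (1 : R) P (g s) by apply: dP; lra.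
  + by apply: cvg_at_right_filter; apply: cP; lra.
  + by apply: cvg_at_left_filter; apply: cP; lra.
- move=> s; rewrite inE /= => hs; have {hs} : s \in `]0, 1[ by [].
  rewrite in_itv /= => /andP[s0 s1].
  by rewrite derive1E; have [] : is_derive s (1 : R) P (g s) by apply: dP; lra.
Qed.

Lemma primitive01 g : continuous g ->
  exists2 P : R -> R, forall s : R, -1 < s < 2 -> is_derive s (1 : R) P (g s) & int01 g = P 1 - P 0.
Proof.
move=> cg; have [P hP] := local_primitive 2 cg.
have hP' (s : R) : -1 < s < 2 -> is_derive s (1 : R) P (g s).
  by move=> hs; apply: hP; lra.
by exists P => //; exact: int01E.
Qed.

(** The mean value theorem inside a window of differentiability, for the primitives above. A sign of
    [dP] then yields monotonicity. *)
Lemma nondecreasing_derive P (dP : R -> R) (lo hi a b : R) :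
  (forall s : R, lo < s < hi -> is_derive s (1 : R) P (dP s)) ->
  lo < a -> a <= b -> b < hi ->
  exists2 c, a <= c <= b & P b - P a = dP c * (b - a).
Proof.
move=> hP la ab bh.
have [||c] := @MVT_segment _ P dP a b ab.
- by move=> x; rewrite in_itv /= => /andP[xa xb]; apply: hP; lra.
- apply: derivable_within_continuous => x; rewrite in_itv /= => /andP[xa xb].
  by have [] : is_derive x (1 : R) P (dP x) by apply: hP; lra.
- by rewrite in_itv /= => hc E; exists c.
Qed.

Let lt_m1_0 : (-1 : R) < 0. Proof. by rewrite ltrN10. Qed.
Let lt_1_2 : (1 : R) < 2. Proof. by rewrite ltr1n. Qed.

Lemma int01_le g h : continuous g -> continuous h ->
  (forall s, 0 <= s <= 1 -> g s <= h s) -> int01 g <= int01 h.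
Proof.
move=> cg ch gh; have [P dP ->] := primitive01 cg; have [Q dQ ->] := primitive01 ch.
have dD (s : R) : -1 < s < 2 -> is_derive s (1 : R) (Q \- P) (h s - g s).
  by move=> hs; apply: is_deriveB; [exact: dQ|exact: dP].
have [c /gh gc /= E] := nondecreasing_derive dD lt_m1_0 ler01 lt_1_2.
by move: E gc; nra.
Qed.

Lemma int01D g h : continuous g -> continuous h ->
  int01 (fun s => g s + h s) = int01 g + int01 h.
Proof.
move=> cg ch; have [P dP ->] := primitive01 cg; have [Q dQ ->] := primitive01 ch.
have c2 : continuous (fun s => g s + h s).
  by move=> s; apply: cvgD; [exact: cg|exact: ch].
have d2 (s : R) : -1 < s < 2 ->
    is_derive s (1 : R) (fun s => P s + Q s) (g s + h s).
  by move=> hs; apply: is_derive_add; [exact: dP|exact: dQ].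
by rewrite (int01E c2 d2); ring.
Qed.

Lemma int01Z g k : continuous g -> int01 (fun s => k * g s) = k * int01 g.
Proof.
move=> cg; have [P dP ->] := primitive01 cg.
have c2 : continuous (fun s => k * g s).
  by move=> s; apply: cvgM; [exact: cvg_cst|exact: cg].
have d2 (s : R) : -1 < s < 2 -> is_derive s (1 : R) (fun s => k * P s) (k * g s).
  move=> hs; have := is_derive_mul (is_derive_cst k s (1 : R)) (dP s hs).
  by rewrite mul0r addr0.
by rewrite (int01E c2 d2); ring.
Qed.

Lemma int01_cst k : int01 (fun=> k) = k.
Proof.
have c2 : continuous (fun _ : R => k) by move=> s; exact: cvg_cst.
have d2 (s : R) : -1 < s < 2 -> is_derive s (1 : R) (fun s => s * k) k.
  move=> _; have := is_derive_mul (is_derive_id s (1 : R)) (is_derive_cst k s (1 : R)).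
  by rewrite mulr0 add0r mul1r.
by rewrite (int01E c2 d2); ring.
Qed.

(** For a primitive P, the difference P (r + 1) - P r has derivative zero by periodicity, so it
    takes the same value at 0 and at [a]. *)
Lemma int01_shift g a : continuous g -> (forall s, g (s + 1) = g s) ->
  int01 (fun s => g (s + a)) = int01 g.
Proof.
(* Wide enough for [P] to be differentiable on (-1, 2), on its translate by [a], and one unit to the
   right of the segment from 0 to [a]. *)
move=> cg pg; pose N : R := `|a| + 3.
have aN : - (N - 3) <= a <= N - 3 by rewrite /N addrK -ler_norml.
have [P dP] := local_primitive N cg.
have sh (b s : R) : - N < s + b < N -> is_derive s (1 : R) (fun r => P (r + b)) (g (s + b)).
  move=> /dP /is_deriveP H; apply/is_deriveP => e /H[d d0 hd].
  by exists d => // h h0 hh; have := hd h h0 hh; rewrite [h%:A]mulr1 addrAC.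
have N3 : 3 <= N by rewrite lerDr.
have c2 : continuous (fun s => g (s + a)).
  move=> s; apply: (@continuous_comp _ _ _ (fun s => s + a)); last exact: cg.
  by apply: cvgD; [exact: cvg_id|exact: cvg_cst].
have d2 (s : R) : -1 < s < 2 ->
    is_derive s (1 : R) (fun s => P (s + a)) (g (s + a)).
  by move=> hs; apply: sh; lra.
have d3 (s : R) : -1 < s < 2 -> is_derive s (1 : R) P (g s).
  by move=> hs; apply: dP; lra.
rewrite (int01E c2 d2) (int01E cg d3).
have dD (s : R) : - N < s < N - 1 -> is_derive s (1 : R) (fun r => P (r + 1) - P r) 0.
  move=> hs; have h1 : - N < s + 1 < N by lra.
  have h2 : - N < s < N by lra.
  have := is_derive_add (sh 1 s h1) (is_deriveN (dP s h2)).
  by rewrite pg subrr.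
rewrite add0r [1 + a]addrC.
have [a0|/ltW a0] := leP 0 a.
  have h1 : - N < 0 by lra.
  have h2 : a < N - 1 by lra.
  by have [c _] := nondecreasing_derive dD h1 a0 h2; rewrite mul0r add0r; lra.
have h1 : - N < a by lra.
have h2 : 0 < N - 1 by lra.
by have [c _] := nondecreasing_derive dD h1 a0 h2; rewrite mul0r add0r; lra.
Qed.

(** If Q is a primitive of |dg|, both Q + g and Q - g are nondecreasing. *)
Lemma osc_le g dg : (forall s : R, is_derive s (1 : R) g (dg s)) -> continuous dg ->
  forall s, 0 <= s <= 1 -> `|g s - g 0| <= int01 (fun s => `|dg s|).
Proof.
move=> hg cdg s /andP[s0 s1].
have cn : continuous (fun s => `|dg s|).
  by move=> x; apply: cvg_norm; exact: cdg.
have [Q dQ ->] := primitive01 cn.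
have QQ : Q s - Q 0 <= Q 1 - Q 0.
  have h1 : -1 < s by lra.
  have [c hc] := nondecreasing_derive dQ h1 s1 lt_1_2.
  have := normr_ge0 (dg c); nra.
apply: le_trans QQ; rewrite ler_norml.
have dD (k x : R) : -1 < x < 2 -> is_derive x (1 : R) (fun y => Q y + k * g y)
    (`|dg x| + k * dg x).
  move=> hx; have := is_derive_mul (is_derive_cst k x (1 : R)) (hg x).
  by rewrite mul0r addr0; exact: (is_derive_add (dQ x hx)).
have s2 : s < 2 by lra.
have [c1 hc1 E1] := nondecreasing_derive (dD 1) lt_m1_0 s0 s2.
have [c2 hc2 E2] := nondecreasing_derive (dD (-1)) lt_m1_0 s0 s2.
have := ler_norm (dg c2); have := ler_norm (- dg c1); rewrite normrN.
move: E1 E2 => /=; nra.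
Qed.

(** One-dimensional Sobolev embedding: the mean of |g| plus the oscillation. It is stated at 0 only,
    and reaches every point when applied on lines with an arbitrary origin. *)
Lemma sup_le_int01 g dg : (forall s : R, is_derive s (1 : R) g (dg s)) -> continuous dg ->
  `|g 0| <= int01 (fun s => `|g s|) + int01 (fun s => `|dg s|).
Proof.
move=> hg cdg.
have cg : continuous (fun s => `|g s|).
  move=> s; apply: cvg_norm.
  by apply: differentiable_continuous; apply/derivable1_diffP; have [] := hg s.
set D := int01 (fun s => `|dg s|).
have c1 (k : R) : continuous (fun _ : R => k) by move=> s; exact: cvg_cst.
rewrite -[leLHS]int01_cst -[D]int01_cst -(int01D cg (c1 D)).
apply: int01_le; first by move=> s; exact: cvg_cst.
  by move=> s; apply: cvgD; [exact: cg|exact: cvg_cst].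
move=> s hs; have := osc_le hg cdg hs; rewrite -/D distrC => q.
rewrite -[g 0](subrK (g s)) (le_trans (ler_normD _ _)) // addrC lerD2l //.
Qed.

Lemma mean0_le_int01 g dg : (forall s : R, is_derive s (1 : R) g (dg s)) ->
  continuous dg -> int01 g = 0 -> `|g 0| <= int01 (fun s => `|dg s|).
Proof.
move=> hg cdg g0.
have cg : continuous g.
  by move=> s; apply: differentiable_continuous; apply/derivable1_diffP; have [] := hg s.
set D := int01 (fun s => `|dg s|); have H := osc_le hg cdg; rewrite -/D in H.
have c1 (k : R) : continuous (fun _ : R => k) by move=> s; exact: cvg_cst.
rewrite ler_norml; apply/andP; split.
  have : int01 g <= int01 (fun=> g 0 + D).
    by apply: int01_le => // s /H; rewrite ler_norml => /andP[]; lra.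
  by rewrite g0 int01_cst; lra.
have : int01 (fun=> g 0 - D) <= int01 g.
  by apply: int01_le => // s /H; rewrite ler_norml => /andP[]; lra.
by rewrite g0 int01_cst; lra.
Qed.

(** On [0, d] the function stays above g 0 - L d, and the rest of the integral is nonnegative. A
    small mean thus forces a small value. *)
Lemma lipschitz_le_int01 g L d : continuous g -> (forall s, 0 <= g s) ->
  (forall s, `|g s - g 0| <= L * `|s|) -> 0 <= L -> 0 < d <= 1 ->
  d * (g 0 - L * d) <= int01 g.
Proof.
move=> cg g0 gL L0 /andP[d0 d1]; have [P dP ->] := primitive01 cg.
have d2 : d < 2 by lra.
have md : -1 < d by lra.
have [c1 hc1 E1] := nondecreasing_derive dP lt_m1_0 (ltW d0) d2.
have [c2 hc2 E2] := nondecreasing_derive dP md d1 lt_1_2.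
have /andP[c10 c1d] := hc1.
have : g 0 - L * d <= g c1.
  have := gL c1; rewrite (ger0_norm c10) distrC => /(le_trans (ler_norm _)).
  have : L * c1 <= L * d by rewrite ler_wpM2l.
  lra.
move: E1 E2 (g0 c2) => /=; nra.
Qed.

(** Riemann sums are combinations of translates, so this error bound lets translation invariance do
    the work of Fubini in [Avg_avg1]. *)
Lemma int01_riemann g eps (N : nat) : continuous g -> (0 < N)%N ->
  (forall s t, `|t - s| <= N%:R^-1 -> `|g t - g s| <= eps) ->
  `|int01 g - N%:R^-1 * \sum_(k < N) g (k%:R / N%:R)| <= eps.
Proof.
move=> cg N0 H; have [P dP ->] := primitive01 cg.
have Np : (0 : R) < N%:R by rewrite ltr0n.
have -> : P 1 - P 0 = \sum_(k < N) (P (k.+1%:R / N%:R) - P (k%:R / N%:R)).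
  rewrite -(big_mkord xpredT (fun k => P (k.+1%:R / N%:R) - P (k%:R / N%:R))).
  by rewrite telescope_sumr // mul0r divff // gt_eqF.
rewrite mulr_sumr -sumrB (le_trans (ler_norm_sum _ _ _)) //.
apply: (@le_trans _ _ (\sum_(k < N) N%:R^-1 * eps)); last first.
  rewrite sumr_const card_ord -[_ *+ N]mulr_natl mulrA divff ?mul1r //.
  by rewrite gt_eqF.
apply: ler_sum => k _.
have k1 : (k.+1%:R : R) <= N%:R by rewrite ler_nat.
have st : k.+1%:R / N%:R - k%:R / N%:R = N%:R^-1 :> R.
  by rewrite -mulrBl -natrB ?leqnSn // subSnn mul1r.
have ki : (0 : R) < N%:R^-1 by rewrite invr_gt0.
have kk0 : (0 : R) <= k%:R / N%:R by rewrite divr_ge0.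
have kk1 : k.+1%:R / N%:R <= (1 : R) by rewrite ler_pdivrMr // mul1r.
have h1 : -1 < k%:R / N%:R :> R by lra.
have h2 : k%:R / N%:R <= k.+1%:R / N%:R :> R by lra.
have h3 : k.+1%:R / N%:R < 2 :> R by lra.
have [c hc ->] := nondecreasing_derive dP h1 h2 h3.
rewrite st mulrC -mulrBr normrM gtr0_norm // ler_pM2l //; apply: H.
by rewrite ger0_norm; lra.
Qed.

End UnitIntegral.

Section Continuity.
Context {R : realType} (V : normedModType R).
Implicit Types f g : V -> R.

Lemma cont_add f g : continuous f -> continuous g -> continuous (fun x => f x + g x).
Proof. by move=> cf cg x; apply: cvgD; [exact: cf|exact: cg]. Qed.

Lemma cont_mul f g : continuous f -> continuous g -> continuous (fun x => f x * g x).
Proof. by move=> cf cg x; apply: cvgM; [exact: cf|exact: cg]. Qed.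

Lemma cont_opp f : continuous f -> continuous (fun x => - f x).
Proof. by move=> cf x; apply: cvgN; exact: cf. Qed.

Lemma cont_norm f : continuous f -> continuous (fun x => `|f x|).
Proof. by move=> cf x; apply: cvg_norm; exact: cf. Qed.

Lemma cont_comp f (u : R -> R) : continuous u -> continuous f -> continuous (fun x => u (f x)).
Proof. by move=> cu cf x; apply: continuous_comp; [exact: cf|exact: cu]. Qed.

End Continuity.

(** * Means over the torus and functional inequalities for them *)

Section TorusAverage.
Context {R : realType} {n : nat}.
Notation S := 'rV[R]_n.
Notation V := (R * 'rV[R]_n)%type.
Notation e i := (delta_mx 0 i : S).
Implicit Types (g h : S -> R) (L : seq 'I_n).

Definition cont_periodic g : Prop := continuous g /\ Defs.periodic g.

Lemma cp_cst (k : R) : cont_periodic (fun=> k).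
Proof. by split; [exact: cst_continuous|move=> m x]. Qed.

Lemma cpD g h : cont_periodic g -> cont_periodic h ->
  cont_periodic (fun x => g x + h x).
Proof.
move=> [cg pg] [ch ph]; split; last by move=> m x; rewrite pg ph.
exact: (cont_add cg ch).
Qed.

Lemma cpM g h : cont_periodic g -> cont_periodic h ->
  cont_periodic (fun x => g x * h x).
Proof.
move=> [cg pg] [ch ph]; split; last by move=> m x; rewrite pg ph.
exact: (cont_mul cg ch).
Qed.

Lemma cpZ (k : R) g : cont_periodic g -> cont_periodic (fun x => k * g x).
Proof. by move=> cg; apply: cpM => //; exact: cp_cst. Qed.

Lemma cpN g : cont_periodic g -> cont_periodic (fun x => - g x).
Proof.
move=> [cg pg]; split; last by move=> m x; rewrite pg.
exact: (cont_opp cg).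
Qed.

Lemma cpB g h : cont_periodic g -> cont_periodic h ->
  cont_periodic (fun x => g x - h x).
Proof. by move=> cg ch; apply: cpD => //; exact: cpN. Qed.

Lemma cp_norm g : cont_periodic g -> cont_periodic (fun x => `|g x|).
Proof.
move=> [cg pg]; split; last by move=> m x; rewrite pg.
exact: (cont_norm cg).
Qed.

Lemma cp_comp g (u : R -> R) : continuous u -> cont_periodic g ->
  cont_periodic (fun x => u (g x)).
Proof.
move=> cu [cg pg]; split; last by move=> m x; rewrite pg.
exact: (cont_comp cu cg).
Qed.

Lemma cp_sum (I : Type) (r : seq I) (P : pred I) (F : I -> S -> R) :
  (forall i, P i -> cont_periodic (F i)) ->
  cont_periodic (fun x => \sum_(i <- r | P i) F i x).
Proof.
move=> H; elim: r => [|i r IH].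
  have -> : (fun x => \sum_(i <- [::] | P i) F i x) = (fun=> 0).
    by apply/funext => q; rewrite big_nil.
  exact: cp_cst.
have -> : (fun q => \sum_(j <- i :: r | P j) F j q) =
    (fun q => if P i then F i q + \sum_(j <- r | P j) F j q
              else \sum_(j <- r | P j) F j q).
  by apply/funext => q; rewrite big_cons.
case Pi: (P i); last exact: IH.
by apply: cpD; [exact: H|exact: IH].
Qed.

Lemma cp_slice (f : V -> R) s : continuous f -> periodicx f ->
  cont_periodic (fun x => f (s, x)).
Proof.
move=> cf pf; split; last exact: pf.
apply/continuousP_lt => x eps eps0.
have [d d0 hd] := (continuousP_lt f).1 cf (s, x) _ eps0.
exists d => // v hv; have := hd (0, v).
have -> : (s, x) + (0, v) = (s, x + v) :> V by congr (_, _); rewrite /= addr0.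
by apply; rewrite norm_pair /= normr0 gt_max d0.
Qed.

Lemma cp_lift g : cont_periodic g ->
  continuous (fun p : V => g p.2) /\ periodicx (fun p : V => g p.2).
Proof.
move=> [cg pg]; split; last by move=> s m x; exact: pg.
apply/continuousP_lt => p eps eps0.
have [d d0 hd] := (continuousP_lt g).1 cg p.2 _ eps0.
by exists d => // v; rewrite norm_pair gt_max => /andP[_ /hd].
Qed.

Lemma cp_unif g : cont_periodic g -> forall eps, 0 < eps ->
  exists2 del, 0 < del & forall x v, `|v| < del -> `|g (x + v) - g x| < eps.
Proof.
move=> /cp_lift[cg pg] eps eps0.
have [d d0 hd] := periodic_unif 0 0 cg pg eps0.
exists d => // x v hv; have := hd 0 x (0, v).
rewrite lexx /=; apply=> //.
by rewrite norm_pair /= normr0 gt_max d0.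
Qed.

Lemma cp_line g x (v : S) : cont_periodic g -> continuous (fun s : R => g (x + s *: v)).
Proof.
move=> [cg _]; apply/continuousP_lt => s eps eps0.
have [d d0 hd] := (continuousP_lt g).1 cg (x + s *: v) _ eps0.
have v0 : 0 < `|v| + 1 by rewrite ltr_wpDl.
exists (d / (`|v| + 1)); first by rewrite divr_gt0.
move=> r hr; rewrite scalerDl addrA; apply: hd; rewrite normrZ.
apply: (@le_lt_trans _ _ (`|r| * (`|v| + 1))); last by rewrite -ltr_pdivlMr.
by rewrite ler_wpM2l // lerDl.
Qed.

Definition avg1 i g (x : S) : R := int01 (fun s => g (x + s *: e i)).
Definition avg L g : S -> R := foldr avg1 g L.
(** The mean over the torus as an iterated integral. It is evaluated at the origin, but [avg_const]
    shows that every base point gives the same value. *)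
Definition Avg g : R := avg (enum 'I_n) g 0.

Lemma avg1_le i g h x : cont_periodic g -> cont_periodic h ->
  (forall y, g y <= h y) -> avg1 i g x <= avg1 i h x.
Proof. by move=> cg ch gh; apply: int01_le => //; exact: cp_line. Qed.

Lemma avg1D i g h : cont_periodic g -> cont_periodic h ->
  avg1 i (fun y => g y + h y) = (fun x => avg1 i g x + avg1 i h x).
Proof.
by move=> cg ch; apply/funext => x; rewrite /avg1 int01D //; exact: cp_line.
Qed.

Lemma avg1Z i g k : cont_periodic g ->
  avg1 i (fun y => k * g y) = (fun x => k * avg1 i g x).
Proof. by move=> cg; apply/funext => x; rewrite /avg1 int01Z //; exact: cp_line. Qed.

Lemma avg1_cst i (k : R) : avg1 i (fun=> k) = (fun=> k).
Proof. by apply/funext => x; exact: int01_cst. Qed.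

Lemma avg1_shift i g (v x : S) : avg1 i (fun y => g (y + v)) x = avg1 i g (x + v).
Proof. by rewrite /avg1; congr int01; apply/funext => s; rewrite addrAC. Qed.

Lemma cp_shift g (v : S) : cont_periodic g -> cont_periodic (fun x => g (x + v)).
Proof.
move=> [cg pg]; split; last by move=> m x; rewrite addrAC pg.
apply/continuousP_lt => x eps eps0.
have [d d0 hd] := (continuousP_lt g).1 cg (x + v) _ eps0.
by exists d => // w hw; rewrite addrAC; exact: hd.
Qed.

Lemma avg1_close i g h eps x : cont_periodic g -> cont_periodic h ->
  (forall y, `|g y - h y| <= eps) -> `|avg1 i g x - avg1 i h x| <= eps.
Proof.
move=> cg ch H.
have cc := cp_cst eps.
have h1 : avg1 i g x <= avg1 i h x + eps.
  rewrite -[eps in X in _ <= X](int01_cst eps).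
  have -> : avg1 i h x + int01 (fun=> eps) = avg1 i (fun y => h y + eps) x.
    by rewrite avg1D // avg1_cst int01_cst.
  apply: avg1_le => //; first exact: cpD.
  by move=> y; have := H y; rewrite ler_norml => /andP[]; lra.
have h2 : avg1 i h x <= avg1 i g x + eps.
  rewrite -[eps in X in _ <= X](int01_cst eps).
  have -> : avg1 i g x + int01 (fun=> eps) = avg1 i (fun y => g y + eps) x.
    by rewrite avg1D // avg1_cst int01_cst.
  apply: avg1_le => //; first exact: cpD.
  by move=> y; have := H y; rewrite ler_norml => /andP[]; lra.
by rewrite ler_norml; lra.
Qed.

Lemma cp_avg1 i g : cont_periodic g -> cont_periodic (avg1 i g).
Proof.
move=> cg; split; last first.
  move=> m x; rewrite -avg1_shift.
  by rewrite (_ : (fun y => _) = g) //; apply/funext => y; exact: cg.2.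
apply/continuousP_lt => x eps eps0; have e20 : 0 < eps / 2 by rewrite divr_gt0.
have [d d0 hd] := cp_unif cg e20; exists d => // v hv.
rewrite -avg1_shift; apply: (@le_lt_trans _ _ (eps / 2)); last first.
  by rewrite ltr_pdivrMr // ltr_pMr // ltr1n.
apply: avg1_close => //; first exact: cp_shift.
by move=> y; apply/ltW/hd.
Qed.

Lemma cp_avg L g : cont_periodic g -> cont_periodic (avg L g).
Proof. by move=> cg; elim: L => [|i L IH]; [exact: cg|exact: cp_avg1 IH]. Qed.

Lemma avg_le L g h x : cont_periodic g -> cont_periodic h ->
  (forall y, g y <= h y) -> avg L g x <= avg L h x.
Proof.
move=> cg ch gh; elim: L x => [|i L IH] x; first exact: gh.
by apply: avg1_le => //; exact: cp_avg.
Qed.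

Lemma avgD L g h : cont_periodic g -> cont_periodic h ->
  avg L (fun y => g y + h y) = (fun x => avg L g x + avg L h x).
Proof.
move=> cg ch; elim: L => [|i L IH] //=.
by rewrite IH avg1D //; exact: cp_avg.
Qed.

Lemma avgZ L g k : cont_periodic g -> avg L (fun y => k * g y) = (fun x => k * avg L g x).
Proof.
move=> cg; elim: L => [|i L IH] //=.
by rewrite IH avg1Z //; exact: cp_avg.
Qed.

Lemma avg_cst L (k : R) : avg L (fun=> k) = (fun=> k).
Proof. by elim: L => [|i L IH] //=; rewrite IH avg1_cst. Qed.

Lemma avg_shift L g (v : S) : avg L (fun y => g (y + v)) = (fun x => avg L g (x + v)).
Proof.
by elim: L => [|i L IH] //=; rewrite IH; apply/funext => x; rewrite avg1_shift.
Qed.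

Lemma avg1_invariant i g (x : S) (h : R) : cont_periodic g ->
  avg1 i g (x + h *: e i) = avg1 i g x.
Proof.
move=> cg; rewrite /avg1 -(@int01_shift _ (fun s => g (x + s *: e i)) h).
- congr int01; apply/funext => s.
  by rewrite scalerDl -addrA [_ *: _ + _ *: _]addrC.
- exact: cp_line.
- move=> s; rewrite scalerDl scale1r addrA.
  have -> : e i = map_mx intr (delta_mx 0 i : 'rV[int]_n) :> S.
    by apply/matrixP => a b; rewrite !mxE; case: (_ && _).
  exact: cg.2.
Qed.

Lemma avg_invariant L g i (x : S) (h : R) : cont_periodic g -> i \in L ->
  avg L g (x + h *: e i) = avg L g x.
Proof.
move=> cg; elim: L x => [|j L IH] x //=; rewrite inE => /predU1P[->|iL].
  by apply: avg1_invariant; exact: cp_avg.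
rewrite -avg1_shift.
suff -> : (fun y => avg L g (y + h *: e i)) = avg L g by [].
by apply/funext => y; exact: IH.
Qed.

Lemma avg_const g x : cont_periodic g -> avg (enum 'I_n) g x = Avg g.
Proof.
move=> cg.
have H (r : seq 'I_n) y : avg (enum 'I_n) g (y + \sum_(j <- r) x 0 j *: e j) =
    avg (enum 'I_n) g y.
  elim: r y => [|i r IH] y; first by rewrite big_nil addr0.
  by rewrite big_cons addrA IH avg_invariant // mem_enum.
by rewrite /Avg {1}[x]row_sum_delta -[\sum_j _]add0r H.
Qed.

Lemma Avg_le g h : cont_periodic g -> cont_periodic h ->
  (forall y, g y <= h y) -> Avg g <= Avg h.
Proof. exact: avg_le. Qed.

Lemma AvgD g h : cont_periodic g -> cont_periodic h ->
  Avg (fun y => g y + h y) = Avg g + Avg h.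
Proof. by move=> cg ch; rewrite /Avg avgD. Qed.

Lemma AvgZ g k : cont_periodic g -> Avg (fun y => k * g y) = k * Avg g.
Proof. by move=> cg; rewrite /Avg avgZ. Qed.

Lemma Avg_cst (k : R) : Avg (fun=> k) = k.
Proof. by rewrite /Avg avg_cst. Qed.

Lemma AvgN g : cont_periodic g -> Avg (fun y => - g y) = - Avg g.
Proof.
move=> cg; rewrite -mulN1r -AvgZ //; congr Avg.
by apply/funext => y; rewrite mulN1r.
Qed.

Lemma AvgB g h : cont_periodic g -> cont_periodic h ->
  Avg (fun y => g y - h y) = Avg g - Avg h.
Proof. by move=> cg ch; rewrite AvgD ?AvgN //; exact: cpN. Qed.

Lemma Avg_sum (I : Type) (r : seq I) (F : I -> S -> R) :
  (forall i, cont_periodic (F i)) ->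
  Avg (fun y => \sum_(i <- r) F i y) = \sum_(i <- r) Avg (F i).
Proof.
move=> H; elim: r => [|i r IH].
  rewrite big_nil -[RHS]Avg_cst; congr Avg.
  by apply/funext => y; rewrite big_nil.
rewrite big_cons -IH -AvgD //; last exact: cp_sum.
by congr Avg; apply/funext => y; rewrite big_cons.
Qed.

Lemma Avg_shift g (v : S) : cont_periodic g -> Avg (fun y => g (y + v)) = Avg g.
Proof. by move=> cg; rewrite {1}/Avg avg_shift avg_const. Qed.

Lemma Avg_ge0 g : cont_periodic g -> (forall y, 0 <= g y) -> 0 <= Avg g.
Proof.
by move=> cg g0; rewrite -(Avg_cst 0); apply: Avg_le => //; exact: cp_cst.
Qed.

Lemma Avg_close g h eps : cont_periodic g -> cont_periodic h ->
  (forall y, `|g y - h y| <= eps) -> `|Avg g - Avg h| <= eps.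
Proof.
move=> cg ch H; have cc := cp_cst eps.
have h1 : Avg g <= Avg (fun y => h y + eps).
  apply: Avg_le => //; first exact: cpD.
  by move=> y; have := H y; rewrite ler_norml => /andP[]; lra.
have h2 : Avg h <= Avg (fun y => g y + eps).
  apply: Avg_le => //; first exact: cpD.
  by move=> y; have := H y; rewrite ler_norml => /andP[]; lra.
by move: h1 h2; rewrite !AvgD // !Avg_cst ler_norml; lra.
Qed.

(** [Avg] is linear and translation invariant, hence takes the same value on [g] and on a Riemann
    sum [A] of its translates; [A] is uniformly close to [avg1 i g]. *)
Lemma Avg_avg1 i g : cont_periodic g -> Avg (avg1 i g) = Avg g.
Proof.
move=> cg; apply/eqP; rewrite -subr_eq0 -normr_le0.
apply/ler_addgt0Pr => eps eps0; rewrite add0r.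
have [d d0 hd] := cp_unif cg eps0.
pose N := Num.bound d^-1.
have Nb : d^-1 < N%:R by apply: archi_boundP; rewrite invr_ge0 ltW.
have N0 : (0 : R) < N%:R by apply: lt_trans Nb; rewrite invr_gt0.
have Nd : N%:R^-1 < d by rewrite invf_plt ?posrE.
have N1 : (0 < N)%N by rewrite -(ltr0n R).
pose A := fun x => N%:R^-1 * \sum_(k < N) g (x + (k%:R / N%:R) *: e i).
have cs v : cont_periodic (fun x => g (x + v)) by exact: cp_shift.
have cA : cont_periodic A by apply: cpZ; apply: cp_sum => k _; exact: cs.
have -> : Avg g = Avg A.
  rewrite AvgZ; last by apply: cp_sum => k _; exact: cs.
  rewrite Avg_sum //; under eq_bigr do rewrite Avg_shift //.
  by rewrite sumr_const card_ord -[Avg g *+ N]mulr_natl mulKf // gt_eqF.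
apply: Avg_close => //; first exact: cp_avg1.
move=> x; apply: (@int01_riemann R (fun s => g (x + s *: e i))) => //.
  exact: cp_line.
move=> s t st; rewrite -[t](subrK s) [t - s + s]addrC scalerDl addrA; apply/ltW/hd.
by rewrite normrZ norm_delta mulr1 (le_lt_trans st).
Qed.

(* Translation invariance makes the difference quotients of f average to 0. *)
Lemma Avg_derive0 i (f f' : S -> R) : cont_periodic f -> cont_periodic f' ->
  (forall x, is_derive x (e i) f (f' x)) -> Avg f' = 0.
Proof.
move=> cf cf' df; apply/eqP; rewrite -normr_le0.
apply/ler_addgt0Pr => eps eps0; rewrite add0r.
have [d d0 hd] := cp_unif cf' eps0.
pose h := d / 2; have h0 : 0 < h by rewrite divr_gt0.
have hd2 : h < d by rewrite ltr_pdivrMr // ltr_pMr // ltr1n.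
pose D := fun x => h^-1 * (f (x + h *: e i) - f x).
have cD : cont_periodic D by apply: cpZ; apply: cpB => //; exact: cp_shift.
have D0 : Avg D = 0.
  rewrite AvgZ ?AvgB ?Avg_shift ?subrr ?mulr0 //; first exact: cp_shift.
  by apply: cpB => //; exact: cp_shift.
rewrite -[Avg f']subr0 -D0; apply: Avg_close => // x.
have [c hc E] := mvt_line x h (fun q => @ex_derive _ _ _ _ _ _ _ (df q)).
rewrite /D E mulKf ?gt_eqF // (@derive_val _ _ _ _ _ _ _ (df _)) distrC.
apply/ltW/hd; rewrite normrZ norm_delta mulr1 (le_lt_trans hc) //.
by rewrite gtr0_norm.
Qed.

Lemma cp_slice_smooth (f : V -> R) s : smooth f -> periodicx f ->
  cont_periodic (fun x => f (s, x)).
Proof. by move=> sf; apply: cp_slice; exact: smooth_cont. Qed.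

Lemma slice_derive (f : V -> R) s x i : smooth f ->
  is_derive x (e i) (fun y => f (s, y)) (dx i f (s, x)).
Proof.
move=> /(is_derive_dx i (s, x)) /is_deriveP H; apply/is_deriveP => eps /H[d d0 hd].
by exists d => // h h0 hh; have := hd h h0 hh; rewrite shift_dxE.
Qed.

Lemma line_derive (f f' : S -> R) i x (t : R) :
  (forall y, is_derive y (e i) f (f' y)) ->
  is_derive t (1 : R) (fun s => f (x + s *: e i)) (f' (x + t *: e i)).
Proof. by move=> df; apply: is_derive_line; exact: df. Qed.

Arguments line_derive {f f'} i x t.
Arguments cp_line {g} x v.

(** Jensen's inequality, by averaging 2 m |g| <= g^2 + m^2 with m the mean of |g|. *)
Lemma avg1_sqr i g x : cont_periodic g ->
  (avg1 i (fun y => `|g y|) x) ^+ 2 <= avg1 i (fun y => g y ^+ 2) x.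
Proof.
move=> cg; set m := avg1 i _ x.
have ca := cp_norm cg; have cg2 := cpM cg cg.
have : avg1 i (fun y => 2 * m * `|g y|) x <= avg1 i (fun y => g y * g y + m ^+ 2) x.
  apply: avg1_le; first exact: cpZ.
    by apply: cpD => //; exact: cp_cst.
  move=> y; have -> : g y * g y = `|g y| ^+ 2 by rewrite real_normK ?num_real.
  by have := sqr_ge0 (`|g y| - m); nra.
rewrite avg1Z // avg1D ?avg1_cst //; last exact: cp_cst.
by rewrite -/m => h; under eq_fun do rewrite expr2; move: h; nra.
Qed.

(** The one-dimensional Sobolev bound for f^2, whose derivative satisfies 2 |f f'| <= f^2 + f'^2;
    this second f^2 accounts for the factor 2. *)
Lemma sqr_le_avg1 i (f f' : S -> R) x : cont_periodic f -> cont_periodic f' ->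
  (forall y, is_derive y (e i) f (f' y)) ->
  f x ^+ 2 <= 2 * avg1 i (fun y => f y ^+ 2) x + avg1 i (fun y => f' y ^+ 2) x.
Proof.
move=> cf cf' df.
have c2 := cpM cf cf; have c2' := cpM cf' cf'.
have cff : cont_periodic (fun y => f y * f' y + f' y * f y).
  by apply: cpD; apply: cpM.
have d2 y : is_derive y (e i) (fun z => f z * f z) (f y * f' y + f' y * f y).
  exact: is_derive_mul.
have := sup_le_int01 (fun s => line_derive i x s d2) (cp_line x (e i) cff).
rewrite scale0r addr0 ger0_norm -?expr2 ?sqr_ge0 // => /le_trans; apply.
have -> : int01 (fun s => `|f (x + s *: e i) * f (x + s *: e i)|) =
  avg1 i (fun y => f y ^+ 2) x.
  by congr int01; apply/funext => s; rewrite ger0_norm -?expr2 ?sqr_ge0.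
rewrite mulr_natl mulr2n -addrA lerD2l.
have -> : avg1 i (fun y => f y ^+ 2) x + avg1 i (fun y => f' y ^+ 2) x =
  avg1 i (fun y => f y * f y + f' y * f' y) x by rewrite avg1D.
apply: (@avg1_le i (fun y => `|f y * f' y + f' y * f y|)); first exact: cp_norm.
  exact: cpD.
move=> y; rewrite ler_norml.
by have := sqr_ge0 (f y - f' y); have := sqr_ge0 (f y + f' y); nra.
Qed.

(** Along each line in direction [i] the derivative f' has mean zero because f is periodic. It is
    therefore bounded by the mean of |f''| on that line, and Jensen gives the square. *)
Lemma Avg_poincare i (f f' f'' : S -> R) :
  cont_periodic f -> cont_periodic f' -> cont_periodic f'' ->
  (forall y, is_derive y (e i) f (f' y)) ->
  (forall y, is_derive y (e i) f' (f'' y)) ->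
  Avg (fun y => f' y ^+ 2) <= Avg (fun y => f'' y ^+ 2).
Proof.
move=> cf cf' cf'' df df'.
have sq g : cont_periodic g -> cont_periodic (fun y => g y ^+ 2).
  by move=> cg; exact: (cpM cg cg).
rewrite -(Avg_avg1 i (sq _ cf'')); apply: Avg_le; first exact: sq.
  by apply: cp_avg1; exact: sq.
move=> x; apply: le_trans (avg1_sqr i x cf'').
have m0 : int01 (fun s => f' (x + s *: e i)) = 0.
  rewrite (int01E (cp_line x (e i) cf') (fun s _ => line_derive i x s df)).
  have -> : x + 1 *: e i = x + map_mx intr (delta_mx 0 i : 'rV[int]_n) :> S.
    congr (_ + _); rewrite scale1r; apply/matrixP => a b.
    by rewrite !mxE; case: (_ && _).
  by rewrite cf.2 scale0r addr0 subrr.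
have := mean0_le_int01 (fun s => line_derive i x s df') (cp_line x (e i) cf'') m0.
rewrite scale0r addr0 => h; rewrite -[f' x ^+ 2]real_normK ?num_real //.
by rewrite ler_sqr ?nnegrE //; apply: le_trans h; exact: normr_ge0.
Qed.

(** The innermost average is peeled off: averaging in one direction keeps the Lipschitz constant in
    all directions, and [lipschitz_le_int01] returns from the average to the function. The threshold
    [eta] depends only on [L], [K] and [eps], hence is uniform in time when applied to slices. *)
Lemma avg_lipschitz L (K eps : R) : 0 <= K -> 0 < eps ->
  exists2 eta, 0 < eta & forall g, cont_periodic g -> (forall x, 0 <= g x) ->
    (forall i (x : S) (s : R), `|g (x + s *: e i) - g x| <= K * `|s|) ->
    forall x, avg L g x <= eta -> g x <= eps.
Proof.
move=> K0; elim/last_ind: L eps => [|L i IH] eps eps0.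
  by exists eps.
(* With K d <= eps / 2, a line mean of at most d eps / 2 leaves at most eps at the base point. *)
pose d := Num.min 1 (eps / 2 / (K + 1)).
have K1 : 0 < K + 1 by rewrite ltr_wpDl.
have d0 : 0 < d by rewrite lt_min ltr01 !divr_gt0.
have d1 : d <= 1 by rewrite ge_min lexx.
have dK : K * d <= eps / 2.
  have : d <= eps / 2 / (K + 1) by rewrite ge_min lexx orbT.
  rewrite ler_pdivlMr // mulrDr mulr1 mulrC => h; apply: le_trans h.
  by rewrite lerDl ltW.
have de0 : 0 < d * (eps / 2) by rewrite !mulr_gt0.
have [eta eta0 H] := IH _ de0.
exists eta => // g cg g0 gL x hx.
have ca := cp_avg1 i cg.
have := H (avg1 i g) ca _ _ x; rewrite /avg foldr_rcons in hx *.
have a0 y : 0 <= avg1 i g y.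
  have <- : avg1 i (fun=> 0) y = 0 by rewrite avg1_cst.
  by apply: avg1_le => //; exact: cp_cst.
have aL j (y : S) (s : R) : `|avg1 i g (y + s *: e j) - avg1 i g y| <= K * `|s|.
  by rewrite -avg1_shift; apply: avg1_close => //; exact: cp_shift.
move=> /(_ a0 aL hx).
have := @lipschitz_le_int01 R (fun s => g (x + s *: e i)) K d (cp_line x _ cg)
  (fun s => g0 _) _ K0 _.
rewrite scale0r addr0 -/(avg1 i g x) d0 d1 => /(_ (fun s => gL i x s) isT) h1 h2.
have : g x - K * d <= eps / 2 by rewrite -(ler_pM2l d0) (le_trans h1).
by lra.
Qed.

Lemma Avg_lipschitz (K eps : R) : 0 <= K -> 0 < eps ->
  exists2 eta, 0 < eta & forall g, cont_periodic g -> (forall x, 0 <= g x) ->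
    (forall i (x : S) (s : R), `|g (x + s *: e i) - g x| <= K * `|s|) ->
    Avg g <= eta -> forall x, g x <= eps.
Proof.
move=> K0 eps0; have [eta eta0 H] := avg_lipschitz (enum 'I_n) K0 eps0.
by exists eta => // g cg g0 gL hA x; apply: H => //; rewrite avg_const.
Qed.

(** The second time derivative is bounded on the torus for times within 1 of [s], so difference
    quotients converge uniformly in x, at rate C |h|. *)
Lemma Avg_time_derive (f : V -> R) (s : R) : smooth f -> periodicx f ->
  is_derive s (1 : R) (fun r => Avg (fun x => f (r, x))) (Avg (fun x => dt f (s, x))).
Proof.
move=> sf pf.
have pdf : periodicx (dt f) by exact: periodicx_derive.
have pddf : periodicx (dt (dt f)) by exact: periodicx_derive.
have sdf := smooth_dt sf; have sddf := smooth_dt sdf.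
have [C C0 hC] := periodic_bounded (s - 1) (s + 1) (smooth_cont sddf) pddf.
apply/is_deriveP => eps eps0.
exists (Num.min 1 (eps / (C + 1))).
  by rewrite lt_min ltr01 divr_gt0 // ltr_wpDl.
move=> h h0; rewrite lt_min => /andP[h1 hC1].
have E : h^-1 * (Avg (fun x => f (s + h%:A, x)) - Avg (fun x => f (s, x))) =
    Avg (fun x => h^-1 * (f (s + h, x) - f (s, x))).
  rewrite AvgZ ?AvgB ?[h%:A]mulr1 //; try (apply: cpB); exact: cp_slice_smooth.
rewrite E; apply: (@le_lt_trans _ _ (C * `|h|)); last first.
  have C1 : 0 < C + 1 by rewrite ltr_wpDl.
  move: hC1; rewrite ltr_pdivlMr // mulrDr mulr1 mulrC => /(le_lt_trans _); apply.
  by rewrite lerDl.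
apply: Avg_close.
- by apply: cpZ; apply: cpB; exact: cp_slice_smooth.
- exact: cp_slice_smooth.
move=> x.
have [c hc Ec] := MVT_any s (s + h) (fun r => line_dt r x sf).
have [c' hc' Ec'] := MVT_any s c (fun r => line_dt r x sdf).
rewrite Ec addrAC subrr add0r mulrC mulfK // Ec' normrM ler_pM //.
  apply: hC; move: hc hc' h1; rewrite ltr_norml.
  rewrite !minEle !maxEle; do 2!case: ifP; lra.
move: hc; rewrite minEle maxEle; case: ifP => hs; rewrite ler_norml.
  by rewrite ger0_norm; lra.
by rewrite ler0_norm; lra.
Qed.

End TorusAverage.

(** * The Gagliardo-Nirenberg inequality *)

Section RealPowers.
Context {R : realType}.

Lemma is_derive_comp1 (V : normedModType R) (u : V -> R) (f : R -> R) (x v : V) (a b : R) :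
  is_derive x v u a -> is_derive (u x) (1 : R) f b ->
  is_derive x v (fun y => f (u y)) (b * a).
Proof.
move=> ua fb.
have u0 : is_derive (0 : R) (1 : R) (fun h => u (x + h *: v)) a.
  by apply: is_derive_line; rewrite scale0r addr0.
have f0 : is_derive (u (x + (0 : R) *: v)) (1 : R) f b by rewrite scale0r addr0.
have /is_deriveP H := is_derive1_comp f0 u0.
apply/is_deriveP => eps /H[d d0 hd]; exists d => // h h0 hh.
by have := hd h h0 hh; rewrite /= add0r [h%:A]mulr1 scale0r addr0.
Qed.

Definition abs_pow (p y : R) : R := `|y| `^ p.
(** The function y |y|^(p-2), up to the factor p the derivative of |y|^p. For p > 2 it is
    continuously differentiable also at 0, which the integration by parts needs; the exponents are
    real because they will be 2N/j. *)
Definition odd_pow (p y : R) : R := y * `|y| `^ (p - 2).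

Lemma abs_pow_small (q eps : R) : 0 < q -> 0 < eps ->
  exists2 d, 0 < d & forall y, `|y| < d -> abs_pow q y < eps.
Proof.
move=> q0 e0; exists (eps `^ q^-1); first exact: powR_gt0.
move=> y hy; have -> : eps = (eps `^ q^-1) `^ q.
  by rewrite -powRrM mulVf ?gt_eqF // powRr1 // ltW.
by apply: gt0_ltr_powR => //; rewrite nnegrE ?powR_ge0.
Qed.

Lemma is_derive_abs (y : R) : y != 0 -> is_derive y (1 : R) (fun z : R => `|z|) (Num.sg y).
Proof.
move=> y0; apply/is_deriveP => e e0; exists `|y|; first by rewrite normr_gt0.
move=> h h0 hh; rewrite [h%:A]mulr1.
suff -> : `|y + h| - `|y| = h * Num.sg y by rewrite mulKf // subrr normr0.
case: (ltrgt0P y) hh => [yp|yn|y00] hh.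
- rewrite gtr0_sg // ger0_norm ?[h * 1]mulr1; first by ring.
  by have := ler_norm (- h); rewrite normrN; lra.
- rewrite ltr0_sg // ler0_norm; first by ring.
  by have := ler_norm h; lra.
- by rewrite y00 eqxx in y0.
Qed.

Lemma continuous_abs_pow q : 0 < q -> continuous (abs_pow q).
Proof.
move=> q0 y; have [->|y0] := eqVneq y 0.
  apply/cvgrPdist_lt => e e0; have [d d0 hd] := abs_pow_small q0 e0.
  apply/nbhs_ballP; exists d => //= z; rewrite /ball /= sub0r normrN => /hd h.
  rewrite {1}/abs_pow normr0 powR0 ?gt_eqF // sub0r normrN ger0_norm //.
  exact: powR_ge0.
apply/differentiable_continuous/derivable1_diffP.
have yp : 0 < `|y| by rewrite normr_gt0.
by have [] := is_derive_comp1 (is_derive_abs y0) (is_derive1_powR q yp).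
Qed.

Lemma abs_odd_pow p y : 2 < p -> y * odd_pow p y = abs_pow p y.
Proof.
move=> p2; have [->|y0] := eqVneq y 0.
  by rewrite mul0r /abs_pow normr0 powR0 // gt_eqF //; lra.
rewrite /odd_pow mulrA -expr2 -real_normK ?num_real // -powR_mulrn //.
by rewrite -powRD ?(normr_eq0, y0, implybT) // addrC subrK.
Qed.

Lemma is_derive_odd_pow p (y : R) : 2 < p ->
  is_derive y (1 : R) (odd_pow p) ((p - 1) * abs_pow (p - 2) y).
Proof.
move=> p2; have p20 : 0 < p - 2 by rewrite subr_gt0.
have [->|y0] := eqVneq y 0.
  apply/is_deriveP => e e0; have [d d0 hd] := abs_pow_small p20 e0.
  exists d => // h h0 /hd hh; rewrite add0r [h%:A]mulr1 /odd_pow mul0r subr0 mulKf //.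
  rewrite /abs_pow normr0 powR0 ?gt_eqF // mulr0 subr0 ger0_norm ?powR_ge0 //.
have yp : 0 < `|y| by rewrite normr_gt0.
have D := is_derive_comp1 (is_derive_abs y0) (is_derive1_powR (p - 2) yp).
have := is_derive_mul (is_derive_id y (1 : R)) D.
suff -> : y * ((p - 2) * `|y| `^ (p - 2 - 1) * Num.sg y) + 1 * `|y| `^ (p - 2) =
  (p - 1) * abs_pow (p - 2) y by [].
have -> : y * ((p - 2) * `|y| `^ (p - 2 - 1) * Num.sg y) =
  (p - 2) * ((Num.sg y * y) * `|y| `^ (p - 2 - 1)) by ring.
by rewrite -normrEsg mulr_powRB1 // /abs_pow; ring.
Qed.

Lemma abs_powM (q : R) (k : nat) (y : R) : abs_pow (q * k%:R) y = abs_pow q y ^+ k.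
Proof. by rewrite /abs_pow powRrM powR_mulrn // powR_ge0. Qed.

(** A weighted Young inequality by cases. If z <= k max(x, y), the left side is at most C k^c max(x,
    y)^m, with C k^c <= eta; otherwise max(x, y) < z / k and everything is bounded by z^m. *)
Lemma young_powers (a b c m : nat) (C eta : R) : (a + b + c = m)%N -> (0 < c)%N ->
  0 <= C -> 0 < eta -> exists2 K, 0 <= K & forall x y z, 0 <= x -> 0 <= y -> 0 <= z ->
  C * (y ^+ a * x ^+ b * z ^+ c) <= eta * (x ^+ m + y ^+ m) + K * z ^+ m.
Proof.
move=> abc c0 C0 eta0.
have C1 : 0 < C + 1 by rewrite ltr_wpDl.
pose k := Num.min 1 (eta / (C + 1)).
have k0 : 0 < k by rewrite lt_min ltr01 divr_gt0.
have k1 : k <= 1 by rewrite ge_min lexx.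
have Ck : C * k ^+ c <= eta.
  apply: (@le_trans _ _ (C * k)).
    by rewrite ler_wpM2l // -[leRHS]expr1 ler_wiXn2l // ltW.
  have : k <= eta / (C + 1) by rewrite ge_min lexx orbT.
  rewrite ler_pdivlMr // mulrDr mulr1 mulrC => h; apply: le_trans h.
  by rewrite lerDl ltW.
exists (C * k ^- m); first by rewrite mulr_ge0 // invr_ge0 exprn_ge0 // ltW.
move=> x y z x0 y0 z0; pose M := Num.max x y.
have M0 : 0 <= M by rewrite le_max x0.
have xM : x <= M by rewrite le_max lexx.
have yM : y <= M by rewrite le_max lexx orbT.
have pos t (j : nat) : 0 <= t -> 0 <= t ^+ j :> R by move=> ?; exact: exprn_ge0.
have [zM|zM] := leP z (k * M).
  apply: (@le_trans _ _ (eta * M ^+ m)).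
    apply: (@le_trans _ _ (C * (M ^+ a * M ^+ b * (k * M) ^+ c))).
      rewrite ler_wpM2l // ler_pM ?mulr_ge0 ?pos // ?ler_pM ?pos // lerXn2r ?nnegrE //.
      by rewrite mulr_ge0 // ltW.
    have -> : C * (M ^+ a * M ^+ b * (k * M) ^+ c) = C * k ^+ c * M ^+ m.
      by rewrite -abc !exprD exprMn; ring.
    by rewrite ler_wpM2r // pos.
  apply: ler_wpDr; first by rewrite !mulr_ge0 ?pos // invr_ge0 pos // ltW.
  rewrite ler_wpM2l //; first exact: ltW.
  have := pos _ m x0; have := pos _ m y0.
  by rewrite /M; case: (leP x y) => _; lra.
apply: ler_wpDl; first by rewrite mulr_ge0 ?addr_ge0 ?pos // ltW.
have Mz : M <= z / k by rewrite ler_pdivlMr // mulrC ltW.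
have zz : z <= z / k by rewrite ler_pdivlMr // ler_piMr.
rewrite -[C * k ^- m * _]mulrA ler_wpM2l // [k ^- m * _]mulrC -expr_div_n -abc !exprD.
rewrite ler_pM ?mulr_ge0 ?pos // ?ler_pM ?pos // lerXn2r ?nnegrE ?divr_ge0 ?(ltW k0) //.
  by rewrite (le_trans yM).
by rewrite (le_trans xM).
Qed.

(** With r = |y|^(1/j) all the fractional powers of |y| become integer powers of r, so the integer
    form of Young's inequality applies. *)
Lemma abs_pow_root (N j : nat) (y : R) : (0 < j)%N -> exists2 r, 0 <= r &
  [/\ r ^+ j = `|y|, r ^+ (2 * N) = abs_pow ((2 * N)%:R / j%:R) y &
   (j <= N)%N -> r ^+ (2 * N - 2 * j) = abs_pow ((2 * N)%:R / j%:R - 2) y].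
Proof.
move=> j0; exists (abs_pow j%:R^-1 y); first exact: powR_ge0.
have jR : (j%:R : R) != 0 by rewrite pnatr_eq0 -lt0n.
split.
- by rewrite -abs_powM mulVf // /abs_pow powRr1.
- by rewrite -abs_powM [_^-1 * _]mulrC.
- move=> jN; rewrite -abs_powM natrB; last by lia.
  by congr abs_pow; rewrite !natrM; field.
Qed.

(** Here [g], [u], [q] stand for derivatives of orders j - 1, j, j + 1. After taking roots of those
    orders the product has degrees (j - 1) + (2N - 2j) + (j + 1) = 2N. *)
Lemma gn_young (N j : nat) (eta : R) : (0 < j < N)%N -> 0 < eta ->
  exists2 K, 0 <= K & forall g u q : R, (j = 1%N -> `|g| <= 1) ->
  ((2 * N)%:R / j%:R - 1) * (`|g| * abs_pow ((2 * N)%:R / j%:R - 2) u * `|q|) <=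
  eta * (abs_pow ((2 * N)%:R / j%:R) u +
    (if j == 1%N then 0 else abs_pow ((2 * N)%:R / j.-1%:R) g)) +
  K * abs_pow ((2 * N)%:R / j.+1%:R) q.
Proof.
move=> /andP[j0 jN] eta0.
have jR : (0 : R) < j%:R by rewrite ltr0n.
have p1 : 0 <= (2 * N)%:R / j%:R - 1 :> R.
  by rewrite subr_ge0 ler_pdivlMr // mul1r ler_nat; lia.
have abc : (j.-1 + (2 * N - 2 * j) + j.+1 = 2 * N)%N by lia.
have [K K0 HK] := young_powers abc (ltn0Sn j) p1 eta0.
exists K => // g u q g1.
have [x x0 [_ <- /(_ (ltnW jN)) <-]] := abs_pow_root N u j0.
have [z z0 [<- <- _]] := abs_pow_root N q (ltn0Sn j).
(* For j = 1 the function itself is only known to be bounded by 1, and y = 0 serves because 0 ^+ 0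
   is 1; for j > 1, y is the root of |g| of order j - 1. *)
have [y y0 [gy ->]] : exists2 y, 0 <= y & `|g| <= y ^+ j.-1 /\
    (if j == 1%N then 0 else abs_pow ((2 * N)%:R / j.-1%:R) g) = y ^+ (2 * N).
  case: eqP => j1.
    exists 0 => //; split; first by rewrite j1 expr0; exact: g1.
    have /negPf E : (2 * N != 0)%N by lia.
    by rewrite expr0n E.
  have jj : (0 < j.-1)%N by lia.
  have [y y0 [gy Ey _]] := abs_pow_root N g jj; exists y => //.
  by rewrite gy lexx Ey.
apply: le_trans (HK x y z x0 y0 z0).
by rewrite ler_wpM2l // ler_wpM2r ?exprn_ge0 // ler_wpM2r ?exprn_ge0.
Qed.

End RealPowers.

(** * Sums over words of indices *)

Section WordSums.
Context {R : realType} {I : finType}.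
Implicit Types F G : seq I -> R.

(** Ordered words instead of multi-indices: the sum of squares is then the full tensor norm of D^k,
    and inductions peel off one letter. *)
Fixpoint sum_words (k : nat) (F : seq I -> R) : R :=
  if k is k'.+1 then \sum_i sum_words k' (fun a => F (i :: a)) else F [::].

Lemma sum_words_le k F G : (forall a, size a = k -> F a <= G a) ->
  sum_words k F <= sum_words k G.
Proof.
elim: k F G => [|k IH] F G H /=; first exact: H.
by apply: ler_sum => i _; apply: IH => a ak; apply: H; rewrite /= ak.
Qed.

Lemma eq_sum_words k F G : (forall a, size a = k -> F a = G a) ->
  sum_words k F = sum_words k G.
Proof.
by move=> H; apply/eqP; rewrite eq_le !sum_words_le // => a /H ->.
Qed.

Lemma sum_wordsD k F G :
  sum_words k (fun a => F a + G a) = sum_words k F + sum_words k G.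
Proof.
elim: k F G => [//|k IH] F G /=; rewrite -big_split /=.
by apply: eq_bigr => i _; rewrite IH.
Qed.

Lemma sum_wordsZ k c F : sum_words k (fun a => c * F a) = c * sum_words k F.
Proof.
elim: k F => [//|k IH] F /=; rewrite mulr_sumr.
by apply: eq_bigr => i _; rewrite IH.
Qed.

Lemma sum_words0 k : sum_words k (fun=> 0) = 0.
Proof. by elim: k => [//|k IH] /=; rewrite big1. Qed.

Lemma sum_words_ge0 k F : (forall a, size a = k -> 0 <= F a) -> 0 <= sum_words k F.
Proof. by move=> H; rewrite -(sum_words0 k); exact: sum_words_le. Qed.

Lemma sum_words_sum k (J : Type) (r : seq J) (F : J -> seq I -> R) :
  sum_words k (fun a => \sum_(j <- r) F j a) = \sum_(j <- r) sum_words k (F j).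
Proof.
elim: k F => [//|k IH] F /=.
by under eq_bigr do rewrite IH; rewrite exchange_big.
Qed.

Lemma sum_words_cat k l F :
  sum_words (k + l) F = sum_words k (fun a => sum_words l (fun b => F (a ++ b))).
Proof. by elim: k F => [//|k IH] F /=; apply: eq_bigr => i _; rewrite IH. Qed.

Lemma sum_words_term a F : (forall b, 0 <= F b) -> F a <= sum_words (size a) F.
Proof.
elim: a F => [//|i a IH] F H /=; rewrite (bigD1 i) //=.
apply: ler_wpDr; last exact: (IH (fun b => F (i :: b))).
by apply: sumr_ge0 => j _; apply: sum_words_ge0.
Qed.

Lemma sum_words_diag k F : (forall b, 0 <= F b) ->
  \sum_i sum_words k (fun a => F (i :: i :: a)) <= sum_words k.+2 F.
Proof.
move=> H /=; apply: ler_sum => i _; rewrite (bigD1 i) //=.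
apply: ler_wpDr => //; apply: sumr_ge0 => j _.
by apply: sum_words_ge0.
Qed.

End WordSums.

(** * Interpolation inequalities on the torus *)

Section GagliardoNirenberg.
Context {R : realType} {n : nat}.
Notation S := 'rV[R]_n.
Notation V := (R * 'rV[R]_n)%type.
Notation e i := (delta_mx 0 i : S).

(** The integral of |D^j w|^(2N/j), the interpolation exponents between a sup bound on w and an L^2
    bound on D^N w; at j = N the exponent is 2. *)
Definition pow_energy (N : nat) (w : V -> R) (s : R) (j : nat) : R :=
  sum_words j (fun a => Avg (fun x => abs_pow ((2 * N)%:R / j%:R) (dxs a w (s, x)))).

(** The total derivative of w |w_i|^(p-2) w_i has mean zero, and one of its two terms is |w_i|^p. *)
Lemma Avg_by_parts (w : V -> R) s i p : smooth w -> periodicx w -> 2 < p ->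
  Avg (fun x => abs_pow p (dx i w (s, x))) <=
  Avg (fun x => (p - 1) * (`|w (s, x)| * abs_pow (p - 2) (dx i w (s, x)) *
                           `|dx i (dx i w) (s, x)|)).
Proof.
move=> sw pw p2; have p20 : 0 < p - 2 by rewrite subr_gt0.
have p0 : 0 < p by lra.
have su := smooth_dx i sw; have pu := periodicx_derive (0, e i) pw.
have sq := smooth_dx i su; have pq := periodicx_derive (0, e i) pu.
have cg := cp_slice_smooth s sw pw; have cu := cp_slice_smooth s su pu.
have cq := cp_slice_smooth s sq pq.
have codd : continuous (odd_pow p).
  move=> y; apply/differentiable_continuous/derivable1_diffP.
  by have [] := is_derive_odd_pow y p2.
pose f x := w (s, x) * odd_pow p (dx i w (s, x)).
pose f' x := abs_pow p (dx i w (s, x)) + w (s, x) * ((p - 1) *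
  abs_pow (p - 2) (dx i w (s, x)) * dx i (dx i w) (s, x)).
have cf : cont_periodic f := cpM cg (cp_comp codd cu).
have cP := cp_comp (continuous_abs_pow p0) cu.
have cP2 := cp_comp (continuous_abs_pow p20) cu.
have c2 := cpM cg (cpM (cpZ (p - 1) cP2) cq).
have df x : is_derive x (e i) f (f' x).
  have d1 := slice_derive s x i sw.
  have d2 := is_derive_comp1 (slice_derive s x i su) (is_derive_odd_pow (dx i w (s, x)) p2).
  have := is_derive_mul d1 d2.
  by rewrite (abs_odd_pow _ p2) addrC.
have := Avg_derive0 cf (cpD cP c2) df; rewrite (AvgD cP c2) => /eqP.
rewrite addr_eq0 => /eqP ->; rewrite -(AvgN c2).
apply: (Avg_le (cpN c2) (cpZ (p - 1) (cpM (cpM (cp_norm cg) cP2) (cp_norm cq)))).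
move=> x /=; set a := abs_pow _ _.
have a0 : 0 <= a by exact: powR_ge0.
rewrite (le_trans (ler_norm _)) // normrN !normrM (ger0_norm a0).
rewrite (@ger0_norm _ (p - 1)); last by lra.
by rewrite le_eqVlt; apply/orP; left; apply/eqP; ring.
Qed.

Lemma cp_abs_pow (w : V -> R) s p : smooth w -> periodicx w -> 0 < p ->
  cont_periodic (fun x => abs_pow p (w (s, x))).
Proof.
move=> sw pw p0; apply: cp_comp; first exact: continuous_abs_pow.
exact: cp_slice_smooth.
Qed.

Lemma pow_energy_ge0 N w s j : smooth w -> periodicx w -> (0 < N)%N -> (0 < j)%N ->
  0 <= pow_energy N w s j.
Proof.
move=> sw pw N0 j0; apply: sum_words_ge0 => a _; apply: Avg_ge0.
  apply: cp_abs_pow; [exact: smooth_dxs|exact: periodicx_dxs|].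
  by rewrite divr_gt0 ?ltr0n // muln_gt0.
by move=> y; exact: powR_ge0.
Qed.

(** Integration by parts for each derivative of order j - 1, followed by Young pointwise. The
    lower-order term does not depend on the last direction, and summing over that direction produces
    the factor n. For j = 1 it is absorbed by the bound |w| <= 1. *)
Lemma gn_step (N j : nat) (eta : R) : (0 < j < N)%N -> 0 < eta ->
  exists2 K, 0 <= K & forall (w : V -> R) s, smooth w -> periodicx w ->
  (forall x, `|w (s, x)| <= 1) ->
  pow_energy N w s j <= eta * (pow_energy N w s j +
     (if j == 1%N then 0 else n%:R * pow_energy N w s j.-1)) +
     K * pow_energy N w s j.+1.
Proof.
move=> /andP[j0 jN] eta0; have N0 : (0 < N)%N by exact: leq_trans jN.
pose p : R := (2 * N)%:R / j%:R.
have jR : (0 : R) < j%:R by rewrite ltr0n.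
have p2 : 2 < p by rewrite /p ltr_pdivlMr // -natrM ltr_nat; lia.
have jjN : (0 < j < N)%N by rewrite j0.
have [K K0 HK] := gn_young jjN eta0.
exists K => // w s sw pw w1.
have q0 k : (0 < k)%N -> (0 : R) < (2 * N)%:R / k%:R.
  by move=> k0; rewrite divr_gt0 ?ltr0n // muln_gt0.
have cP a k : (0 < k)%N ->
    cont_periodic (fun x => abs_pow ((2 * N)%:R / k%:R) (dxs a w (s, x))).
  move=> k0; apply: cp_abs_pow; [exact: smooth_dxs|exact: periodicx_dxs|exact: q0].
pose Y a x : R := if j == 1%N then 0 else
  abs_pow ((2 * N)%:R / j.-1%:R) (dxs a w (s, x)).
have cY a : cont_periodic (Y a).
  rewrite /Y; case: eqP => [_|j1]; first exact: cp_cst.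
  by apply: cP; lia.
have key i a : size a = j.-1 ->
  Avg (fun x => abs_pow p (dxs (i :: a) w (s, x))) <=
  eta * (Avg (fun x => abs_pow p (dxs (i :: a) w (s, x))) + Avg (Y a)) +
  K * Avg (fun x => abs_pow ((2 * N)%:R / j.+1%:R) (dxs (i :: i :: a) w (s, x))).
  move=> sa.
  have sg := smooth_dxs a sw; have pg := periodicx_dxs a pw.
  apply: le_trans (Avg_by_parts s i sg pg p2) _.
  rewrite -AvgD; [|exact: cP|exact: cY].
  rewrite -AvgZ; last by apply: cpD; [exact: cP|exact: cY].
  rewrite -AvgZ; last exact: cP.
  rewrite -AvgD; first last.
  - by apply: cpZ; exact: cP.
  - by apply: cpZ; apply: cpD; [exact: cP|exact: cY].
  have su := smooth_dx i sg; have pu := periodicx_derive (0, e i) pg.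
  have sq := smooth_dx i su; have pq := periodicx_derive (0, e i) pu.
  have p20 : 0 < p - 2 by rewrite subr_gt0.
  apply: Avg_le.
  - apply: cpZ; apply: cpM; first apply: cpM.
    + exact: cp_norm (cp_slice_smooth s sg pg).
    + exact: cp_abs_pow su pu p20.
    + exact: cp_norm (cp_slice_smooth s sq pq).
  - apply: cpD; apply: cpZ; last exact: cP.
    by apply: cpD; [exact: cP|exact: cY].
  move=> x; apply: HK => j1.
  by case: (a) sa => [_|b l]; [exact: w1|rewrite j1].
have -> : pow_energy N w s j = \sum_i sum_words j.-1 (fun a =>
    Avg (fun x => abs_pow p (dxs (i :: a) w (s, x)))).
  by rewrite /pow_energy -[in sum_words j](prednK j0).
apply: le_trans.
  apply: ler_sum => i _; apply: sum_words_le => a sa; exact: (key i a sa).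
under eq_bigr do rewrite sum_wordsD !sum_wordsZ sum_wordsD.
rewrite big_split /= -!mulr_sumr big_split /= lerD //.
  rewrite ler_wpM2l ?(ltW eta0) // lerD2l sumr_const card_ord.
  rewrite -[_ *+ n]mulr_natl /Y; case: eqP => j1.
    by rewrite j1 /= Avg_cst mulr0.
  by rewrite lexx.
rewrite ler_wpM2l //.
have := @sum_words_diag R 'I_n j.-1
  (fun a => Avg (fun x => abs_pow ((2 * N)%:R / j.+1%:R) (dxs a w (s, x)))).
rewrite prednK // => H; apply: H => b; apply: Avg_ge0; first exact: cP.
by move=> y; exact: powR_ge0.
Qed.

Lemma gn_chain (N j : nat) : (0 < j < N)%N ->
  exists2 K, 0 <= K & forall (w : V -> R) s, smooth w -> periodicx w ->
  (forall x, `|w (s, x)| <= 1) -> pow_energy N w s j <= K * pow_energy N w s j.+1.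
Proof.
elim: j => [//|j IH] /andP[_ jN].
have N0 : (0 < N)%N by exact: leq_trans jN.
case: j IH jN => [_ N1|j IH jN].
- have h2 : (0 : R) < 2^-1 by rewrite invr_gt0.
  have jj : (0 < 1 < N)%N by [].
  have [K K0 HK] := gn_step jj h2; exists (2 * K); first by rewrite mulr_ge0.
  move=> w s sw pw w1; have := HK w s sw pw w1; rewrite eqxx addr0; lra.
have jj : (0 < j.+2 < N)%N by [].
have [C C0 HC] := IH (ltnW jN).
(* Since A1 <= C A2, the choice eta = 1 / (2 (1 + n C)) makes the terms carrying eta at most A2 / 2,
   which the left side absorbs. *)
have D0 : 0 < 2 * (1 + n%:R * C) by rewrite mulr_gt0 // ltr_pwDl // mulr_ge0.
have e0 : 0 < (2 * (1 + n%:R * C))^-1 by rewrite invr_gt0.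
have [K K0 HK] := gn_step jj e0; exists (2 * K); first by rewrite mulr_ge0.
move=> w s sw pw w1; have := HK w s sw pw w1; have := HC w s sw pw w1.
rewrite /=; set A1 := pow_energy N w s j.+1; set A2 := pow_energy N w s j.+2.
set A3 := pow_energy _ _ _ _ => h1 h2.
have h3 : (2 * (1 + n%:R * C))^-1 * (A2 + n%:R * A1) <= 2^-1 * A2.
  rewrite invfM -mulrA ler_wpM2l ?invr_ge0 // ler_pdivrMl ?ltr_pwDl ?mulr_ge0 //.
  by rewrite mulrDl mul1r lerD2l -mulrA ler_wpM2l.
by lra.
Qed.

Lemma gagliardo_nirenberg (N : nat) : (0 < N)%N ->
  exists2 K, 0 <= K & forall (w : V -> R) s j, smooth w -> periodicx w ->
  (forall x, `|w (s, x)| <= 1) -> (0 < j <= N)%N ->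
  pow_energy N w s j <= K * pow_energy N w s N.
Proof.
move=> N0.
suff H d : exists2 K, 0 <= K & forall (w : V -> R) s j, smooth w -> periodicx w ->
    (forall x, `|w (s, x)| <= 1) -> (0 < j <= N)%N -> (N - j <= d)%N ->
    pow_energy N w s j <= K * pow_energy N w s N.
  have [K K0 HK] := H N; exists K => // w s j sw pw w1 jN.
  by apply: HK => //; exact: leq_subr.
elim: d => [|d [K K0 HK]].
  exists 1 => // w s j _ _ _ /andP[j0 jN] jd.
  have -> : j = N by lia.
  by rewrite mul1r lexx.
have [j0|jp] := posnP (N - d.+1).
  exists K; first exact: K0.
  move=> w s j sw pw w1 jN jd; apply: (HK w s j sw pw w1 jN).
  by move: jN j0; lia.
have jj : (0 < N - d.+1 < N)%N by lia.
have [C C0 HC] := gn_chain jj.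
exists (Num.max K (C * K)); first by rewrite le_max K0.
move=> w s j sw pw w1 jN jd.
have EN := pow_energy_ge0 s sw pw N0 N0.
have [jd'|jd'] := leqP (N - j) d.
  apply: (le_trans (HK w s j sw pw w1 jN jd')).
  by rewrite ler_wpM2r // le_max lexx.
have -> : j = (N - d.+1)%N by lia.
apply: (le_trans (HC w s sw pw w1)).
apply: (@le_trans _ _ (C * K * pow_energy N w s N)); last first.
  by rewrite ler_wpM2r // le_max lexx orbT.
rewrite -mulrA ler_wpM2l //; apply: HK; [exact: sw|exact: pw|exact: w1|lia|lia].
Qed.

End GagliardoNirenberg.

(** * Matrices *)

Section PositiveDefinite.
Context {R : realType}.

Lemma mulmx_trE n (A : 'M[R]_n) i j : (A *m A^T) i j = \sum_m A i m * A j m.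
Proof. by rewrite mxE; apply: eq_bigr => m _; rewrite mxE. Qed.

Lemma quad_dot n (A : 'M[R]_n) (w y : 'rV[R]_n) :
  (w *m A *m y^T) 0 0 = \sum_i \sum_j w 0 i * A i j * y 0 j.
Proof.
rewrite mxE exchange_big /=; apply: eq_bigr => j _.
by rewrite mxE mulr_suml; apply: eq_bigr => i _; rewrite mxE.
Qed.

(** Induction through the Schur complement of the corner entry. The factor turns norms measured by A
    into Euclidean norms. *)
Lemma cholesky n (A : 'M[R]_n) : A^T = A -> posdef A ->
  exists2 L : 'M[R]_n, A = L *m L^T & L \in unitmx.
Proof.
elim: n A => [|n IH] A symA posA.
  exists 1%:M; last exact: unitmx1.
  by apply/matrixP => -[].
rewrite -[n.+1]/(1 + n)%N in A symA posA *.
pose a := A 0 0; pose b := ursubmx A; pose D := drsubmx A.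
have Aul : ulsubmx A = a%:M.
  by rewrite [LHS]mx11_scalar; congr (_%:M); rewrite !mxE; congr (A _ _); apply/val_inj.
have Adl : dlsubmx A = b^T by rewrite /b trmx_ursub symA.
have Dsym : D^T = D by rewrite /D trmx_drsub symA.
have Ablock : A = block_mx a%:M b b^T D by rewrite -Aul -Adl submxK.
have a0 : 0 < a.
  have := posA (delta_mx 0 0).
  rewrite trmx_delta -rowE -colE !mxE; apply.
  apply/eqP => /matrixP /(_ 0 0); rewrite !mxE eqxx => /eqP.
  by rewrite oner_eq0.
pose C := D - a^-1 *: (b^T *m b).
have Csym : C^T = C.
  by rewrite /C linearB linearZ /= trmx_mul trmxK Dsym.
have posC : posdef C.
  (* With this first coordinate the vector is orthogonal, for A, to the first axis, so A on it
     reduces to the Schur complement on [w]. *)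
  move=> w w0; pose al := - a^-1 *: (w *m b^T).
  have := posA (row_mx al w).
  have E : row_mx al w *m A = row_mx 0 (w *m C).
    rewrite Ablock mul_row_block; congr row_mx.
      by rewrite mul_mx_scalar /al scalerA mulrN mulfV ?gt_eqF // scaleN1r addNr.
    rewrite /C mulmxBr addrC; congr (_ + _).
    by rewrite /al -scalemxAl -scalemxAr mulmxA scaleNr.
  rewrite E tr_row_mx mul_row_col mul0mx add0r; apply.
  apply: contra w0 => /eqP; rewrite -[0 in RHS](row_mx0 _ 1) => h.
  by have [_ ->] := eq_row_mx h.
have [L' EL uL] := IH C Csym posC.
have sa0 : Num.sqrt a != 0 by rewrite sqrtr_eq0 -ltNge.
pose L := block_mx (Num.sqrt a)%:M 0 ((Num.sqrt a)^-1 *: b^T) L'.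
exists L; last first.
  rewrite unitmxE det_lblock unitrM det_scalar1 unitfE sa0 /=.
  by rewrite -unitmxE.
rewrite Ablock /L tr_block_mx mulmx_block.
rewrite !tr_scalar_mx !trmx0 !mulmx0 !mul0mx !addr0.
congr block_mx.
- by rewrite -scalar_mxM -expr2 sqr_sqrtr // ltW.
- rewrite linearZ /= trmxK mul_scalar_mx scalerA mulfV // scale1r //.
- by rewrite mul_mx_scalar scalerA mulfV // scale1r.
- rewrite -EL linearZ /= trmxK -scalemxAl -scalemxAr scalerA -invfM -expr2.
  by rewrite sqr_sqrtr ?ltW // /C addrC subrK.
Qed.

Lemma posdef_det_gt0 n (A : 'M[R]_n) : A^T = A -> posdef A -> 0 < \det A.
Proof.
move=> sA pA; have [L -> uL] := cholesky sA pA.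
rewrite det_mulmx det_tr -expr2 lt0r sqr_ge0 andbT expf_neq0 //.
by rewrite -unitfE -unitmxE.
Qed.

Lemma posdef_unit n (A : 'M[R]_n) : A^T = A -> posdef A -> A \in unitmx.
Proof. by move=> sA pA; rewrite unitmxE unitfE gt_eqF // posdef_det_gt0. Qed.

Lemma cauchy_schwarz (I : finType) (a b : I -> R) :
  (\sum_i a i * b i) ^+ 2 <= (\sum_i a i ^+ 2) * (\sum_i b i ^+ 2).
Proof.
set A := \sum_i a i ^+ 2; set B := \sum_i b i ^+ 2; set D := \sum_i a i * b i.
have A0 : 0 <= A by apply: sumr_ge0 => i _; exact: sqr_ge0.
have B0 : 0 <= B by apply: sumr_ge0 => i _; exact: sqr_ge0.
have key t : 0 <= A * t ^+ 2 - 2 * D * t + B.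
  have -> : A * t ^+ 2 - 2 * D * t + B = \sum_i (a i * t - b i) ^+ 2.
    rewrite /A /B /D mulr_suml mulr_sumr mulr_suml -sumrB -big_split /=.
    by apply: eq_bigr => i _; ring.
  by apply: sumr_ge0 => i _; exact: sqr_ge0.
have [A00|Ap] := eqVneq A 0.
  have := key ((B + 1) / D); rewrite A00 mul0r sub0r mul0r.
  have [->|D0] := eqVneq D 0; first by rewrite expr0n.
  have -> : 2 * D * ((B + 1) / D) = 2 * (B + 1) by field.
  by lra.
have := key (D / A).
have -> : A * (D / A) ^+ 2 - 2 * D * (D / A) + B = B - D ^+ 2 / A by field.
by rewrite subr_ge0 ler_pdivrMr ?lt0r ?Ap // mulrC.
Qed.

(* With G = L L^T on pairs of indices, tr (G T G T) = |L^T T L|^2. *)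
Lemma pair_curvature_bound (P : finType) (L T F : P -> P -> R) (Y Z : P -> R) :
  (forall p q, T p q = T q p) ->
  (forall p q, F p q = \sum_r (\sum_m L p m * L r m) * T r q) ->
  (\sum_p \sum_q (\sum_m L p m * Y m) * T p q * (\sum_m L q m * Z m)) ^+ 2 <=
  (\sum_p \sum_q F p q * F q p) * ((\sum_m Y m ^+ 2) * (\sum_m Z m ^+ 2)).
Proof.
move=> symT HF.
(* [T'] is [T] written in an orthonormal frame. Both sides become Euclidean expressions in [T'], [Y]
   and [Z], and Cauchy-Schwarz over pairs (m, k) finishes. *)
pose B m q := \sum_r L r m * T r q.
pose T' m k := \sum_q B m q * L q k.
have FE p q : F p q = \sum_m L p m * B m q.
  rewrite HF /B; under eq_bigr do rewrite mulr_suml.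
  rewrite exchange_big /=; apply: eq_bigr => m _; rewrite mulr_sumr.
  by apply: eq_bigr => r _; rewrite mulrA.
have symT' m k : T' m k = T' k m.
  rewrite /T' /B; under eq_bigr do rewrite mulr_suml.
  rewrite exchange_big /=; apply: eq_bigr => q _; rewrite mulr_suml.
  by apply: eq_bigr => r _; rewrite symT; ring.
have -> : \sum_p \sum_q F p q * F q p = \sum_m \sum_k T' m k ^+ 2.
  transitivity (\sum_m \sum_k T' k m * T' m k); last first.
    by apply: eq_bigr => m _; apply: eq_bigr => k _; rewrite symT' -expr2.
  under eq_bigr do under eq_bigr do rewrite !FE big_distrlr /=.
  rewrite (eq_bigr (fun p => \sum_m \sum_k \sum_q L p m * B m q * (L q k * B k p))).
    rewrite exchange_big /=; apply: eq_bigr => m _.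
    rewrite exchange_big /=; apply: eq_bigr => k _.
    rewrite /T' big_distrlr /=; apply: eq_bigr => p _; apply: eq_bigr => q _.
    by ring.
  move=> p _; rewrite exchange_big /=; apply: eq_bigr => m _.
  by rewrite exchange_big.
have -> : \sum_p \sum_q (\sum_m L p m * Y m) * T p q * (\sum_m L q m * Z m) =
    \sum_m \sum_k T' m k * (Y m * Z k).
  transitivity (\sum_m \sum_k \sum_q \sum_p Y m * (L p m * T p q * L q k) * Z k).
    rewrite (eq_bigr (fun p => \sum_m \sum_k \sum_q Y m * (L p m * T p q * L q k) * Z k)).
      rewrite exchange_big /=; apply: eq_bigr => m _.
      rewrite exchange_big /=; apply: eq_bigr => k _.
      by rewrite exchange_big.
    move=> p _; rewrite (eq_bigr (fun q => \sum_m \sum_k Y m * (L p m * T p q * L q k) * Z k)).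
      rewrite exchange_big /=; apply: eq_bigr => m _.
      by rewrite exchange_big.
    move=> q _; rewrite mulr_suml mulr_suml; apply: eq_bigr => m _.
    by rewrite mulr_sumr; apply: eq_bigr => k _; ring.
  apply: eq_bigr => m _; apply: eq_bigr => k _; rewrite /T' mulr_suml.
  apply: eq_bigr => q _; rewrite /B !mulr_suml.
  by apply: eq_bigr => p _; ring.
rewrite !pair_big /=.
apply: le_trans (cauchy_schwarz _ _) _.
rewrite le_eqVlt; apply/orP; left; apply/eqP; congr (_ * _).
rewrite -(pair_big xpredT xpredT (fun m k => (Y m * Z k) ^+ 2)) /= mulr_suml.
by apply: eq_bigr => m _; rewrite mulr_sumr; apply: eq_bigr => k _; rewrite exprMn.
Qed.

End PositiveDefinite.

(** * Calculus of determinants and inverse matrices *)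

Section SmoothMatrices.
Context {R : realType} (V : normedModType R).

Lemma smooth_det n (M : V -> 'M[R]_n) : (forall i j, smooth (fun p => M p i j)) ->
  smooth (fun p => \det (M p)).
Proof.
move=> sM; rewrite /determinant; apply: smooth_sum => s _.
apply: smoothM; first exact: smooth_cst.
by apply: smooth_prod => i _; exact: sM.
Qed.

Lemma smooth_invmx n (M : V -> 'M[R]_n) : (forall i j, smooth (fun p => M p i j)) ->
  (forall p, M p \in unitmx) -> forall i j, smooth (fun p => invmx (M p) i j).
Proof.
move=> sM uM i j.
have -> : (fun p => invmx (M p) i j) = (fun p => (\det (M p))^-1 * cofactor (M p) j i).
  by apply/funext => p; rewrite /invmx uM !mxE.
apply: smoothM.
  by apply: smoothV; [exact: smooth_det|move=> p; rewrite -unitfE -unitmxE].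
rewrite /cofactor; apply: smoothM; first exact: smooth_cst.
have -> : (fun p => \det (row' j (col' i (M p)))) =
   (fun p => \det (\matrix_(a, b) M p (lift j a) (lift i b))).
  by apply/funext => p; congr (\det _); apply/matrixP => a b; rewrite !mxE.
apply: smooth_det => a b.
have -> : (fun p => (\matrix_(a, b) M p (lift j a) (lift i b)) a b) =
  (fun p => M p (lift j a) (lift i b)) by apply/funext => p; rewrite mxE.
exact: sM.
Qed.

Lemma derive_invmx n (M : V -> 'M[R]_n) : (forall i j, smooth (fun p => M p i j)) ->
  (forall p, M p \in unitmx) -> forall i j w p,
  'D_w (fun q => invmx (M q) i j) p =
  - \sum_a \sum_b invmx (M p) i a * 'D_w (fun q => M q a b) p * invmx (M p) b j.
Proof.
move=> sM uM i j w p.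
have sU := smooth_invmx sM uM.
pose dM : 'M[R]_n := \matrix_(a, b) 'D_w (fun q => M q a b) p.
pose dU : 'M[R]_n := \matrix_(a, b) 'D_w (fun q => invmx (M q) a b) p.
have E : dM *m invmx (M p) + M p *m dU = 0.
  apply/matrixP => a b; rewrite !mxE -big_split /=.
  have D : is_derive p w (fun q => \sum_k M q a k * invmx (M q) k b)
     (\sum_k (M p a k * 'D_w (fun q => invmx (M q) k b) p +
              'D_w (fun q => M q a k) p * invmx (M p) k b)).
    apply: is_derive_bigsum => k _.
    by apply: is_derive_mul; apply: smooth_is_derive; [exact: sM|exact: sU].
  have D0 : is_derive p w (fun q => \sum_k M q a k * invmx (M q) k b) 0.
    have -> : (fun q => \sum_k M q a k * invmx (M q) k b) = (fun=> (1%:M : 'M[R]_n) a b).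
      by apply/funext => q; rewrite -(mulmxV (uM q)) mxE.
    exact: is_derive_cst.
  have [_ e1] := D; have [_] := D0; rewrite e1 => e2; rewrite -[RHS]e2.
  by apply: eq_bigr => k _; rewrite !mxE addrC.
have : dU = - (invmx (M p) *m dM *m invmx (M p)).
  have := congr1 (mulmx (invmx (M p))) E.
  rewrite mulmxDr mulmx0 !mulmxA mulVmx // mul1mx => /eqP.
  by rewrite addrC addr_eq0 => /eqP.
move=> /matrixP /(_ i j); rewrite !mxE => ->; congr (- _).
rewrite exchange_big /=; apply: eq_bigr => b _.
by rewrite mxE mulr_suml; apply: eq_bigr => a _; rewrite mxE.
Qed.

Lemma is_derive_prod (I : eqType) (r : seq I) (F : I -> V -> R) (dF : I -> R) p w :
  uniq r -> (forall i, is_derive p w (F i) (dF i)) ->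
  is_derive p w (fun q => \prod_(i <- r) F i q)
    (\sum_(k <- r) dF k * \prod_(i <- r | i != k) F i p).
Proof.
move=> + H; elim: r => [_|a r IH /= /andP[ar ur]].
  have -> : (fun q => \prod_(i <- [::]) F i q) = (fun=> 1).
    by apply/funext => q; rewrite big_nil.
  by rewrite big_nil; exact: is_derive_cst.
have -> : (fun q => \prod_(i <- a :: r) F i q) = (fun q => F a q * \prod_(i <- r) F i q).
  by apply/funext => q; rewrite big_cons.
have := is_derive_mul (H a) (IH ur).
rewrite !big_cons eqxx /= addrC mulr_sumr.
have -> : \prod_(i <- r | i != a) F i p = \prod_(i <- r) F i p.
  rewrite big_seq_cond [RHS]big_seq_cond; apply: eq_bigl => i.
  by rewrite andbT; case: (boolP (i \in r)) => //= ir; apply: contraNneq ar => <-.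
suff -> : \sum_(k <- r) dF k * \prod_(i <- a :: r | i != k) F i p =
  \sum_(i <- r) F a p * (dF i * \prod_(i0 <- r | i0 != i) F i0 p) by [].
rewrite big_seq [RHS]big_seq; apply: eq_bigr => k kr; rewrite big_cons.
have -> : a != k by apply: contraNneq ar => ->.
by ring.
Qed.

Lemma is_derive_det n (M : V -> 'M[R]_n) (dM : 'M[R]_n) p w :
  (forall i j, is_derive p w (fun q => M q i j) (dM i j)) ->
  is_derive p w (fun q => \det (M q)) (\sum_k \sum_j dM k j * cofactor (M p) k j).
Proof.
move=> H.
have D : is_derive p w (fun q => \sum_(s : 'S_n) (-1) ^+ s * \prod_i M q i (s i))
   (\sum_(s : 'S_n) (-1) ^+ s * (\sum_k dM k (s k) * \prod_(i | i != k) M p i (s i))).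
  apply: is_derive_bigsum => s _.
  have D1 := @is_derive_prod 'I_n (index_enum _) (fun i q => M q i (s i))
    (fun i => dM i (s i)) p w (index_enum_uniq _) (fun i => H i (s i)).
  have := is_derive_mul (is_derive_cst ((-1) ^+ s : R) p w) D1.
  by rewrite mul0r addr0.
rewrite /determinant.
suff -> : \sum_k \sum_j dM k j * cofactor (M p) k j =
  \sum_(s : 'S_n) (-1) ^+ s * (\sum_k dM k (s k) * \prod_(i | i != k) M p i (s i)) by [].
under [RHS]eq_bigr do rewrite mulr_sumr.
rewrite [RHS]exchange_big /=; apply: eq_bigr => k _.
(* The matrix with row k differentiated: its determinant is the k-th term on both sides, by
   expansion along that row and by the Leibniz formula. *)
pose N : 'M[R]_n := \matrix_(i, j) if i == k then dM i j else M p i j.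
transitivity (\det N).
  rewrite (expand_det_row N k); apply: eq_bigr => j _; rewrite mxE eqxx; congr (_ * _).
  rewrite /cofactor; congr (_ * \det _); apply/matrixP => a b.
  by rewrite !mxE eq_sym (negPf (neq_lift _ _)).
rewrite /determinant; apply: eq_bigr => s _; congr (_ * _).
rewrite (bigD1 k) //= mxE eqxx; congr (_ * _).
by apply: eq_bigr => i ik; rewrite mxE (negPf ik).
Qed.

Lemma derive_ln_det n (M : V -> 'M[R]_n) (dM : 'M[R]_n) p w :
  (forall i j, is_derive p w (fun q => M q i j) (dM i j)) -> 0 < \det (M p) ->
  is_derive p w (fun q => ln (\det (M q))) (\sum_i \sum_j invmx (M p) j i * dM i j).
Proof.
move=> H d0.
have D := is_derive_det H.
have := is_derive_comp1 D (is_derive1_ln d0).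
suff -> : (\det (M p))^-1 * (\sum_k \sum_j dM k j * cofactor (M p) k j) =
  \sum_i \sum_j invmx (M p) j i * dM i j by [].
have uM : M p \in unitmx by rewrite unitmxE unitfE gt_eqF.
rewrite mulr_sumr; apply: eq_bigr => i _; rewrite mulr_sumr; apply: eq_bigr => j _.
by rewrite /invmx uM !mxE; ring.
Qed.

End SmoothMatrices.

(** * Quadratic forms and their inverses *)

Section QuadraticForms.
Context {R : realType} {n : nat}.
Implicit Types (A L : 'M[R]_n) (w y : 'rV[R]_n).

Definition quad A w : R := (w *m A *m w^T) 0 0.

Lemma quadE A w : quad A w = \sum_i \sum_j w 0 i * A i j * w 0 j.
Proof. exact: quad_dot. Qed.

Lemma dotE w y : dot w y = (w *m y^T) 0 0.
Proof. by rewrite /dot mxE; apply: eq_bigr => i _; rewrite mxE. Qed.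

Lemma dot_ge0 w : 0 <= dot w w.
Proof. by apply: sumr_ge0 => i _; rewrite -expr2 sqr_ge0. Qed.

Lemma norm_sqr_le_dot w : `|w| ^+ 2 <= dot w w.
Proof.
have : `|w| <= Num.sqrt (dot w w).
  apply: norm_row_le; first exact: sqrtr_ge0.
  move=> i; rewrite -sqrtr_sqr; apply: ler_wsqrtr.
  rewrite /dot (bigD1 i) //= expr2 lerDl; apply: sumr_ge0 => j _.
  by rewrite -expr2 sqr_ge0.
rewrite -(@ler_pXn2r _ 2) ?nnegrE ?sqrtr_ge0 // sqr_sqrtr //.
exact: dot_ge0.
Qed.

Lemma dot_gt0 w : w != 0 -> 0 < dot w w.
Proof.
move=> w0; apply: lt_le_trans (norm_sqr_le_dot w).
by rewrite exprn_gt0 // normr_gt0.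
Qed.

Lemma dot_cauchy_schwarz w y : dot w y ^+ 2 <= dot w w * dot y y.
Proof.
apply: le_trans (cauchy_schwarz _ _) _.
by rewrite le_eqVlt; apply/orP; left; apply/eqP; congr (_ * _);
  apply: eq_bigr => i _; rewrite expr2.
Qed.

Lemma invmx_cholesky L : L \in unitmx -> invmx (L *m L^T) = (invmx L)^T *m invmx L.
Proof.
move=> uL; have uLT : L^T \in unitmx by rewrite unitmx_tr.
have uA : L *m L^T \in unitmx by rewrite unitmx_mul uL.
have E : L *m L^T *m ((invmx L)^T *m invmx L) = 1%:M.
  by rewrite -mulmxA (mulmxA L^T) -trmx_mul mulVmx // trmx1 mul1mx mulmxV.
by rewrite -[RHS](mulKmx uA) E mulmx1.
Qed.

(** Cauchy-Schwarz for w L and w L^-T, where A = L L^T; their scalar product is |w|^2. *)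
Lemma quad_inv_ge A w : A^T = A -> posdef A ->
  dot w w ^+ 2 <= quad A w * quad (invmx A) w.
Proof.
move=> sA pA; have [L EA uL] := cholesky sA pA.
pose a := w *m L; pose b := w *m (invmx L)^T.
have -> : dot w w = dot a b.
  by rewrite !dotE /a /b trmx_mul trmxK mulmxA -(mulmxA w) mulmxV // mulmx1.
have -> : quad A w = dot a a.
  by rewrite dotE /quad EA /a trmx_mul !mulmxA.
have -> : quad (invmx A) w = dot b b.
  by rewrite dotE /quad EA invmx_cholesky // /b trmx_mul trmxK !mulmxA.
exact: dot_cauchy_schwarz.
Qed.

Lemma quad_le_entries A w B : (forall i j, `|A i j| <= B) ->
  quad A w <= n%:R * B * dot w w.
Proof.
move=> HB; rewrite quadE.
apply: (@le_trans _ _ (\sum_i \sum_j B * (2^-1 * (w 0 i ^+ 2 + w 0 j ^+ 2)))).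
  apply: ler_sum => i _; apply: ler_sum => j _.
  apply: (le_trans (ler_norm _)); rewrite !normrM.
  have -> : `|w 0 i| * `|A i j| * `|w 0 j| = `|A i j| * (`|w 0 i| * `|w 0 j|) by ring.
  apply: ler_pM; [by []|by rewrite mulr_ge0|exact: HB|].
  rewrite -[w 0 i ^+ 2]real_normK ?num_real // -[w 0 j ^+ 2]real_normK ?num_real //.
  by have := sqr_ge0 (`|w 0 i| - `|w 0 j|); rewrite sqrrB; lra.
under eq_bigr do rewrite -mulr_sumr -mulr_sumr big_split /= sumr_const card_ord.
rewrite -mulr_sumr -mulr_sumr big_split /= sumr_const card_ord sumrMnl.
have -> : \sum_i w 0 i ^+ 2 = dot w w by apply: eq_bigr => i _; rewrite expr2.
rewrite le_eqVlt; apply/orP; left; apply/eqP.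
by rewrite -mulr_natr; field.
Qed.

End QuadraticForms.

(** * The Legendre transform *)

Section LegendreTransform.
Context {R : realType} {n : nat}.
Notation S := 'rV[R]_n.
Notation V := (R * 'rV[R]_n)%type.
Notation e i := (delta_mx 0 i : S).

Lemma dx_coord i j : dx i (fun p : V => p.2 0 j) = (fun=> (j == i)%:R).
Proof.
apply: dxE => p; have := is_derive_coord st_coordinates (Some j) p (0, e i).
by rewrite /= mxE eqxx.
Qed.

Lemma min_derive0 (g : R -> R) d : is_derive (0 : R) (1 : R) g d ->
  (forall t, g 0 <= g t) -> d = 0.
Proof.
move=> /is_deriveP H gmin; apply/eqP; rewrite -normr_le0.
apply/ler_addgt0Pr => eps eps0; rewrite add0r.
have [del d0 hd] := H _ eps0.
have h0 : 0 < del / 2 by rewrite divr_gt0.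
have h1 : del / 2 < del by rewrite ltr_pdivrMr // ltr_pMr // ltr1n.
have hn : (del / 2) != 0 by rewrite gt_eqF.
have := hd (del / 2) hn; rewrite gtr0_norm // => /(_ h1).
have := hd (- (del / 2)); rewrite oppr_eq0 hn normrN gtr0_norm // => /(_ isT h1).
rewrite !add0r ![_%:A]mulr1 invrN mulNr.
have i0 : 0 <= (del / 2)^-1 by rewrite invr_ge0 ltW.
have h5 : 0 <= (del / 2)^-1 * (g (del / 2) - g 0) by rewrite mulr_ge0 ?subr_ge0.
have h6 : 0 <= (del / 2)^-1 * (g (- (del / 2)) - g 0) by rewrite mulr_ge0 ?subr_ge0.
move: h5 h6; set P := _ * (g (del / 2) - _); set Q := _ * (g (- _) - _) => h5 h6.
rewrite !ltr_norml => /andP[h7 h8] /andP[h9 h10].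
by rewrite ler_norml; lra.
Qed.

Variable psi : V -> R.
Hypothesis spsi : smooth psi.
Hypothesis ppsi : periodicx psi.

Definition kpot (p : V) : R := kahler_potential (fun y => psi (p.1, y)) p.2.

Lemma smooth_dot : smooth (fun p : V => dot p.2 p.2).
Proof. by apply: smooth_sum => i _; apply: smoothM; exact: smooth_coord. Qed.

Lemma smooth_pot : smooth kpot.
Proof.
have -> : kpot = (fun p => 2^-1 * dot p.2 p.2 + psi p) by apply/funext => -[s x].
apply: smoothD; last exact: spsi.
by apply: smoothM; [exact: smooth_cst|exact: smooth_dot].
Qed.

Lemma dx_pot i : dx i kpot = (fun p => p.2 0 i + dx i psi p).
Proof.
have -> : kpot = (fun p => 2^-1 * dot p.2 p.2 + psi p) by apply/funext => -[s x].
rewrite dxD; [|by apply: smoothM; [exact: smooth_cst|exact: smooth_dot]|exact: spsi].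
rewrite dxM; [|exact: smooth_cst|exact: smooth_dot].
apply/funext => p; congr (_ + _); rewrite dx_cst mul0r addr0 /dot.
rewrite dx_sum; last by move=> k _; apply: smoothM; exact: smooth_coord.
rewrite (eq_bigr (fun k => if k == i then 2 * p.2 0 i else 0)).
  by rewrite -big_mkcond big_pred1_eq mulKf.
move=> k _; rewrite dxM ?dx_coord; [|exact: smooth_coord|exact: smooth_coord].
by case: eqP => [->|_]; rewrite ?(mulr1, mul1r, mulr0, mul0r, addr0) //; ring.
Qed.

Lemma dt_pot : dt kpot = dt psi.
Proof.
have -> : kpot = (fun p => 2^-1 * dot p.2 p.2 + psi p) by apply/funext => -[s x].
apply/funext => -[s x].
have E : is_derive s (1 : R) (fun r => 2^-1 * dot x x + psi (r, x)) (0 + dt psi (s, x)).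
  apply: (is_derive_add (is_derive_cst (2^-1 * dot x x) s (1 : R))).
  exact: line_dt.
have sp : smooth (fun p : V => 2^-1 * dot p.2 p.2 + psi p).
  apply: smoothD; last exact: spsi.
  by apply: smoothM; [exact: smooth_cst|exact: smooth_dot].
have [_ <-] := line_dt s x sp; have [_] := E.
by rewrite add0r => ->.
Qed.

Lemma dx_dx_pot i j : dx i (dx j kpot) = (fun p => (j == i)%:R + dx i (dx j psi) p).
Proof.
by rewrite dx_pot (dxD i (smooth_coord j) (smooth_dx j spsi)) dx_coord.
Qed.

(* Opaque, so that unification never compares entries by unfolding derivatives. *)
Fact Vmat_seal : {M : V -> 'M[R]_n | forall p i j, M p i j = dx i (dx j kpot) p}.
Proof. by exists (fun p => \matrix_(i, j) dx i (dx j kpot) p) => p i j; rewrite mxE. Qed.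

Definition Vmat : V -> 'M[R]_n := sval Vmat_seal.

Lemma Vmat_dx p i j : Vmat p i j = dx i (dx j kpot) p.
Proof. exact: (svalP Vmat_seal). Qed.

Lemma hessian_pot s : hessian (kahler_potential (fun y => psi (s, y))) = (fun x => Vmat (s, x)).
Proof.
apply/funext => x; apply/matrixP => i j; rewrite [LHS]mxE Vmat_dx.
have -> : partial j (kahler_potential (fun y => psi (s, y))) =
    (fun y => dx j kpot (s, y)) by exact: (partial_sliceE j kpot s).
exact: (partial_slice i (dx j kpot) s x).
Qed.

Lemma smooth_dx_pot i : smooth (dx i kpot).
Proof. by apply: smooth_dx; exact: smooth_pot. Qed.

Lemma smooth_Vmat i j : smooth (fun p => Vmat p i j).
Proof.
have -> : (fun p => Vmat p i j) = dx i (dx j kpot).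
  by apply/funext => p; exact: Vmat_dx.
by apply: smooth_dx; exact: smooth_dx_pot.
Qed.

Lemma VmatE p i j : Vmat p i j = (i == j)%:R + dx i (dx j psi) p.
Proof. by rewrite Vmat_dx dx_dx_pot eq_sym. Qed.

Lemma periodic_Vmat i j : periodicx (fun p => Vmat p i j).
Proof.
have -> : (fun p => Vmat p i j) = (fun p => (i == j)%:R + dxs [:: i; j] psi p).
  by apply/funext => p; exact: VmatE.
move: (dxs [:: i; j] psi) (periodicx_dxs [:: i; j] ppsi) => f pf s m x.
by rewrite pf.
Qed.

Lemma Vmat_sym p : (Vmat p)^T = Vmat p.
Proof.
apply/matrixP => i j; rewrite [LHS]mxE !Vmat_dx.
by rewrite (dx_comm _ _ smooth_pot).
Qed.

Hypothesis posV : forall p, posdef (Vmat p).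

Lemma unit_Vmat p : Vmat p \in unitmx.
Proof. exact: posdef_unit (Vmat_sym p) (posV p). Qed.

Definition Umat (p : V) : 'M[R]_n := invmx (Vmat p).

Lemma smooth_Umat i j : smooth (fun p => Umat p i j).
Proof. by apply: smooth_invmx; [exact: smooth_Vmat|exact: unit_Vmat]. Qed.

Lemma Umat_sym p : (Umat p)^T = Umat p.
Proof. by rewrite /Umat trmx_inv Vmat_sym. Qed.

Lemma Umat_symE p i j : Umat p i j = Umat p j i.
Proof. by rewrite -{1}Umat_sym mxE. Qed.

Lemma periodic_Umat i j : periodicx (fun p => Umat p i j).
Proof.
move=> s m x; rewrite /Umat.
suff -> : Vmat (s, x + map_mx intr m) = Vmat (s, x) by [].
by apply/matrixP => a b; exact: (periodic_Vmat a b s m x).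
Qed.

(** A lower bound for V is read off from an upper bound for its inverse: periodicity bounds the
    entries of [Umat], and |w|^4 <= V(w, w) U(w, w) <= V(w, w) n B |w|^2. *)
Lemma strong_convexity (a b : R) : exists2 c, 0 < c &
  forall s x w, a <= s <= b -> c * dot w w <= quad (Vmat (s, x)) w.
Proof.
have [B B0 HB] : exists2 B, 0 <= B & forall s x i j, a <= s <= b ->
    `|Umat (s, x) i j| <= B.
  have H i j := periodic_bounded a b (smooth_cont (smooth_Umat i j)) (periodic_Umat i j).
  exists (\sum_i \sum_j `|projT1 (cid2 (H i j))|).
    by apply: sumr_ge0 => i _; apply: sumr_ge0.
  move=> s x i j hs; rewrite (bigD1 i) //= (bigD1 j) //=.
  have H1 : `|Umat (s, x) i j| <= `|projT1 (cid2 (H i j))|.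
    case: (cid2 (H i j)) => C C0 HC /=; rewrite (ger0_norm C0); exact: HC.
  rewrite -addrA ler_wpDr //; apply: addr_ge0; first exact: sumr_ge0.
  by apply: sumr_ge0 => k _; apply: sumr_ge0.
have nB : 0 < n%:R * B + 1 by rewrite ltr_wpDl // mulr_ge0.
exists (n%:R * B + 1)^-1; first by rewrite invr_gt0.
move=> s x w hs; rewrite ler_pdivrMl //.
have [->|w0] := eqVneq w 0.
  by rewrite dotE /quad !mul0mx mxE mulr0.
have d0 := dot_gt0 w0.
have q0 : 0 < quad (Vmat (s, x)) w by apply: posV.
have h1 := quad_inv_ge w (Vmat_sym (s, x)) (@posV (s, x)).
have h2 := quad_le_entries w (fun i j => HB s x i j hs).
have h3 : dot w w * dot w w <= (quad (Vmat (s, x)) w * (n%:R * B)) * dot w w.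
  by rewrite -expr2 (le_trans h1) // -mulrA ler_pM2l.
rewrite ler_pM2r // in h3; apply: (le_trans h3).
by rewrite mulrDl mul1r mulrC lerDl ltW.
Qed.

Lemma is_derive_segment (f : V -> R) s (x w : S) (t : R) : smooth f ->
  is_derive t (1 : R) (fun r => f (s, x + r *: w))
    (\sum_j w 0 j * dx j f (s, x + t *: w)).
Proof.
move=> sf; have := @is_derive_line _ _ f (s, x) (0, w) t _ (smooth_is_derive _ _ sf).
have E r : (s, x) + r *: (0, w) = (s, x + r *: w) :> V.
  by congr (_, _); rewrite /= scaler0 addr0.
rewrite E derive_st // mul0r add0r.
by have -> : (fun r => f ((s, x) + r *: (0, w))) = (fun r => f (s, x + r *: w))
  by apply/funext => r; rewrite E.
Qed.

(** Strong convexity integrated along a segment. This makes the gradient map injective, and its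
    inverse Lipschitz uniformly for bounded times. *)
Lemma grad_monotone (a b : R) : exists2 c, 0 < c &
  forall s x y, a <= s <= b ->
    c * `|x - y| <= \sum_i `|dx i kpot (s, x) - dx i kpot (s, y)|.
Proof.
have [c c0 H] := strong_convexity a b; exists c => // s x y hs.
have [->|xy] := eqVneq x y.
  by rewrite subrr normr0 mulr0; apply: sumr_ge0.
pose w := x - y; have w0 : 0 < `|w| by rewrite normr_gt0 subr_eq0.
have D (t : R) : is_derive t (1 : R) (fun r => \sum_i w 0 i * dx i kpot (s, y + r *: w))
    (\sum_i w 0 i * (\sum_j w 0 j * dx j (dx i kpot) (s, y + t *: w))).
  apply: is_derive_bigsum => i _.
  have := is_derive_mul (is_derive_cst (w 0 i) t (1 : R))
    (is_derive_segment s y w t (smooth_dx_pot i)).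
  by rewrite mul0r addr0.
have [t _ E] := MVT_any 0 1 D.
have hq : c * `|w| ^+ 2 <= quad (Vmat (s, y + t *: w)) w.
  by apply: le_trans (H _ _ _ hs); rewrite ler_pM2l // norm_sqr_le_dot.
have qE : quad (Vmat (s, y + t *: w)) w =
    \sum_i w 0 i * (dx i kpot (s, x) - dx i kpot (s, y)).
  have -> : \sum_i w 0 i * (dx i kpot (s, x) - dx i kpot (s, y)) =
     \sum_i w 0 i * dx i kpot (s, y + 1 *: w) - \sum_i w 0 i * dx i kpot (s, y + 0 *: w).
    rewrite -sumrB scale1r scale0r addr0 /w [y + _]addrC subrK.
    by apply: eq_bigr => i _; rewrite mulrBr.
  rewrite E subr0 mulr1 quadE; apply: eq_bigr => i _; rewrite mulr_sumr.
  by apply: eq_bigr => j _; rewrite Vmat_dx (dx_comm i j smooth_pot); ring.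
have : c * `|w| ^+ 2 <= `|w| * \sum_i `|dx i kpot (s, x) - dx i kpot (s, y)|.
  rewrite (le_trans hq) // qE mulr_sumr; apply: ler_sum => i _.
  by rewrite (le_trans (ler_norm _)) // normrM ler_wpM2r // norm_coord.
by rewrite expr2 mulrA mulrC ler_pM2l.
Qed.

(** The potential minus the linear function x is coercive, psi being bounded; at its minimum the
    gradient equals x. *)
Lemma grad_onto s (x : S) : exists xi, grad (fun y => kpot (s, y)) xi = x.
Proof.
have [C C0 HC] := periodic_bounded s s (smooth_cont spsi) ppsi.
have ss : s <= s <= s by rewrite lexx.
pose f y := kpot (s, y) - dot x y.
(* Beyond this radius |y|^2 / 2 dominates both the linear term and the oscillation of psi, at most 2
   C, so the minimum over the cube is global. *)
pose rho : R := 2 * (\sum_i `|x 0 i| + 1) + 4 * C + 1.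
have X0 : 0 <= \sum_i `|x 0 i| by apply: sumr_ge0.
have rho0 : 0 <= rho by rewrite /rho; lra.
have lin y : dot x y <= (\sum_i `|x 0 i|) * `|y|.
  rewrite mulr_suml; apply: ler_sum => i _.
  by rewrite (le_trans (ler_norm _)) // normrM ler_wpM2l // norm_coord.
have far y : rho < `|y| -> f 0 <= f y.
  move=> hy; have h1 := HC s y ss; have h2 := HC s 0 ss.
  have h3 := norm_sqr_le_dot y; have h4 := lin y.
  have d0 : dot x 0 = 0 by rewrite /dot big1 // => i _; rewrite mxE mulr0.
  have d00 : dot (0 : S) 0 = 0 by rewrite /dot big1 // => i _; rewrite mxE mulr0.
  rewrite /f /kpot /kahler_potential /= d0 d00 mulr0 add0r subr0.
  move: h1 h2; rewrite !ler_norml => /andP[h1 h1'] /andP[h2 h2'].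
  have h5 : (2 * (\sum_i `|x 0 i|) + 4 * C) * `|y| <= `|y| ^+ 2.
    by rewrite expr2 ler_wpM2r //; move: hy; rewrite /rho; lra.
  have h6 : 1 <= `|y| by move: hy; rewrite /rho; lra.
  have h7 : 4 * C <= 4 * C * `|y| by rewrite ler_peMr // mulr_ge0.
  nra.
have cf : continuous f.
  apply/continuousP_lt => y eps eps0.
  have sl : smooth (fun p : V => kpot p - dot x p.2).
    apply: smoothB; first exact: smooth_pot.
    by apply: smooth_sum => i _; apply: smoothM; [exact: smooth_cst|exact: smooth_coord].
  have [d d0 hd] := (continuousP_lt _).1 (smooth_cont sl) (s, y) _ eps0.
  exists d => // v hv; have := hd (0, v).
  have -> : (s, y) + (0, v) = (s, y + v) :> V by congr (_, _); rewrite /= addr0.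
  by rewrite norm_pair /= normr0 gt_max d0 hv => /(_ isT).
have cK : compact [set y : S | forall i, y ord0 i \in `[- rho, rho]].
  by apply: (@rV_compact _ _ (fun=> `[- rho, rho]%classic)) => _; exact: segment_compact.
have K0 : [set y : S | forall i, y ord0 i \in `[- rho, rho]] !=set0.
  by exists 0 => i /=; rewrite mxE in_itv /=; apply/andP; split; lra.
have [xi xiK xmin] := EVT_min_rV K0 cK (continuous_subspaceT cf).
have gmin y : f xi <= f y.
  have [yr|/far] := leP `|y| rho.
    apply: xmin; rewrite inE => i; rewrite in_itv /= -ler_norml.
    by apply: le_trans yr; exact: norm_coord.
  apply: le_trans; apply: xmin; rewrite inE => i.
  by rewrite mxE in_itv /=; apply/andP; split; lra.
exists xi; apply/rowP => i; rewrite mxE partial_slice.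
have D : is_derive (0 : R) (1 : R) (fun t => f (xi + t *: e i)) (dx i kpot (s, xi) - x 0 i).
  have D1 := line_dx i s xi 0 smooth_pot; rewrite scale0r addr0 in D1.
  have D2 : is_derive (0 : R) (1 : R) (fun t => dot x xi + t * x 0 i) (0 + (0 * 0 + 1 * x 0 i)).
    apply: (is_derive_add (is_derive_cst _ _ _)).
    exact: (is_derive_mul (is_derive_id (0 : R) (1 : R)) (is_derive_cst (x 0 i) _ _)).
  have := is_derive_add D1 (is_deriveN D2).
  rewrite mulr0 mul1r !add0r.
  suff -> : (fun t => f (xi + t *: e i)) =
    (fun q => kpot (s, xi + q *: e i) + (- (fun t => dot x xi + t * x 0 i)) q) by [].
  apply/funext => t; rewrite /f; congr (_ - _); rewrite /dot -[RHS]addr0.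
  rewrite (eq_bigr (fun k => x 0 k * xi 0 k + (if k == i then t * x 0 i else 0))).
    by rewrite big_split /= -big_mkcond big_pred1_eq addr0.
  move=> k _; rewrite !mxE mulrDr eqxx; case: eqP => [->|_] /=; rewrite ?mulr0 //.
  by rewrite mulr1; ring.
have := min_derive0 D; rewrite scale0r addr0 => /(_ (fun t => gmin _)).
by move/eqP; rewrite subr_eq0 => /eqP.
Qed.

Lemma grad_inj s : injective (grad (fun y => kpot (s, y))).
Proof.
move=> x y xy; have [c c0 H] := grad_monotone s s.
have := H s x y; rewrite lexx => /(_ isT).
rewrite big1 ?pmulr_rle0 // ?normr_le0 ?subr_eq0; first by move/eqP.
move=> i _; have := congr1 (fun z : S => z 0 i) xy.
by rewrite !mxE !partial_slice => ->; rewrite subrr normr0.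
Qed.

(** The inverse of the gradient map, with the same choice operator as [legendre] so that the two
    agree literally, and opaque like [Vmat]. *)
Fact Xi_seal : {X : V -> S |
  forall p, X p = xget 0 [set xi | grad (fun y => kpot (p.1, y)) xi = p.2]}.
Proof. by exists (fun p => xget 0 [set xi | grad (fun y => kpot (p.1, y)) xi = p.2]). Qed.

Definition Xi : V -> S := sval Xi_seal.

Lemma XiE p : Xi p = xget 0 [set xi | grad (fun y => kpot (p.1, y)) xi = p.2].
Proof. exact: (svalP Xi_seal). Qed.

Lemma grad_Xi p : grad (fun y => kpot (p.1, y)) (Xi p) = p.2.
Proof.
rewrite XiE; case: xgetP => [xi -> //|H].
by have [xi Exi] := grad_onto p.1 p.2; case: (H xi).
Qed.

Lemma dx_pot_Xi p i : dx i kpot (p.1, Xi p) = p.2 0 i.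
Proof. by rewrite -[in RHS]grad_Xi mxE partial_slice. Qed.

Lemma Xi_grad s xi : Xi (s, grad (fun y => kpot (s, y)) xi) = xi.
Proof. by apply: (@grad_inj s); exact: grad_Xi. Qed.

End LegendreTransform.

(** * The inverse gradient map, the symplectic potential and scalar curvature *)

Section SymplecticCoordinates.
Context {R : realType} {n : nat}.
Notation S := 'rV[R]_n.
Notation V := (R * 'rV[R]_n)%type.
Notation e i := (delta_mx 0 i : S).
Variable psi : V -> R.
Hypothesis spsi : smooth psi.
Hypothesis ppsi : periodicx psi.
Hypothesis posV : forall p, posdef (Vmat psi p).
Local Notation pot := (kpot psi).
Local Notation Vm := (Vmat psi).
Local Notation Um := (Umat psi).
Local Notation Xi := (Xi psi).

Let spot := smooth_pot spsi.
Let sX i : smooth (dx i pot) := smooth_dx i spot.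
Let sU i j := smooth_Umat spsi posV i j.

Definition Theta (p : V) : V := (p.1, Xi p).

Lemma dx_pot_Theta p i : dx i pot (Theta p) = p.2 0 i.
Proof. exact: (dx_pot_Xi spsi ppsi). Qed.

Lemma periodic_dt_dx_pot i : periodicx (dt (dx i pot)).
Proof.
rewrite -(dx_dt i spot) (dt_pot spsi).
exact: (periodicx_dxs [:: i] (periodicx_derive (1, 0) ppsi)).
Qed.

(** Strong monotonicity at the shifted time compares the new point with the old one: their gradients
    differ by the change of x minus the drift of the gradient in time, both O(|v|). This precedes
    any differentiability of [Xi]. *)
Lemma Xi_lip p0 : exists2 C, 0 <= C &
  forall v : V, `|v| <= 1 -> `|Xi (p0 + v) - Xi p0| <= C * `|v|.
Proof.
have [c c0 Hc] := grad_monotone spsi ppsi posV (p0.1 - 1) (p0.1 + 1).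
have HB i := periodic_bounded (p0.1 - 1) (p0.1 + 1) (smooth_cont (smooth_dt (sX i)))
  (periodic_dt_dx_pot i).
pose B i := projT1 (cid2 (HB i)).
have B0 i : 0 <= B i by rewrite /B; case: (cid2 (HB i)).
have BB i s x : p0.1 - 1 <= s <= p0.1 + 1 -> `|dt (dx i pot) (s, x)| <= B i.
  by rewrite /B; case: (cid2 (HB i)) => C C0 H /=; exact: H.
exists ((\sum_i (1 + B i)) / c).
  by rewrite divr_ge0 ?(ltW c0) // sumr_ge0 // => i _; rewrite addr_ge0.
move=> v v1.
have hv1 : `|v.1| <= `|v| by rewrite norm_pair le_max lexx.
have hv2 : `|v.2| <= `|v| by rewrite norm_pair le_max lexx orbT.
have hs : p0.1 - 1 <= p0.1 + v.1 <= p0.1 + 1.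
  by have := le_trans hv1 v1; rewrite ler_norml; lra.
rewrite mulrAC ler_pdivlMr // mulrC.
apply: le_trans (Hc (p0.1 + v.1) _ _ hs) _.
rewrite mulr_suml; apply: ler_sum => i _.
have -> : dx i pot (p0.1 + v.1, Xi (p0 + v)) = p0.2 0 i + v.2 0 i.
  by have := dx_pot_Theta (p0 + v) i; rewrite mxE.
rewrite -(dx_pot_Theta p0 i) /Theta.
have [t ht E] := MVT_any p0.1 (p0.1 + v.1) (fun r => line_dt r (Xi p0) (sX i)).
have -> : dx i pot (p0.1, Xi p0) + v.2 0 i - dx i pot (p0.1 + v.1, Xi p0) =
  v.2 0 i - (dx i pot (p0.1 + v.1, Xi p0) - dx i pot (p0.1, Xi p0)) by ring.
rewrite E addrAC subrr add0r mulrDl mul1r.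
rewrite (le_trans (ler_normB _ _)) // lerD //.
  by apply: le_trans hv2; exact: norm_coord.
rewrite normrM ler_pM //; apply: BB.
move: ht hs; rewrite minEle maxEle; case: ifP; lra.
Qed.

Lemma cont_Theta (g : V -> R) : continuous g -> continuous (fun p => g (Theta p)).
Proof.
move=> cg; apply/continuousP_lt => p eps eps0.
have [d d0 hd] := (continuousP_lt g).1 cg (Theta p) _ eps0.
have [C C0 HC] := Xi_lip p.
have C1 : 0 < C + 1 by rewrite ltr_wpDl.
exists (Num.min 1 (d / (C + 1))); first by rewrite lt_min ltr01 divr_gt0.
move=> v; rewrite lt_min => /andP[v1 vd].
have -> : Theta (p + v) = Theta p + (v.1, Xi (p + v) - Xi p).
  by congr (_, _); rewrite /= [RHS]addrC subrK.
apply: hd; rewrite norm_pair /= gt_max.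
move: vd; rewrite ltr_pdivlMr // => vd; apply/andP; split.
  apply: le_lt_trans vd; apply: (@le_trans _ _ `|v|).
    by rewrite norm_pair le_max lexx.
  by rewrite ler_peMr // lerDr.
apply: le_lt_trans vd; apply: (le_trans (HC v (ltW v1))).
by rewrite mulrC ler_wpM2l // lerDl.
Qed.

(** The implicit function theorem for grad v(Xi) = x: the equation is expanded to first order at
    [Theta p0] and solved with U = V^-1; [Xi_lip] makes the error o(|h|). *)
Lemma is_derive_Xi p0 (w : V) k : is_derive p0 w (fun p => Xi p 0 k)
  (\sum_i Um (Theta p0) i k * (w.2 0 i - w.1 * dt (dx i pot) (Theta p0))).
Proof.
apply/is_deriveP => eps eps0; set q := Theta p0.
have [C C0 HC] := Xi_lip p0.
(* Bounds the increment [z] of [Theta]: |h w| covers its time part and C |h w| its space part. *)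
pose C' := (1 + C) * `|w|.
have C'0 : 0 <= C' by rewrite mulr_ge0 // addr_ge0.
pose M := \sum_i `|Um q i k|.
have M0 : 0 <= M by apply: sumr_ge0.
have MC : 0 < M * C' + 1 by rewrite ltr_wpDl // mulr_ge0.
have e1 : 0 < eps / (M * C' + 1) by rewrite divr_gt0.
have [d d0 hd] : exists2 d, 0 < d & forall i r, r < d -> forall z : V, `|z| <= r ->
    `|dx i pot (q + z) - dx i pot q -
      \sum_j st_coord j z * 'D_(st_vec j) (dx i pot) q| <= eps / (M * C' + 1) * `|z|.
  apply: finite_delta => i; have [d d0 hd] := frechet st_coordinates q (sX i) e1.
  by exists d => // r rd z zr; apply: hd; exact: le_lt_trans rd.
have w1 : 0 < `|w| + 1 by rewrite ltr_wpDl.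
have C1 : 0 < C' + 1 by rewrite ltr_wpDl.
exists (Num.min (`|w| + 1)^-1 (d / (C' + 1))).
  by rewrite lt_min invr_gt0 w1 divr_gt0.
move=> h h0; rewrite lt_min => /andP[hw hdC].
have hw1 : `|h *: w| <= 1.
  rewrite normrZ; apply: (@le_trans _ _ (`|h| * (`|w| + 1))).
    by rewrite ler_wpM2l // lerDl.
  by rewrite -ler_pdivlMr // mul1r ltW.
have HD := HC _ hw1.
set D := Xi (p0 + h *: w) - Xi p0 in HD.
pose z : V := (h * w.1, D).
have zC : `|z| <= C' * `|h|.
  rewrite norm_pair /= ge_max; apply/andP; split.
    rewrite normrM /C' mulrC ler_wpM2r // mulrDl mul1r ler_wpDr ?mulr_ge0 //.
    by rewrite norm_pair le_max lexx.
  apply: (le_trans HD); rewrite normrZ /C'.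
  have -> : (1 + C) * `|w| * `|h| = C * (`|h| * `|w|) + `|w| * `|h| by ring.
  by rewrite lerDl mulr_ge0.
have zd : `|z| < d.
  apply: (le_lt_trans zC); move: hdC; rewrite ltr_pdivlMr // => /(le_lt_trans _); apply.
  by rewrite mulrC ler_wpM2l // lerDl.
pose r i := dx i pot (q + z) - dx i pot q -
      \sum_j st_coord j z * 'D_(st_vec j) (dx i pot) q.
have rB i : `|r i| <= eps / (M * C' + 1) * (C' * `|h|).
  by rewrite (le_trans (hd i `|z| zd z (lexx _))) // ler_wpM2l // ltW.
(* The linearised equation: V applied to the increment [D] equals the prescribed first-order change
   up to the Frechet remainder [r]. *)
have rE i : \sum_j D 0 j * Vm q j i = h * (w.2 0 i - w.1 * dt (dx i pot) q) - r i.
  have -> : \sum_j D 0 j * Vm q j i = \sum_j D 0 j * dx j (dx i pot) q.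
    by apply: eq_bigr => j _; rewrite Vmat_dx.
  rewrite /r sum_option /=.
  have -> : q + z = Theta (p0 + h *: w).
    by congr (_, _) => //=; rewrite /D addrC subrK.
  rewrite dx_pot_Theta /q dx_pot_Theta -/q.
  rewrite [(p0 + h *: w).2 0 i]mxE [(h *: w).2 0 i]mxE.
  rewrite -/(dt (dx i pot) q); set A := \sum_j _.
  by ring.
have DE : D 0 k = \sum_i (\sum_j D 0 j * Vm q j i) * Um q i k.
  have E : D = D *m Vm q *m Um q.
    by rewrite -mulmxA /Umat mulmxV ?mulmx1 //; exact: (unit_Vmat spsi posV).
  by rewrite {1}E mxE; apply: eq_bigr => i _; rewrite mxE.
have -> : Xi (p0 + h *: w) 0 k - Xi p0 0 k = D 0 k by rewrite /D !mxE.
rewrite DE mulr_sumr -sumrB.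
apply: (@le_lt_trans _ _ (\sum_i `|Um q i k| * (eps / (M * C' + 1) * C'))).
  apply: (le_trans (ler_norm_sum _ _ _)); apply: ler_sum => i _.
  rewrite rE.
  have -> : h^-1 * ((h * (w.2 0 i - w.1 * dt (dx i pot) q) - r i) * Um q i k) -
    Um q i k * (w.2 0 i - w.1 * dt (dx i pot) q) = - (Um q i k * (h^-1 * r i)).
    by field.
  rewrite normrN normrM ler_wpM2l // normrM normfV ler_pdivrMl ?normr_gt0 //.
  by rewrite (le_trans (rB i)) // mulrA mulrC.
rewrite -mulr_suml -/M.
have -> : M * (eps / (M * C' + 1) * C') = eps * ((M * C') / (M * C' + 1)).
  by field; rewrite gt_eqF.
by rewrite gtr_pMr // ltr_pdivrMr // mul1r ltrDl.
Qed.

Lemma is_derive_Theta (g : V -> R) p (w : V) : smooth g ->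
  is_derive p w (fun q => g (Theta q)) (w.1 * dt g (Theta p) + \sum_j
   (\sum_i Um (Theta p) i j * (w.2 0 i - w.1 * dt (dx i pot) (Theta p))) *
     dx j g (Theta p)).
Proof.
move=> sg; apply: st_chain => //; last by move=> j; exact: is_derive_Xi.
exact: (is_derive_coord st_coordinates None p w).
Qed.

(** A derivative of g(Theta) is again F(Theta) with F smooth in (s, xi), so the class of such
    functions is closed under differentiation and no bootstrap on [Xi] is required. *)
Lemma smooth_Theta (g : V -> R) : smooth g -> smooth (fun p => g (Theta p)).
Proof.
move=> sg.
pose T (f : V -> R) := exists2 g, smooth g & f = (fun p => g (Theta p)).
have key g0 : smooth g0 -> ring_closure T (fun p => g0 (Theta p)).
  by move=> sg0; apply: closure_gen; exists g0.
apply: (@ring_closure_smooth _ _ T); last exact: key.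
move=> _ [f sf ->]; split; first by apply: cont_Theta; exact: smooth_cont.
move=> w; split; first by move=> p; have [] := is_derive_Theta p w sf.
rewrite (derive_funE (fun p => is_derive_Theta p w sf)).
pose F q := w.1 * dt f q + \sum_j
   (\sum_i Um q i j * (w.2 0 i - w.1 * dt (dx i pot) q)) * dx j f q.
apply: (key F); apply: smoothD.
  by apply: smoothM; [exact: smooth_cst|exact: smooth_dt].
apply: smooth_sum => j _; apply: smoothM; last exact: smooth_dx.
apply: smooth_sum => i _; apply: smoothM; first exact: sU.
apply: smoothB; first exact: smooth_cst.
by apply: smoothM; [exact: smooth_cst|apply: smooth_dt; exact: sX].
Qed.

Lemma dx_Theta (g : V -> R) k : smooth g ->
  dx k (fun p => g (Theta p)) = (fun p => \sum_j Um (Theta p) k j * dx j g (Theta p)).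
Proof.
move=> sg; apply: dxE => p; have := is_derive_Theta p (0, e k) sg.
rewrite /= mul0r add0r; set A := \sum_j _; set B := \sum_j _.
suff -> : A = B by [].
apply: eq_bigr => j _; congr (_ * _); rewrite (bigD1 k) //= big1 ?addr0.
  by rewrite mxE !eqxx mul0r subr0 mulr1.
by move=> i ik; rewrite mxE (negPf ik) andbF mul0r subr0 mulr0.
Qed.

Lemma dt_Theta (g : V -> R) p : smooth g ->
  dt (fun q => g (Theta q)) p = dt g (Theta p) -
   \sum_j (\sum_i Um (Theta p) i j * dt (dx i pot) (Theta p)) * dx j g (Theta p).
Proof.
move=> sg; have [_] := is_derive_Theta p (1, 0) sg.
rewrite -/(dt _ p) => ->; rewrite mul1r -sumrN; congr (_ + _).
apply: eq_bigr => j _; rewrite -mulNr -sumrN; congr (_ * _).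
by apply: eq_bigr => i _; rewrite mxE mul1r sub0r mulrN.
Qed.

Lemma smooth_Xi k : smooth (fun p => Xi p 0 k).
Proof. exact: (smooth_Theta (smooth_coord k)). Qed.

Lemma dx_Xi i k p : dx i (fun p => Xi p 0 k) p = Um (Theta p) i k.
Proof.
rewrite (dx_Theta i (smooth_coord k)) (bigD1 k) //= dx_coord eqxx mulr1.
by rewrite big1 ?addr0 // => j jk; rewrite dx_coord eq_sym (negPf jk) mulr0.
Qed.

Lemma dt_Xi k p : dt (fun p => Xi p 0 k) p =
  - \sum_i Um (Theta p) i k * dt (dx i pot) (Theta p).
Proof.
rewrite (dt_Theta p (smooth_coord k)).
have -> : dt (fun p : V => p.2 0 k) (Theta p) = 0.
  have [_ E] := is_derive_coord st_coordinates (Some k) (Theta p) (1, 0).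
  by rewrite /dt E /= mxE.
rewrite sub0r (bigD1 k) //= [X in _ + X]big1 ?addr0.
  by rewrite dx_coord eqxx mulr1.
by move=> j jk; rewrite dx_coord eq_sym (negPf jk) mulr0.
Qed.

Definition sym_pot (p : V) : R := dot p.2 (Xi p) - pot (Theta p).

Lemma smooth_sym_pot : smooth sym_pot.
Proof.
apply: smoothB; last exact: smooth_Theta.
by apply: smooth_sum => i _; apply: smoothM; [exact: smooth_coord|exact: smooth_Xi].
Qed.

Lemma dx_sym_pot k : dx k sym_pot = (fun p => Xi p 0 k).
Proof.
apply: dxE => p.
have D1 : is_derive p ((0, e k) : V) (fun q => dot q.2 (Xi q))
    (\sum_i (p.2 0 i * Um (Theta p) k i + (i == k)%:R * Xi p 0 i)).
  apply: is_derive_bigsum => i _; apply: is_derive_mul.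
    by have := is_derive_dx k p (smooth_coord i); rewrite dx_coord.
  by have := is_derive_dx k p (smooth_Xi i); rewrite dx_Xi.
have D2 := is_derive_dx k p (smooth_Theta spot); rewrite (dx_Theta k spot) in D2.
have := is_derive_add D1 (is_deriveN D2).
set A := \sum_i _ + _; suff -> : A = Xi p 0 k by [].
rewrite /A big_split /= addrAC.
have -> : \sum_j Um (Theta p) k j * dx j pot (Theta p) =
          \sum_i p.2 0 i * Um (Theta p) k i.
  by apply: eq_bigr => j _; rewrite dx_pot_Theta mulrC.
rewrite subrr add0r (bigD1 k) //= eqxx mul1r big1 ?addr0 //.
by move=> i ik; rewrite (negPf ik) mul0r.
Qed.

(** Envelope identity: the motion of [Xi] contributes nothing, since x is the gradient of the
    potential there. *)
Lemma dt_sym_pot : dt sym_pot = (fun p => - dt psi (Theta p)).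
Proof.
apply/funext => p.
have D1 : is_derive p ((1, 0) : V) (fun q => dot q.2 (Xi q))
    (\sum_i (p.2 0 i * dt (fun q => Xi q 0 i) p + 0 * Xi p 0 i)).
  apply: is_derive_bigsum => i _; apply: is_derive_mul.
    have := is_derive_coord st_coordinates (Some i) p (1, 0).
    by rewrite /= mxE.
  exact: smooth_is_derive (smooth_Xi i).
have D2 := smooth_is_derive p ((1, 0) : V) (smooth_Theta spot).
rewrite -/(dt _ p) (dt_Theta p spot) in D2.
have [_] := is_derive_add D1 (is_deriveN D2).
rewrite -/(dt sym_pot p) => ->; rewrite -(dt_pot spsi) opprB.
have -> : \sum_j (\sum_i Um (Theta p) i j * dt (dx i pot) (Theta p)) *
    dx j pot (Theta p) = - \sum_i (p.2 0 i * dt (fun q => Xi q 0 i) p + 0 * Xi p 0 i).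
  rewrite -sumrN; apply: eq_bigr => j _.
  by rewrite dx_pot_Theta dt_Xi mul0r addr0 mulrN opprK mulrC.
by rewrite addrA subrr sub0r.
Qed.

Lemma dx_dx_sym_pot i j : dx i (dx j sym_pot) = (fun p => Um (Theta p) i j).
Proof. by rewrite dx_sym_pot; apply/funext => p; rewrite dx_Xi. Qed.

Lemma hessian_sym_pot s x : hessian (fun y => sym_pot (s, y)) x = Um (Theta (s, x)).
Proof.
apply/matrixP => i j; rewrite [LHS]mxE partial_sliceE partial_slice.
by rewrite dx_dx_sym_pot.
Qed.

Lemma legendre_kpot s :
  legendre (kahler_potential (fun y => psi (s, y))) = (fun y => sym_pot (s, y)).
Proof. by apply/funext => y; rewrite /sym_pot /Theta XiE. Qed.

(** The matrix u^{ij} of the symplectic side, written as the Hessian of v at the corresponding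
    point. *)
Definition Gmat (p : V) : 'M[R]_n := Vm (Theta p).

Lemma smooth_Gmat i j : smooth (fun p => Gmat p i j).
Proof. exact: (smooth_Theta (smooth_Vmat spsi i j)). Qed.

Lemma inv_Um p : invmx (Um p) = Vm p.
Proof. by rewrite /Umat invmxK. Qed.

Lemma inv_hessian_sym_pot s i j :
  inv_hessian (fun y => sym_pot (s, y)) i j = (fun x => Gmat (s, x) i j).
Proof. by apply/funext => x; rewrite /inv_hessian hessian_sym_pot inv_Um. Qed.

Lemma grad_shift s (x : S) (m : 'rV[int]_n) :
  grad (fun y => pot (s, y)) (x + map_mx intr m) =
  grad (fun y => pot (s, y)) x + map_mx intr m.
Proof.
apply/rowP => i; rewrite [LHS]mxE [RHS]mxE [grad _ x 0 i]mxE !partial_slice.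
have X1 p : dx i pot p = p.2 0 i + dx i psi p := congr1 (fun f => f p) (dx_pot spsi i).
have X2 : dx i psi (s, x + map_mx intr m) = dx i psi (s, x).
  exact: (periodicx_dxs [:: i] ppsi s m x).
by rewrite !X1 X2 /= [(x + _) 0 i]mxE addrAC.
Qed.

Lemma Xi_shift s (x : S) (m : 'rV[int]_n) :
  Xi (s, x + map_mx intr m) = Xi (s, x) + map_mx intr m.
Proof.
apply: (grad_inj spsi ppsi posV (s := s)).
rewrite grad_shift -[s in LHS]/((s, x + map_mx intr m).1) (grad_Xi spsi ppsi).
by rewrite -[s]/((s, x).1) (grad_Xi spsi ppsi).
Qed.

Lemma periodic_Theta (g : V -> R) : periodicx g -> periodicx (fun p => g (Theta p)).
Proof. by move=> pg s m x; rewrite /Theta Xi_shift pg. Qed.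

Lemma periodic_Gmat i j : periodicx (fun p => Gmat p i j).
Proof. exact: (periodic_Theta (periodic_Vmat spsi ppsi i j)). Qed.

(* The periodic part of the symplectic potential. *)
Definition hpot (p : V) : R := sym_pot p - 2^-1 * dot p.2 p.2.

Lemma smooth_hpot : smooth hpot.
Proof.
apply: smoothB; first exact: smooth_sym_pot.
by apply: smoothM; [exact: smooth_cst|exact: smooth_dot].
Qed.

Lemma dotD (a b c : S) : dot (a + b) c = dot a c + dot b c.
Proof. by rewrite /dot -big_split; apply: eq_bigr => i _; rewrite mxE mulrDl. Qed.

Lemma dotC (a b : S) : dot a b = dot b a.
Proof. by apply: eq_bigr => i _; rewrite mulrC. Qed.

(** Completing the square, [hpot] is - |x - Xi|^2 / 2 - psi(Theta), and x - Xi is unchanged when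
    both shift by an integer vector. *)
Lemma periodic_hpot : periodicx hpot.
Proof.
move=> s m x; rewrite /hpot /sym_pot /Theta Xi_shift /kpot /kahler_potential /=.
rewrite ppsi; move: (Xi _) (map_mx intr m) (psi _) => X M P.
have DD (a b c d : S) : dot (a + b) (c + d) = dot a c + dot a d + dot b c + dot b d.
  by rewrite dotD [dot a _]dotC [dot b _]dotC !dotD ![dot _ a]dotC ![dot _ b]dotC; ring.
by rewrite !DD [dot M X]dotC [dot M x]dotC; field.
Qed.

Lemma dx_hpot i : dx i hpot = (fun p => Xi p 0 i - p.2 0 i).
Proof.
apply: dxE => p.
have D1 := is_derive_dx i p smooth_sym_pot; rewrite dx_sym_pot in D1.
have sd : smooth (fun p : V => 2^-1 * dot p.2 p.2).
  by apply: smoothM; [exact: smooth_cst|exact: smooth_dot].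
have D2 := is_derive_dx i p sd.
have E : dx i (fun p : V => 2^-1 * dot p.2 p.2) p = p.2 0 i.
  have s0 : smooth (fun _ : V => (0 : R)) by exact: smooth_cst.
  have := congr1 (fun f => f p) (dx_pot s0 i); rewrite dx_cst addr0 => <-.
  by congr (dx i _ p); apply/funext => -[s x]; rewrite /kpot /kahler_potential /= addr0.
by rewrite E in D2; exact: (is_derive_add D1 (is_deriveN D2)).
Qed.

Lemma dx_dx_hpot i j : dx i (dx j hpot) = (fun p => Um (Theta p) i j - (j == i)%:R).
Proof.
apply/funext => p; rewrite dx_hpot.
have [_ E] := is_derive_add (is_derive_dx i p (smooth_Xi j))
  (is_deriveN (is_derive_dx i p (smooth_coord j))).
by rewrite dx_Xi dx_coord in E.
Qed.

Lemma dt_hpot : dt hpot = (fun p => - dt psi (Theta p)).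
Proof.
apply/funext => p; have E0 := congr1 (fun f => f p) dt_sym_pot.
rewrite /= in E0; rewrite -E0.
have sd : smooth (fun p : V => 2^-1 * dot p.2 p.2).
  by apply: smoothM; [exact: smooth_cst|exact: smooth_dot].
have D2 := smooth_is_derive p ((1, 0) : V) sd.
have [_ E] := is_derive_add (smooth_is_derive p ((1, 0) : V) smooth_sym_pot) (is_deriveN D2).
rewrite /dt [LHS]E.
have -> : 'D_((1, 0) : V) (fun p : V => 2^-1 * dot p.2 p.2) p = 0.
  case: p {D2 E E0} => s x; rewrite -/(dt _ (s, x)); have [_ <-] := line_dt s x sd.
  by have [_ ->] := is_derive_cst (2^-1 * dot x x) s (1 : R).
by rewrite subr0.
Qed.

(** The derivative of log det V in xi_j, by Jacobi's formula. *)
Definition trace_dV (j : 'I_n) (p : V) : R :=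
  \sum_a \sum_b Um p b a * dx j (fun q => Vm q a b) p.

Lemma smooth_trace_dV j : smooth (trace_dV j).
Proof.
apply: smooth_sum => a _; apply: smooth_sum => b _.
by apply: smoothM; [exact: sU|apply: smooth_dx; exact: smooth_Vmat].
Qed.

Lemma dx_Vmat_comm l i j : dx l (fun q => Vm q i j) = dx j (fun q => Vm q l i).
Proof.
have VE a b : (fun q => Vm q a b) = dx a (dx b pot).
  by apply/funext => q; exact: Vmat_dx.
rewrite !VE (dx_comm i j spot) (dx_comm l j (sX i)).
by [].
Qed.

(** The heart of Abreu's formula: d/dx_i is U_il d/dxi_l, and symmetry of the third derivatives of v
    turns the divergence of V into the trace of U times a derivative of V. *)
Lemma div_Gmat j : (fun p => \sum_i dx i (fun q => Gmat q i j) p) =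
  (fun p => trace_dV j (Theta p)).
Proof.
apply/funext => p; rewrite /trace_dV exchange_big /=; apply: eq_bigr => i _.
rewrite (dx_Theta i (smooth_Vmat spsi i j)); apply: eq_bigr => l _.
by rewrite (dx_Vmat_comm l i j).
Qed.

Lemma div_div_Gmat p : \sum_i \sum_j dx j (dx i (fun q => Gmat q i j)) p =
  \sum_j \sum_l Um (Theta p) j l * dx l (trace_dV j) (Theta p).
Proof.
rewrite exchange_big /=; apply: eq_bigr => j _.
rewrite -(congr1 (fun f => f p) (dx_Theta j (smooth_trace_dV j))) -div_Gmat.
have sG i : true -> smooth (dx i (fun q => Gmat q i j)).
  by move=> _; apply: smooth_dx; exact: smooth_Gmat.
by rewrite (dx_sum j (index_enum _) sG).
Qed.

(** The factors 1/4 of [ddbar] cancel: the inverse gives 4, the outer derivative 1/4, and the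
    scaling inside log det only adds a constant. *)
Lemma scalar_curvatureE s xi : scalar_curvature (fun y => psi (s, y)) xi =
  - \sum_i \sum_j Um (s, xi) i j * dx i (trace_dV j) (s, xi).
Proof.
rewrite /scalar_curvature; congr (- _).
apply: eq_bigr => i _; apply: eq_bigr => j _.
have dd x : ddbar (kahler_potential (fun y => psi (s, y))) x = 4^-1 *: Vm (s, x).
  by rewrite /ddbar hessian_pot.
have u4 : (4^-1 : R) \is a GRing.unit by rewrite unitfE invr_eq0 pnatr_eq0.
have uV p := unit_Vmat spsi posV p.
have inv4 p : invmx (4^-1 *: Vm p) = 4 *: Um p.
  rewrite invmxZ ?invrK // unitmxE detZ unitrM -unitmxE uV andbT.
  by rewrite unitrX.
pose F p := ln (\det (4^-1 *: Vm p)).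
have dF : dx j F = trace_dV j.
  apply: dxE => p.
  pose dM : 'M[R]_n := \matrix_(a, b) (4^-1 * dx j (fun q => Vm q a b) p).
  have D a b : is_derive p ((0, e j) : V) (fun q => (4^-1 *: Vm q) a b) (dM a b).
    have -> : (fun q => (4^-1 *: Vm q) a b) = (fun q => 4^-1 * Vm q a b).
      by apply/funext => q; rewrite [LHS]mxE.
    have := is_derive_mul (is_derive_cst (4^-1 : R) p ((0, e j) : V))
      (is_derive_dx j p (smooth_Vmat spsi a b)).
    by rewrite mul0r addr0 [dM _ _]mxE.
  have d0 : 0 < \det (4^-1 *: Vm p).
    rewrite detZ mulr_gt0 ?exprn_gt0 ?invr_gt0 //.
    exact: posdef_det_gt0 (Vmat_sym spsi p) (posV p).
  have := derive_ln_det D d0.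
  suff -> : \sum_i0 \sum_j0 invmx (4^-1 *: Vm p) j0 i0 * dM i0 j0 = trace_dV j p by [].
  apply: eq_bigr => a _; apply: eq_bigr => b _.
  have e1 : (4 *: Um p) b a = 4 * Um p b a by rewrite [LHS]mxE.
  have e2 : dM a b = 4^-1 * dx j (fun q => Vm q a b) p by rewrite [LHS]mxE.
  by rewrite inv4 e1 e2; field.
rewrite dd inv4.
have -> : (fun y => ln (\det (ddbar (kahler_potential (fun y => psi (s, y))) y))) =
  (fun y => F (s, y)) by apply/funext => y; rewrite dd.
have e1 : (4 *: Um (s, xi)) i j = 4 * Um (s, xi) i j by rewrite [LHS]mxE.
have e2 : ddbar (fun y => F (s, y)) xi i j = 4^-1 * dx i (trace_dV j) (s, xi).
  rewrite /ddbar [LHS]mxE [hessian _ _ _ _]mxE partial_sliceE dF.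
  by rewrite partial_slice.
by rewrite e1 e2; field.
Qed.

End SymplecticCoordinates.

(** * Curvature and uniform pinching *)

Section Riccati.
Context {R : realType}.
Variables (f df ddf U dU : R -> R) (K : R).
Hypothesis f_deriv : forall s : R, is_derive s (1 : R) f (df s).
Hypothesis df_deriv : forall s : R, is_derive s (1 : R) df (ddf s).
Hypothesis U_deriv : forall s : R, is_derive s (1 : R) U (dU s).
Hypothesis f_gt0 : forall s, 0 < f s.
Hypothesis dU_ge0 : forall s, 0 <= dU s.
Hypothesis f_periodic : forall (m : int) s, f (s + m%:~R) = f s.
Hypothesis U_periodic : forall (m : int) s, U (s + m%:~R) = U s + m%:~R.
Hypothesis K_ge0 : 0 <= K.
Hypothesis ddf_le : forall s, `|ddf s| <= K * f s * dU s.

Lemma antitone_le (g dg : R -> R) (a b : R) :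
  (forall s : R, is_derive s (1 : R) g (dg s)) -> (forall s, dg s <= 0) ->
  a <= b -> g b <= g a.
Proof.
move=> hg dg0 ab; have [c _ E] := MVT_any a b hg.
by rewrite -subr_le0 E mulr_le0_ge0 // subr_ge0.
Qed.

Lemma f_continuous : continuous f.
Proof. by move=> s; apply/differentiable_continuous/derivable1_diffP; have [] := f_deriv s. Qed.

Lemma U_mono a b : a <= b -> U a <= U b.
Proof.
move=> ab; rewrite -lerN2.
have h1 (s : R) : is_derive s (1 : R) (fun s => - U s) (- dU s).
  exact: (is_deriveN (U_deriv s)).
by apply: (antitone_le h1 _ ab) => s; rewrite oppr_le0.
Qed.

Lemma crit_min a : (forall t, f a <= f t) -> df a = 0.
Proof.
move=> H; apply: (@min_derive0 R (fun h => f (a + h))).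
  have /is_deriveP D := f_deriv a; apply/is_deriveP => e /D[d d0 hd].
  exists d => // h h0 hh; rewrite /= add0r addr0; exact: hd.
by move=> t; rewrite addr0.
Qed.

Lemma crit_max a : (forall t, f t <= f a) -> df a = 0.
Proof.
move=> H; apply/eqP; rewrite -oppr_eq0; apply/eqP.
apply: (@min_derive0 R (fun h => - f (a + h))).
  have /is_deriveP D := is_deriveN (f_deriv a); apply/is_deriveP => e /D[d d0 hd].
  exists d => // h h0 hh; rewrite /= add0r addr0; exact: hd.
by move=> t; rewrite addr0 lerN2.
Qed.

(** The position in a prescribed unit interval matters: across such an interval [U] grows by at most
    1. *)
Lemma min_point a : exists2 s, a - 1 <= s <= a & forall t, f s <= f t.
Proof.
have ab : a - 1 <= a by lra.
have [s hs smin] := EVT_min ab (continuous_subspaceT f_continuous).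
exists s; first by move: hs; rewrite in_itv.
move=> t; have /andP[h1 h2] := floor_itv (t - (a - 1)).
rewrite -(f_periodic (- Num.floor (t - (a - 1))) t); apply: smin.
by rewrite in_itv /= rmorphN /=; move: h1 h2; rewrite intrD; lra.
Qed.

Lemma max_point a : exists2 s, a - 1 <= s <= a & forall t, f t <= f s.
Proof.
have ab : a - 1 <= a by lra.
have [s hs smax] := EVT_max ab (continuous_subspaceT f_continuous).
exists s; first by move: hs; rewrite in_itv.
move=> t; have /andP[h1 h2] := floor_itv (t - (a - 1)).
rewrite -(f_periodic (- Num.floor (t - (a - 1))) t); apply: smax.
by rewrite in_itv /= rmorphN /=; move: h1 h2; rewrite intrD; lra.
Qed.

(* With y = f'/f one has y' + y^2 = f''/f <= K U', so that
   2 k ln f + y - K U - k^2 s is nonincreasing; between a minimum and a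
   maximum of f the terms y vanish. *)
Lemma riccati_harnack k s t : 1 <= k -> K <= k -> f t <= expR k * f s.
Proof.
move=> k1 Kk.
have [s1 _ smax] := max_point 0.
have [s0 /andP[s01 s10] smin] := min_point s1.
have d1 := crit_max smax; have d0 := crit_min smin.
pose P s := 2 * k * ln (f s) + df s / f s - K * U s - k ^+ 2 * s.
pose dP s := 2 * k * ((f s)^-1 * df s) +
  (df s * (- (f s)^-1 * (f s)^-1 * df s) + ddf s * (f s)^-1) - K * dU s - k ^+ 2.
have hP r : is_derive r (1 : R) P (dP r).
  have f0 : f r != 0 by rewrite gt_eqF.
  have D1 := is_derive_mul (is_derive_cst (2 * k) r (1 : R))
    (is_derive_comp1 (f_deriv r) (is_derive1_ln (f_gt0 r))).
  have D2 := is_derive_mul (df_deriv r) (is_derive_inv f0 (f_deriv r)).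
  have D3 := is_derive_mul (is_derive_cst K r (1 : R)) (U_deriv r).
  have D4 := is_derive_mul (is_derive_cst (k ^+ 2) r (1 : R)) (is_derive_id r (1 : R)).
  rewrite !mul0r !addr0 ?mulr1 in D1 D3 D4.
  exact: (is_derive_add (is_derive_add (is_derive_add D1 D2) (is_deriveN D3)) (is_deriveN D4)).
have dP0 r : dP r <= 0.
  have f0 := f_gt0 r; have fn : f r != 0 by rewrite gt_eqF.
  pose y := df r / f r.
  have -> : dP r = - (y - k) ^+ 2 + (ddf r / f r - K * dU r).
    by rewrite /dP /y; field.
  have : ddf r / f r <= K * dU r.
    rewrite ler_pdivrMr //; apply: (le_trans (ler_norm _)); rewrite mulrAC; exact: ddf_le.
  by have := sqr_ge0 (y - k); lra.
have := antitone_le hP dP0 s10; rewrite /P d0 d1 !mul0r !addr0.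
have hU : U s1 - U s0 <= 1.
  have := U_mono s01; have := U_periodic (-1) s1; rewrite rmorphN /= => ->; lra.
have hU0 : 0 <= U s1 - U s0 by rewrite subr_ge0 U_mono.
(* Here 2 k (ln f s1 - ln f s0) <= K (U s1 - U s0) + k^2 (s1 - s0) <= k + k^2 <= 2 k^2, whence the
   ratio exp k. *)
move=> hPP.
have h1 : K * (U s1 - U s0) <= k * 1 by rewrite ler_pM.
have h2 : k ^+ 2 * (s1 - s0) <= k ^+ 2.
  by rewrite ler_piMr ?sqr_ge0 //; lra.
have h3 : k <= k ^+ 2 by rewrite expr2 ler_peMr //; lra.
have k0 : 0 < k by lra.
have h4 : 2 * k * (ln (f s1) - ln (f s0)) <= 2 * k * k by rewrite expr2 in h2 h3 hPP; nra.
rewrite ler_pM2l ?mulr_gt0 // in h4.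
apply: (le_trans (smax t)); apply: (@le_trans _ _ (expR k * f s0)); last first.
  by rewrite ler_pM2l ?expR_gt0.
by rewrite -[f s1]lnK ?posrE // -[f s0]lnK ?posrE // -expRD ler_expR; lra.
Qed.

(** f' vanishes at a minimum within distance 1 to the left of s, and |f''| <= K M U' integrates to
    at most K M from there. *)
Lemma riccati_derivative M s : (forall t, f t <= M) -> `|df s| <= K * M.
Proof.
move=> fM; have [s0 /andP[h0 h1] /crit_min d0] := min_point s.
have M0 : 0 <= K * M by rewrite mulr_ge0 // (le_trans _ (fM 0)) // ltW.
have hU : U s - U s0 <= 1.
  have := U_mono h0; have := U_periodic (-1) s; rewrite rmorphN /= => ->; lra.
have hUM : K * M * (U s - U s0) <= K * M by rewrite ler_piMr.
have ddM r : `|ddf r| <= K * M * dU r.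
  by rewrite (le_trans (ddf_le r)) // ler_wpM2r // ler_wpM2l.
have D c r : is_derive r (1 : R) (fun r => c * df r - K * M * U r) (c * ddf r - K * M * dU r).
  have D1 := is_derive_mul (is_derive_cst c r (1 : R)) (df_deriv r).
  have D2 := is_derive_mul (is_derive_cst (K * M) r (1 : R)) (U_deriv r).
  by rewrite !mul0r !addr0 in D1 D2; exact: (is_derive_add D1 (is_deriveN D2)).
have := antitone_le (D 1) _ h1; have := antitone_le (D (-1)) _ h1.
rewrite d0 ler_norml => h2 h3.
have : forall r, -1 * ddf r - K * M * dU r <= 0.
  by move=> r; have := ddM r; rewrite ler_norml; lra.
move=> /h2 {h2} h2.
have : forall r, 1 * ddf r - K * M * dU r <= 0.
  by move=> r; have := ddM r; rewrite ler_norml; lra.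
move=> /h3 {h3} h3.
by rewrite mulrBr in hUM; lra.
Qed.

End Riccati.

Section BoundedConvex.
Context {R : realType}.

(** If g'' > 0 everywhere then g' is strictly increasing, so g' 1 > 0 or g' 0 < 0, and g grows at
    least linearly to the right or to the left. *)
Lemma bounded_not_convex (g dg ddg : R -> R) C :
  (forall s : R, is_derive s (1 : R) g (dg s)) ->
  (forall s : R, is_derive s (1 : R) dg (ddg s)) ->
  (forall s, `|g s| <= C) -> exists s, ddg s <= 0.
Proof.
move=> hg hdg gC; apply: contrapT => H.
have pos s : 0 < ddg s by rewrite ltNge; apply/negP => h; apply: H; exists s.
have mono a b : a < b -> dg a < dg b.
  move=> ab; have [c _ E] := MVT_any a b hdg.
  by rewrite -subr_gt0 E mulr_gt0 // subr_gt0.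
have C0 : 0 <= C by apply: le_trans (gC 0).
have d01 : dg 0 < dg 1 by apply: mono.
have [h|h] := ltP 0 (dg 1).
  (* Over this length the increase is at least 2 C + 1, more than the oscillation of g allows. *)
  pose T := (2 * C + 1) / dg 1.
  have T0 : 0 < T by rewrite divr_gt0 //; lra.
  have [c hc E] := MVT_any 1 (1 + T) hg.
  have : dg 1 <= dg c.
    move: hc; rewrite min_l; last by lra.
    by rewrite le_eqVlt => /andP[/orP[/eqP <-//|/mono/ltW]].
  move: E; rewrite addrAC subrr add0r => E h1.
  have h2 : dg 1 * T = 2 * C + 1 by rewrite /T mulrC divfK // gt_eqF.
  have h3 : dg 1 * T <= dg c * T by rewrite ler_wpM2r // ltW.
  by have := gC 1; have := gC (1 + T); rewrite !ler_norml; lra.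
have h' : dg 0 < 0 by apply: lt_le_trans h.
pose T := (2 * C + 1) / (- dg 0).
have n0 : 0 < - dg 0 by rewrite oppr_gt0.
have T0 : 0 < T by rewrite divr_gt0 //; lra.
have [c hc E] := MVT_any (- T) 0 hg.
have : dg c <= dg 0.
  move: hc; rewrite max_r; last by lra.
  by rewrite (le_eqVlt c) => /andP[_ /orP[/eqP <-//|/mono/ltW]].
move: E; rewrite sub0r opprK => E h1.
have h2 : - dg 0 * T = 2 * C + 1 by rewrite /T mulrC divfK // gt_eqF.
have h3 : dg c * T <= dg 0 * T by rewrite ler_wpM2r // ltW.
by have := gC 0; have := gC (- T); rewrite !ler_norml; lra.
Qed.

End BoundedConvex.

Lemma mulmx3E (R : comNzRingType) (m n p q : nat) (A : 'M[R]_(m, n)) (B : 'M[R]_(n, p))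
    (C : 'M[R]_(p, q)) i j :
  (A *m B *m C) i j = \sum_a \sum_b A i a * B a b * C b j.
Proof.
rewrite mxE exchange_big /=; apply: eq_bigr => b _.
by rewrite mxE mulr_suml.
Qed.

(** * Symmetries of the curvature tensor and the pointwise second-derivative bound *)

Section CurvatureBounds.
Context {R : realType} {n : nat}.
Notation S := 'rV[R]_n.
Notation V := (R * 'rV[R]_n)%type.
Notation e i := (delta_mx 0 i : S).
Variable psi : V -> R.
Hypothesis spsi : smooth psi.
Hypothesis ppsi : periodicx psi.
Hypothesis posV : forall p, posdef (Vmat psi p).
Local Notation Th := (Theta psi).
Local Notation G := (Gmat psi).
Local Notation Xi := (Xi psi).

Definition Wmat (p : V) : 'M[R]_n := Umat psi (Th p).
Local Notation W := Wmat.

Lemma W_dx_dx i j : (fun p => W p i j) = dx i (dx j (sym_pot psi)).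
Proof. by rewrite (dx_dx_sym_pot spsi ppsi posV). Qed.

Let su := smooth_sym_pot spsi ppsi posV.

Lemma smooth_Wmat i j : smooth (fun p => W p i j).
Proof. by rewrite W_dx_dx; apply: smooth_dx; exact: smooth_dx. Qed.

Lemma G_sym p : (G p)^T = G p.
Proof. exact: (Vmat_sym spsi). Qed.

Lemma G_symE p i j : G p i j = G p j i.
Proof. by rewrite -{1}G_sym mxE. Qed.

Lemma W_symE p i j : W p i j = W p j i.
Proof. exact: (Umat_symE spsi). Qed.

Lemma G_inv p : G p = invmx (W p).
Proof. by rewrite /Wmat inv_Um. Qed.

Lemma W_inv p : W p = invmx (G p).
Proof. by []. Qed.

Lemma W_unit p : W p \in unitmx.
Proof. by rewrite unitmx_inv; exact: (unit_Vmat spsi posV). Qed.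

Fact mx_seal (I : Type) (f : I -> V -> 'I_n -> 'I_n -> R) :
  {M : I -> V -> 'M[R]_n | forall k p i j, M k p i j = f k p i j}.
Proof. by exists (fun k p => \matrix_(i, j) f k p i j) => k p i j; rewrite mxE. Qed.

Definition W3 : 'I_n -> V -> 'M[R]_n :=
  sval (mx_seal (fun k p i j => dx k (fun q => W q i j) p)).
Definition W4 (k l : 'I_n) : V -> 'M[R]_n :=
  sval (mx_seal (fun kl p i j => dx kl.1 (dx kl.2 (fun q => W q i j)) p)) (k, l).
Definition G3 : 'I_n -> V -> 'M[R]_n :=
  sval (mx_seal (fun k p i j => dx k (fun q => G q i j) p)).

Lemma W3E k p i j : W3 k p i j = dx k (fun q => W q i j) p.
Proof. exact: (svalP (mx_seal (fun k p i j => dx k (fun q => W q i j) p))). Qed.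

Lemma W4E k l p i j : W4 k l p i j = dx k (dx l (fun q => W q i j)) p.
Proof.
exact: (svalP (mx_seal (fun kl p i j => dx kl.1 (dx kl.2 (fun q => W q i j)) p)) (k, l)).
Qed.

Lemma G3_E k p i j : G3 k p i j = dx k (fun q => G q i j) p.
Proof. exact: (svalP (mx_seal (fun k p i j => dx k (fun q => G q i j) p))). Qed.

Lemma dx_G k i j p : dx k (fun q => G q i j) p = - (G p *m W3 k p *m G p) i j.
Proof.
have -> : (fun q => G q i j) = (fun q => invmx (W q) i j).
  by apply/funext => q; rewrite G_inv.
rewrite /dx (derive_invmx smooth_Wmat W_unit) -/(dx k _ p) -G_inv; congr (- _).
by rewrite mulmx3E; apply: eq_bigr => a _; apply: eq_bigr => b _; rewrite W3E.
Qed.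

Lemma G3E k p : G3 k p = - (G p *m W3 k p *m G p).
Proof. by apply/matrixP => i j; rewrite G3_E dx_G [RHS]mxE. Qed.

(* The curvature tensor with its first pair of indices lowered. *)
Definition Riem (k l : 'I_n) (p : V) : 'M[R]_n :=
  W3 k p *m G p *m W3 l p + W3 l p *m G p *m W3 k p - W4 k l p.

Lemma dx_dx_G k l i j p : dx k (dx l (fun q => G q i j)) p = (G p *m Riem k l p *m G p) i j.
Proof.
have sG := smooth_Gmat spsi ppsi posV.
have -> : dx l (fun q => G q i j) =
  (fun q => \sum_a \sum_b (- 1 * G q i a) * (dx l (fun r => W r a b) q * G q b j)).
  apply/funext => q; rewrite dx_G mxE -sumrN exchange_big /=; apply: eq_bigr => b _.
  rewrite [(_ *m _) i b]mxE mulr_suml -sumrN; apply: eq_bigr => a _.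
  by rewrite W3E; ring.
have sW3 a b : smooth (dx l (fun r => W r a b)).
  by apply: smooth_dx; exact: smooth_Wmat.
have D : is_derive p ((0, e k) : V)
  (fun q => \sum_a \sum_b (- 1 * G q i a) * (dx l (fun r => W r a b) q * G q b j))
  (\sum_a \sum_b ((- 1 * G p i a) * (W3 l p a b * G3 k p b j + W4 k l p a b * G p b j) +
                  (- 1 * G3 k p i a + 0 * G p i a) * (W3 l p a b * G p b j))).
  apply: is_derive_bigsum => a _; apply: is_derive_bigsum => b _.
  have D1 := is_derive_dx k p (sG i a); have D2 := is_derive_dx k p (sG b j).
  have D3 := is_derive_dx k p (sW3 a b).
  have := is_derive_mul (is_derive_mul (is_derive_cst (- 1 : R) p ((0, e k) : V)) D1)
    (is_derive_mul D3 D2).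
  by rewrite W3E W4E !G3_E.
have [_] := D; rewrite -/(dx k _ p) => ->.
have -> : G p *m Riem k l p *m G p =
  - (G p *m W3 l p *m G3 k p + G p *m W4 k l p *m G p + G3 k p *m W3 l p *m G p).
  rewrite /Riem !G3E; move: (G p) (W3 k p) (W3 l p) (W4 k l p) => g a b c.
  rewrite mulmxBr mulmxDr mulmxBl mulmxDl !mulmxN !mulNmx !mulmxA.
  by rewrite !opprD !opprK -addrA addrC.
rewrite [RHS]mxE [(_ + _ *m _ *m _) i j]mxE [(_ + _ *m _ *m _) i j]mxE !mulmx3E.
rewrite -!big_split /= -sumrN; apply: eq_bigr => a _.
rewrite -!big_split /= -sumrN; apply: eq_bigr => b _.
by ring.
Qed.

Lemma W3_perm k i j p : W3 k p i j = W3 i p k j.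
Proof.
rewrite !W3E (W_dx_dx i j) (W_dx_dx k j).
exact: (congr1 (fun f => f p) (dx_comm k i (smooth_dx j su))).
Qed.

Lemma W3_sym k i j p : W3 k p i j = W3 k p j i.
Proof.
rewrite !W3E; congr (dx k _ p).
by apply/funext => q; exact: W_symE.
Qed.

Lemma W4_swap k l i j p : W4 k l p i j = W4 i j p k l.
Proof.
rewrite W4E (W4E i) (W_dx_dx i j) (W_dx_dx k l); set u := sym_pot psi.
have sj := smooth_dx j su; have sl := smooth_dx l su.
rewrite -[dx l (dx i _)](dx_comm i l sj) -[dx l (dx j u)](dx_comm j l su).
have -> := dx_comm k i (smooth_dx j sl).
exact: (congr1 (fun f => dx i f p) (dx_comm k j sl)).
Qed.

(** The derivatives of u are totally symmetric. Under the exchange of pairs the fourth-order term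
    and the first product are fixed termwise, the second after exchanging its summation indices. *)
Lemma Riem_swap k l i j p : Riem k l p i j = Riem i j p k l.
Proof.
have BE (A B C : 'M[R]_n) a b : (A + B - C) a b = A a b + B a b - C a b.
  by rewrite mxE [(A + B) a b]mxE [(- C) a b]mxE.
rewrite /Riem !BE (W4_swap k l i j) !mulmx3E.
congr (_ + _ - _).
  apply: eq_bigr => c _; apply: eq_bigr => d _.
  by rewrite (W3_perm k i c) (W3_sym l d j) (W3_perm l j d) (W3_sym j l d).
rewrite exchange_big /=; apply: eq_bigr => c _; apply: eq_bigr => d _.
rewrite (G_symE p d c) (W3_perm l i d) (W3_sym k c j) (W3_perm k j c) (W3_sym j k c).
by rewrite (W3_sym i l d); ring.
Qed.

Variable K : R.
Hypothesis K0 : 0 <= K.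
Hypothesis Rm_le : forall s x, Rm_norm (fun y => psi (s, y)) x <= K.

Lemma Rm_sq_le s x : Rm_sq_symplectic (fun y => sym_pot psi (s, y)) x <= K ^+ 2.
Proof.
have [xi <-] := grad_onto spsi ppsi s x.
have := Rm_le s xi; rewrite /Rm_norm.
rewrite legendre_kpot.
set r := Rm_sq_symplectic _ _ => h.
(* A negative [r] would be hidden by the square root, but it lies below [K ^+ 2] anyway. *)
have [r0|r0] := leP 0 r; last by rewrite (le_trans (ltW r0)) // sqr_ge0.
by rewrite -(sqr_sqrtr r0) ler_sqr ?nnegrE ?sqrtr_ge0.
Qed.

Lemma Rm_sqE s x : Rm_sq_symplectic (fun y => sym_pot psi (s, y)) x =
  \sum_i \sum_j \sum_k \sum_l dx k (dx l (fun q => G q i j)) (s, x) *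
                              dx i (dx j (fun q => G q k l)) (s, x).
Proof.
apply: eq_bigr => i _; apply: eq_bigr => j _; apply: eq_bigr => k _.
apply: eq_bigr => l _.
have E a b c d : partial c (partial d (inv_hessian (fun y => sym_pot psi (s, y)) a b)) x =
   dx c (dx d (fun q => G q a b)) (s, x).
  rewrite (inv_hessian_sym_pot spsi ppsi posV).
  by rewrite (partial_sliceE d (fun q => G q a b)) partial_slice.
by rewrite !E.
Qed.

Lemma posG p : posdef (G p).
Proof. exact: posV. Qed.

(** The second derivative is the curvature form evaluated on the pairs w G tensor w G and e_b tensor
    e_b. [pair_curvature_bound] applies with the Cholesky factor of G acting on each index of a
    pair. *)
Lemma quad_curvature p (w : S) b :
  `|\sum_i \sum_j w 0 i * dx b (dx b (fun q => G q i j)) p * w 0 j| <=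
  K * quad (G p) w * W p b b.
Proof.
have [L EL uL] := cholesky (G_sym p) (@posG p).
have uLT : L^T \in unitmx by rewrite unitmx_tr.
(* The frame components: |y|^2 = G(w, w) and |z|^2 = W_bb, so their tensor squares [Y] and [Z] have
   these as Euclidean norms. *)
pose y := w *m L; pose z := e b *m (invmx L)^T.
pose Lp (q r : 'I_n * 'I_n) := L q.1 r.1 * L q.2 r.2.
pose T (q r : 'I_n * 'I_n) := Riem r.1 r.2 p q.1 q.2.
pose F (q r : 'I_n * 'I_n) := dx r.1 (dx r.2 (fun o => G o q.1 q.2)) p.
pose Y (q : 'I_n * 'I_n) := y 0 q.1 * y 0 q.2.
pose Z (q : 'I_n * 'I_n) := z 0 q.1 * z 0 q.2.
have GE i a : G p i a = \sum_m L i m * L a m by rewrite {1}EL mulmx_trE.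
have symT q r : T q r = T r q by exact: Riem_swap.
have pairE (f g : 'I_n -> R) : \sum_q f q.1 * g q.2 = (\sum_i f i) * (\sum_i g i).
  rewrite big_distrlr /= (pair_big xpredT xpredT (fun i j => f i * g j)) /=.
  by apply: eq_bigr.
have LLE q r : \sum_m Lp q m * Lp r m = G p q.1 r.1 * G p q.2 r.2.
  rewrite !GE -pairE; apply: eq_bigr => m _; rewrite /Lp; ring.
have FE q r : F q r = \sum_o (\sum_m Lp q m * Lp o m) * T o r.
  rewrite /F dx_dx_G mulmx3E (pair_big xpredT xpredT) /=; apply: eq_bigr => -[a c] _ /=.
  by rewrite LLE /T /= (G_symE p c); ring.
have LY q : \sum_m Lp q m * Y m = (w *m G p) 0 q.1 * (w *m G p) 0 q.2.
  have E a : (w *m G p) 0 a = \sum_m L a m * y 0 m.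
    by rewrite EL mulmxA -/y [LHS]mxE; apply: eq_bigr => m _; rewrite [_^T _ _]mxE mulrC.
  by rewrite !E -pairE; apply: eq_bigr => m _; rewrite /Lp /Y; ring.
have LZ q : \sum_m Lp q m * Z m = (e b) 0 q.1 * (e b) 0 q.2.
  have E a : (e b) 0 a = \sum_m L a m * z 0 m.
    have {1}-> : e b = z *m L^T by rewrite /z -mulmxA -trmx_mul mulmxV // trmx1 mulmx1.
    by rewrite [LHS]mxE; apply: eq_bigr => m _; rewrite [_^T _ _]mxE mulrC.
  by rewrite !E -pairE; apply: eq_bigr => m _; rewrite /Lp /Z; ring.
have Y2 : \sum_m Y m ^+ 2 = quad (G p) w ^+ 2.
  have -> : quad (G p) w = \sum_m y 0 m ^+ 2.
    rewrite /quad EL mulmxA -/y -mulmxA -trmx_mul -/y [LHS]mxE.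
    by apply: eq_bigr => m _; rewrite [_^T _ _]mxE expr2.
  by rewrite expr2 -pairE; apply: eq_bigr => m _; rewrite /Y exprMn.
have Z2 : \sum_m Z m ^+ 2 = W p b b ^+ 2.
  have -> : W p b b = \sum_m z 0 m ^+ 2.
    have -> : W p b b = (e b *m W p *m (e b)^T) 0 0.
      by rewrite trmx_delta -rowE -colE !mxE.
    rewrite W_inv EL invmx_cholesky // mulmxA -/z -mulmxA.
    have -> : invmx L *m (e b)^T = z^T by rewrite /z trmx_mul trmxK.
    by rewrite [LHS]mxE; apply: eq_bigr => m _; rewrite [_^T _ _]mxE expr2.
  by rewrite expr2 -pairE; apply: eq_bigr => m _; rewrite /Z exprMn.
have := @pair_curvature_bound R _ Lp T F Y Z symT FE.
rewrite Y2 Z2.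
have -> : \sum_q \sum_r F q r * F r q = Rm_sq_symplectic (fun y => sym_pot psi (p.1, y)) p.2.
  rewrite Rm_sqE [RHS](pair_big xpredT xpredT) /=; apply: eq_bigr => -[i j] _ /=.
  rewrite [RHS](pair_big xpredT xpredT) /=; apply: eq_bigr => -[k l] _ /=.
  by rewrite /F /=; case: (p).
have -> : \sum_q \sum_r (\sum_m Lp q m * Y m) * T q r * (\sum_m Lp r m * Z m) =
  \sum_i \sum_j w 0 i * dx b (dx b (fun q => G q i j)) p * w 0 j.
  transitivity (\sum_q ((w *m G p) 0 q.1 * (w *m G p) 0 q.2) * T q (b, b)).
    apply: eq_bigr => q _; rewrite LY; under eq_bigr do rewrite LZ.
    rewrite (bigD1 (b, b)) // big1 ?Monoid.mulm1.
      by rewrite ![delta_mx _ _ _ _]mxE !eqxx !mulr1.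
    move=> [k l] /= kl; rewrite ![delta_mx _ _ _ _]mxE eqxx /=.
    have : ~~ ((k == b) && (l == b)) by apply: contra kl => /andP[/eqP-> /eqP->].
    by rewrite negb_and => /orP[/negPf ->|/negPf ->]; rewrite ?mul0r ?mulr0.
  under [RHS]eq_bigr do under eq_bigr do rewrite dx_dx_G.
  rewrite -(quadE (G p *m Riem b b p *m G p)) /quad.
  have -> : w *m (G p *m Riem b b p *m G p) *m w^T =
     (w *m G p) *m Riem b b p *m (w *m G p)^T.
    by rewrite trmx_mul G_sym !mulmxA.
  rewrite -/(quad _ _) quadE [RHS](pair_big xpredT xpredT) /=; apply: eq_bigr => -[i j] _ /=.
  by rewrite /T /=; ring.
set D := \sum_i _ => h.
have Wb : 0 <= W p b b.
  have -> : W p b b = \sum_m z 0 m ^+ 2.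
    have -> : W p b b = (e b *m W p *m (e b)^T) 0 0.
      by rewrite trmx_delta -rowE -colE !mxE.
    rewrite W_inv EL invmx_cholesky // mulmxA -/z -mulmxA.
    have -> : invmx L *m (e b)^T = z^T by rewrite /z trmx_mul trmxK.
    by rewrite [LHS]mxE; apply: eq_bigr => m _; rewrite [_^T _ _]mxE expr2.
  by apply: sumr_ge0 => m _; exact: sqr_ge0.
have q0 : 0 <= quad (G p) w.
  have -> : quad (G p) w = \sum_m y 0 m ^+ 2.
    rewrite /quad EL mulmxA -/y -mulmxA -trmx_mul -/y [LHS]mxE.
    by apply: eq_bigr => m _; rewrite [_^T _ _]mxE expr2.
  by apply: sumr_ge0 => m _; exact: sqr_ge0.
rewrite -(@ler_pXn2r _ 2) ?nnegrE ?mulr_ge0 // real_normK ?num_real //.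
apply: (le_trans h); rewrite !exprMn -mulrA ler_wpM2r ?mulr_ge0 ?sqr_ge0 //.
exact: Rm_sq_le.
Qed.

Lemma W_diag_ge0 p b : 0 <= W p b b.
Proof.
have [L EL uL] := cholesky (G_sym p) (@posG p).
have -> : W p b b = dot (e b *m (invmx L)^T) (e b *m (invmx L)^T).
  have -> : W p b b = (e b *m W p *m (e b)^T) 0 0.
    by rewrite trmx_delta -rowE -colE !mxE.
  by rewrite dotE W_inv EL invmx_cholesky // trmx_mul trmxK !mulmxA.
exact: dot_ge0.
Qed.

End CurvatureBounds.

(** * From quadratic forms to matrix entries *)

Section QuadraticForms.
Context {R : realType} {n : nat}.
Notation S := 'rV[R]_n.
Notation V := (R * 'rV[R]_n)%type.
Notation e i := (delta_mx 0 i : S).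

Lemma quad_deltaD (A : 'M[R]_n) (i j : 'I_n) :
  quad A (e i + e j) = A i i + A i j + (A j i + A j j).
Proof.
have E k l : (e k *m A *m (e l)^T) 0 0 = A k l.
  by rewrite trmx_delta -rowE -colE !mxE.
rewrite /quad mulmxDl mulmxDl linearD /= !mulmxDr.
have ME (a b c d : 'M[R]_1) : (a + b + (c + d)) 0 0 = a 0 0 + b 0 0 + (c 0 0 + d 0 0).
  by rewrite mxE [(a + b) 0 0]mxE [(c + d) 0 0]mxE.
by rewrite ME !E; ring.
Qed.

Lemma ler_sum_cst (F : 'I_n -> R) (c : R) : (forall i, F i <= c) -> \sum_i F i <= n%:R * c.
Proof.
move=> H; apply: (@le_trans _ _ (\sum_(i < n) c)); first by apply: ler_sum.
by rewrite sumr_const card_ord mulr_natl.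
Qed.

Lemma quad0 (A : 'M[R]_n) : quad A 0 = 0.
Proof. by rewrite /quad !mul0mx mxE. Qed.

Lemma dot_deltaD_le (i j : 'I_n) : dot (e i + e j) (e i + e j) <= 4.
Proof.
have -> : dot (e i + e j) (e i + e j) = quad 1%:M (e i + e j) by rewrite dotE /quad mulmx1.
rewrite quad_deltaD !mxE !eqxx.
by case: (i == j); case: (j == i) => /=; lra.
Qed.

(** Polarisation: twice A_ij is the value at e_i + e_j, at most 4 c since |e_i + e_j|^2 <= 4 even if
    i = j, minus two diagonal entries of size at most c. *)
Lemma entry_le_quad (A : 'M[R]_n) c : A^T = A -> 0 <= c ->
  (forall w, `|quad A w| <= c * dot w w) -> forall i j, `|A i j| <= 3 * c.
Proof.
move=> sA c0 H.
have D i : `|A i i| <= c.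
  have := H (e i); rewrite quadE /dot.
  rewrite (bigD1 i) //= (bigD1 i) //= [X in _ + X + _]big1; last first.
    by move=> j /negPf ji; rewrite [X in _ * X]mxE eqxx ji mulr0.
  rewrite [X in _ + _ + X]big1; last first.
    move=> j /negPf ji; rewrite big1 // => k _.
    by rewrite [X in X * _ * _]mxE eqxx ji !mul0r.
  rewrite (bigD1 i) //= [X in _ * (_ + X)]big1; last first.
    by move=> j /negPf ji; rewrite mxE eqxx ji mul0r.
  by rewrite !mxE !eqxx !addr0 !mulr1 mul1r.
move=> i j; have := H (e i + e j); rewrite quad_deltaD.
have -> : A j i = A i j by rewrite -{1}sA mxE.
have h4 : c * dot (e i + e j) (e i + e j) <= c * 4 by rewrite ler_wpM2l // dot_deltaD_le.
move/(le_trans)/(_ h4); have := D i; have := D j.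
by rewrite !ler_norml => /andP[? ?] /andP[? ?] /andP[? ?]; apply/andP; split; lra.
Qed.

(** For y = w A^-1 one has A(y, y) = y . w = A^-1(w, w), and Cauchy-Schwarz for y . w closes the
    estimate. *)
Lemma quad_invmx_le (A : 'M[R]_n) c : A^T = A -> A \in unitmx -> 0 <= c ->
  (forall w, dot w w <= c * quad A w) -> (forall w, 0 <= quad A w) ->
  forall w, 0 <= quad (invmx A) w <= c * dot w w.
Proof.
move=> sA uA c0 H A0 w; pose y := w *m invmx A.
have q1 : quad A y = quad (invmx A) w.
  rewrite /quad /y trmx_mul trmx_inv sA -!mulmxA (mulmxA A) mulmxV // mul1mx.
  by rewrite !mulmxA.
have q2 : dot y w = quad (invmx A) w by rewrite dotE.
have q0 : 0 <= quad (invmx A) w by rewrite -q1.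
rewrite q0 /=; have := dot_cauchy_schwarz y w; rewrite q2 => h.
have h2 := H y; rewrite q1 in h2.
have [z|z] := leP (quad (invmx A) w) 0.
  by rewrite (le_trans z) // mulr_ge0 // dot_ge0.
rewrite -(ler_pM2r z) -expr2 (le_trans h) //.
by rewrite mulrAC ler_wpM2r ?dot_ge0.
Qed.

Lemma smooth_bilin (F : 'I_n -> 'I_n -> V -> R) (w : S) : (forall i j, smooth (F i j)) ->
  smooth (fun p => \sum_i \sum_j w 0 i * F i j p * w 0 j).
Proof.
move=> sF; apply: smooth_sum => i _; apply: smooth_sum => j _.
by apply: smoothM; [apply: smoothM; [exact: smooth_cst|exact: sF]|exact: smooth_cst].
Qed.

Lemma dx_bilin b (F : 'I_n -> 'I_n -> V -> R) (w : S) : (forall i j, smooth (F i j)) ->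
  dx b (fun p => \sum_i \sum_j w 0 i * F i j p * w 0 j) =
  (fun p => \sum_i \sum_j w 0 i * dx b (F i j) p * w 0 j).
Proof.
move=> sF; apply: dxE => p.
apply: is_derive_bigsum => i _; apply: is_derive_bigsum => j _.
have := is_derive_mul (is_derive_mul (is_derive_cst (w 0 i) p ((0, e b) : V))
  (is_derive_dx b p (sF i j))) (is_derive_cst (w 0 j) p ((0, e b) : V)).
by rewrite mulr0 mul0r addr0 add0r.
Qed.

End QuadraticForms.

(** * Harnack inequality and uniform pinching of G *)

Section UniformBounds.
Context {R : realType} {n : nat}.
Notation S := 'rV[R]_n.
Notation V := (R * 'rV[R]_n)%type.
Notation e i := (delta_mx 0 i : S).
Variable psi : V -> R.
Hypothesis spsi : smooth psi.
Hypothesis ppsi : periodicx psi.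
Hypothesis posV : forall p, posdef (Vmat psi p).
Variable K : R.
Hypothesis K0 : 0 <= K.
Hypothesis Rm_le : forall s x, Rm_norm (fun y => psi (s, y)) x <= K.
Local Notation G := (Gmat psi).
Local Notation W := (Wmat psi).
Local Notation k := (Num.max 1 K).

Let sG := smooth_Gmat spsi ppsi posV.

Lemma quadG_gt0 p (w : S) : w != 0 -> 0 < quad (G p) w.
Proof. exact: posV. Qed.

Lemma shift_int b (x : S) (t : R) (m : int) :
  x + (t + m%:~R) *: e b = x + t *: e b + map_mx intr (m *: delta_mx 0 b).
Proof.
rewrite scalerDl addrA; congr (_ + _); apply/rowP => j.
by rewrite !mxE; case: (_ && _); rewrite ?mulr1 ?mulr0.
Qed.

Lemma G_line s b (x w : S) : w != 0 ->
  (forall t r : R, quad (G (s, x + t *: e b)) w <= expR k * quad (G (s, x + r *: e b)) w) /\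
  forall M, (forall t : R, quad (G (s, x + t *: e b)) w <= M) -> forall t : R,
  `|\sum_i \sum_j w 0 i * dx b (fun q => G q i j) (s, x + t *: e b) * w 0 j| <= K * M.
Proof.
move=> w0; pose F (p : V) := \sum_i \sum_j w 0 i * G p i j * w 0 j.
have sF : smooth F := smooth_bilin w sG.
have FE p : quad (G p) w = F p by exact: quadE.
have dF : dx b F = (fun p => \sum_i \sum_j w 0 i * dx b (fun q => G q i j) p * w 0 j).
  exact: (dx_bilin b w sG).
have ddF : dx b (dx b F) =
    (fun p => \sum_i \sum_j w 0 i * dx b (dx b (fun q => G q i j)) p * w 0 j).
  by rewrite dF; apply: (dx_bilin b w (F := fun i j => dx b (fun q => G q i j))) => i j;
    apply: smooth_dx; exact: sG.
have dXi p : dx b (fun q => Xi psi q 0 b) p = W p b b by exact: (dx_Xi spsi ppsi posV).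
have D1 (t : R) : is_derive t (1 : R) (fun r => F (s, x + r *: e b)) (dx b F (s, x + t *: e b)).
  exact: line_dx.
have D2 (t : R) : is_derive t (1 : R) (fun r => dx b F (s, x + r *: e b))
    (dx b (dx b F) (s, x + t *: e b)).
  by apply: line_dx; exact: smooth_dx.
have D3 (t : R) : is_derive t (1 : R) (fun r => Xi psi (s, x + r *: e b) 0 b)
    (W (s, x + t *: e b) b b).
  have := line_dx b s x t (smooth_Xi spsi ppsi posV b).
  by rewrite dXi.
have F0 t : 0 < F (s, x + t *: e b) by rewrite -FE; exact: quadG_gt0.
have W0 t : 0 <= W (s, x + t *: e b) b b by exact: W_diag_ge0.
have Fp (m : int) (t : R) : F (s, x + (t + m%:~R) *: e b) = F (s, x + t *: e b).
  have GE : G (s, x + (t + m%:~R) *: e b) = G (s, x + t *: e b).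
    rewrite shift_int; apply/matrixP => i j.
    exact: (periodic_Gmat spsi ppsi posV i j s (m *: delta_mx 0 b) (x + t *: e b)).
  by rewrite -!FE GE.
have Up (m : int) (t : R) :
    Xi psi (s, x + (t + m%:~R) *: e b) 0 b = Xi psi (s, x + t *: e b) 0 b + m%:~R.
  by rewrite shift_int (Xi_shift spsi ppsi posV) mxE !mxE !eqxx mulr1.
have FK t : `|dx b (dx b F) (s, x + t *: e b)| <=
    K * F (s, x + t *: e b) * W (s, x + t *: e b) b b.
  by rewrite ddF -FE; exact: quad_curvature.
split=> [t r|M HM t].
  have k1 : 1 <= k by rewrite le_max lexx.
  have kK : K <= k by rewrite le_max lexx orbT.
  have H := riccati_harnack D1 D2 D3 F0 W0 Fp Up K0 FK r t k1 kK.
  by rewrite [X in X <= _]FE [X in _ <= _ * X]FE.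
have := riccati_derivative D1 D2 D3 F0 W0 Fp Up K0 FK (M := M) t.
rewrite dF; apply => r; rewrite -[X in X <= _]FE; exact: HM.
Qed.

(** Any two points are joined by n moves along coordinate lines, each at the cost of a factor exp
    k. *)
Lemma G_harnack s (x y w : S) :
  quad (G (s, x)) w <= expR k ^+ n * quad (G (s, y)) w.
Proof.
have [->|w0] := eqVneq w 0.
  by rewrite !quad0 mulr0.
have H (r : seq 'I_n) (c : 'I_n -> R) : quad (G (s, y + \sum_(j <- r) c j *: e j)) w <=
    expR k ^+ size r * quad (G (s, y)) w.
  elim: r => [|j r IH]; first by rewrite big_nil addr0 mul1r.
  rewrite big_cons addrCA addrC exprS -mulrA.
  have := (G_line s j (y + \sum_(i <- r) c i *: e i) w0).1 (c j) 0.
  rewrite scale0r addr0 => /le_trans; apply.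
  by rewrite ler_pM2l // expR_gt0.
have := H (index_enum 'I_n) (fun j => (x - y) 0 j).
have -> : y + \sum_(j <- index_enum 'I_n) (x - y) 0 j *: e j = x.
  by rewrite -[X in y + X]row_sum_delta addrC subrK.
move/le_trans; apply.
by rewrite [index_enum _]unlock -enumT size_enum_ord.
Qed.

(** The two signs give the two sides. The direction [w] may be irrational, so psi need not be
    periodic along the line; it is bounded, and [bounded_not_convex] applies to sgn psi. *)
Lemma G_touch s (w : S) (sgn : R) : sgn ^+ 2 = 1 ->
  exists x, sgn * quad (G (s, x)) w <= sgn * dot w w.
Proof.
move=> sg.
have [C C0 HC] := periodic_bounded s s (smooth_cont spsi) ppsi.
have D1 (t : R) : is_derive t (1 : R) (fun r => sgn * psi (s, 0 + r *: w))
    (sgn * \sum_j w 0 j * dx j psi (s, 0 + t *: w)).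
  have := is_derive_mul (is_derive_cst sgn t (1 : R)) (is_derive_segment s 0 w t spsi).
  by rewrite mul0r addr0.
have sd : smooth (fun p => \sum_j w 0 j * dx j psi p).
  apply: smooth_sum => j _; apply: smoothM; first exact: smooth_cst.
  exact: smooth_dx.
have D2 (t : R) : is_derive t (1 : R) (fun r => sgn * \sum_j w 0 j * dx j psi (s, 0 + r *: w))
    (sgn * \sum_i w 0 i * dx i (fun p => \sum_j w 0 j * dx j psi p) (s, 0 + t *: w)).
  have := is_derive_mul (is_derive_cst sgn t (1 : R)) (is_derive_segment s 0 w t sd).
  by rewrite mul0r addr0.
have [t ht] : exists t, sgn * (\sum_i w 0 i * dx i (fun p => \sum_j w 0 j * dx j psi p)
     (s, 0 + t *: w)) <= 0.
  apply: (bounded_not_convex D1 D2 (C := `|sgn| * C)) => t.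
  by rewrite normrM ler_wpM2l // HC // lexx.
exists (grad (fun y => kpot psi (s, y)) (0 + t *: w)).
rewrite -subr_le0 -mulrBr /Gmat /Theta /= (Xi_grad spsi ppsi posV).
suff -> : quad (Vmat psi (s, 0 + t *: w)) w - dot w w =
  \sum_i w 0 i * dx i (fun p => \sum_j w 0 j * dx j psi p) (s, 0 + t *: w) by [].
rewrite quadE /dot -sumrB; apply: eq_bigr => i _.
have -> : dx i (fun p => \sum_j w 0 j * dx j psi p) (s, 0 + t *: w) =
  \sum_j w 0 j * dx i (dx j psi) (s, 0 + t *: w).
  suff D : is_derive ((s, 0 + t *: w) : V) ((0, e i) : V) (fun p => \sum_j w 0 j * dx j psi p)
     (\sum_j w 0 j * dx i (dx j psi) (s, 0 + t *: w)) by have [_] := D.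
  apply: is_derive_bigsum => j _.
  have := is_derive_mul (is_derive_cst (w 0 j) ((s, 0 + t *: w) : V) ((0, e i) : V))
     (is_derive_dx i (s, 0 + t *: w) (smooth_dx j spsi)).
  by rewrite mul0r addr0.
rewrite mulr_sumr; apply/eqP; rewrite subr_eq; apply/eqP.
transitivity (\sum_j (w 0 i * (w 0 j * dx i (dx j psi) (s, 0 + t *: w)) +
   w 0 i * ((i == j)%:R * w 0 j))).
  by apply: eq_bigr => j _; rewrite (VmatE spsi); ring.
rewrite big_split /=; congr (_ + _).
rewrite (bigD1 i) //= eqxx mul1r big1 ?addr0 // => j /negPf ji.
by rewrite eq_sym ji mul0r mulr0.
Qed.

Lemma G_pinched p (w : S) : quad (G p) w <= expR k ^+ n * dot w w /\
  dot w w <= expR k ^+ n * quad (G p) w.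
Proof.
case: p => s x; split.
  have [y] := G_touch s w (expr1n _ 2); rewrite !mul1r => h.
  apply: (le_trans (G_harnack s x y w)); apply: ler_wpM2l h.
  by apply: exprn_ge0; exact: expR_ge0.
have sg : (- 1 : R) ^+ 2 = 1 by rewrite sqrrN expr1n.
have [y] := G_touch s w sg; rewrite !mulN1r lerN2 => h.
exact: (le_trans h (G_harnack s y x w)).
Qed.

(** One constant for all that the energy method uses. Polarisation passes from forms to entries, and
    W_b = - W G_b W transfers the bound on first derivatives from G to its inverse. *)
Lemma uniform_bounds : exists2 L, 1 <= L & forall p,
  [/\ forall w, dot w w <= L * quad (G p) w, forall i j, `|G p i j| <= L,
      forall i j, `|W p i j| <= L & forall b i j, `|dx b (fun q => W q i j) p| <= L].
Proof.
pose l := expR k ^+ n.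
have l1 : 1 <= l.
  rewrite exprn_ege1 // (le_trans _ (expR_ge1Dx _)) //.
  by rewrite lerDl le_max ler01.
have l0 : 0 <= l by rewrite (le_trans ler01).
have qG0 p w : 0 <= quad (G p) w.
  have [->|w0] := eqVneq w 0; first by rewrite quad0.
  exact: ltW (quadG_gt0 p w0).
have hG p i j : `|G p i j| <= 3 * l.
  apply: entry_le_quad => [| //|w]; first exact: G_sym.
  by rewrite ger0_norm //; exact: (G_pinched p w).1.
have hW p i j : `|W p i j| <= 3 * l.
  apply: entry_le_quad => [|//|w].
    by apply/matrixP => a b; rewrite mxE; exact: W_symE.
  have /andP[h1 h2] := quad_invmx_le (G_sym spsi p) (unit_Vmat spsi posV _) l0
    (fun w => (G_pinched p w).2) (qG0 p) w.
  by rewrite ger0_norm.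
have hG3 b p i j : `|G3 psi b p i j| <= 3 * (K * l).
  apply: entry_le_quad => [||w].
  - apply/matrixP => i' j'; rewrite mxE !G3_E; congr (dx b _ p).
    by apply/funext => q; exact: G_symE.
  - exact: mulr_ge0.
  have [->|w0] := eqVneq w 0.
    by rewrite quad0 normr0 mulr_ge0 ?mulr_ge0 // dot_ge0.
  case: p => s x; rewrite quadE.
  under eq_bigr do under eq_bigr do rewrite G3_E.
  have [_ /(_ (l * dot w w))] := G_line s b x w0.
  move=> /(_ (fun t => (G_pinched _ w).1)) /(_ 0).
  by rewrite scale0r addr0 mulrA.
have hW3 b p i j : `|W3 psi b p i j| <= n%:R * (n%:R * (3 * l * (3 * (K * l)) * (3 * l))).
  have -> : W3 psi b p = - (W p *m G3 psi b p *m W p).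
    rewrite (G3E spsi ppsi posV) mulmxN mulNmx opprK.
    have uG : G p \in unitmx by exact: unit_Vmat.
    have WG : W p *m G p = 1%:M by exact: mulVmx.
    have GW : G p *m W p = 1%:M by exact: mulmxV.
    by rewrite !mulmxA WG mul1mx -mulmxA GW mulmx1.
  rewrite mxE normrN mulmx3E (le_trans (ler_norm_sum _ _ _)) //.
  apply: ler_sum_cst => a; rewrite (le_trans (ler_norm_sum _ _ _)) //.
  apply: ler_sum_cst => c; rewrite !normrM.
  by apply: ler_pM => //; apply: ler_pM.
pose m := n%:R * (n%:R * (3 * l * (3 * (K * l)) * (3 * l))) : R.
have m0 : 0 <= m by rewrite /m !mulr_ge0.
exists (3 * l + m); first by lra.
move=> p; split=> [w|i j|i j|b i j].
- rewrite (le_trans (G_pinched p w).2) // ler_wpM2r //; rewrite -/l; lra.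
- by rewrite (le_trans (hG p i j)) // lerDl.
- by rewrite (le_trans (hW p i j)) // lerDl.
- by rewrite -W3E (le_trans (hW3 b p i j)) // lerDr mulr_ge0.
Qed.

End UniformBounds.

(** * Energy estimates *)

Section TraceInequality.
Context {R : realType} {n : nat}.

Lemma sum_quad_row (m : nat) (B : 'M[R]_n) (A : 'M[R]_(m, n)) :
  \sum_i quad B (row i A) = \tr (A *m B *m A^T).
Proof.
rewrite /mxtrace; apply: eq_bigr => i _.
rewrite /quad -row_mul [LHS]mxE [RHS]mxE; apply: eq_bigr => j _.
by rewrite [row i _ 0 j]mxE [_^T j 0]mxE [row i A 0 j]mxE [A^T j i]mxE.
Qed.

Lemma sum_dot_row (m : nat) (A : 'M[R]_(m, n)) :
  \sum_i dot (row i A) (row i A) = \tr (A *m A^T).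
Proof.
rewrite -[X in X *m _]mulmx1 -sum_quad_row; apply: eq_bigr => i _.
by rewrite /quad mulmx1 dotE.
Qed.

(** Ellipticity of the linearised operator. With G = C C^T the right side is tr (C^T A G A C), and
    the lower bound on G is used twice, cyclicity of the trace exposing the second G. *)
Lemma trace_lower_bound (A G : 'M[R]_n) (c : R) : 0 < c -> A^T = A -> G^T = G ->
  (forall w, c * dot w w <= quad G w) ->
  c ^+ 2 * (\sum_i \sum_j A i j ^+ 2) <= \sum_i \sum_j A i j * (G *m A *m G) i j.
Proof.
move=> c0 sA sG H.
have pG : posdef G.
  by move=> w w0; apply: lt_le_trans (H w); rewrite mulr_gt0 // dot_gt0.
have [C EG _] := cholesky sG pG.
have trE (m : nat) (D : 'M[R]_(m, n)) : c * \tr (D *m D^T) <= \tr (D *m G *m D^T).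
  rewrite -sum_quad_row -sum_dot_row mulr_sumr; apply: ler_sum => i _; exact: H.
have -> : \sum_i \sum_j A i j * (G *m A *m G) i j = \tr ((C^T *m A) *m G *m (C^T *m A)^T).
  rewrite trmx_mul trmxK sA -!mulmxA mxtrace_mulC -!mulmxA -EG /mxtrace.
  apply: eq_bigr => i _; rewrite [RHS]mxE; apply: eq_bigr => j _.
  have sQ : (G *m A *m G)^T = G *m A *m G by rewrite !trmx_mul sA sG mulmxA.
  by congr (_ * _); rewrite !mulmxA -[in LHS]sQ [_^T i j]mxE.
have -> : \sum_i \sum_j A i j ^+ 2 = \tr (A *m A^T).
  rewrite /mxtrace; apply: eq_bigr => i _; rewrite [RHS]mxE; apply: eq_bigr => j _.
  by rewrite [A^T j i]mxE expr2.
apply: le_trans (trE _ _); rewrite expr2 -mulrA ler_pM2l //.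
apply: (le_trans (trE _ A)).
rewrite trmx_mul trmxK sA -!mulmxA [leRHS]mxtrace_mulC -!mulmxA -EG.
by rewrite [leRHS]mxtrace_mulC -mulmxA.
Qed.

End TraceInequality.

(** * Differential polynomials in G and H *)

Section Energy.
Context {R : realType} {n : nat}.
Notation S := 'rV[R]_n.
Notation V := (R * 'rV[R]_n)%type.
Variables (G : V -> 'M[R]_n) (h : V -> R).
Hypothesis sG : forall i j, smooth (fun p => G p i j).
Hypothesis pG : forall i j, periodicx (fun p => G p i j).
Hypothesis symG : forall p, (G p)^T = G p.
Hypothesis sh : smooth h.
Hypothesis ph : periodicx h.
Local Notation H a b := (dx a (dx b h)).
Hypothesis dG : forall l i j, dx l (fun p => G p i j) =
  (fun p => - \sum_a \sum_b G p i a * dx l (H a b) p * G p b j).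

Let sH a b : smooth (H a b).
Proof. by apply: smooth_dx; exact: smooth_dx. Qed.

Let pH a b : periodicx (H a b).
Proof. exact: (periodicx_dxs [:: a; b] ph). Qed.

(* Sums of monomials in the entries of G and the derivatives of H, with k
   derivatives in total and at least p factors H. *)
Inductive DPoly : nat -> nat -> (V -> R) -> Prop :=
| DPoly_zero k p : DPoly k p (fun=> 0)
| DPoly_cst c : DPoly 0 0 (fun=> c)
| DPoly_G i j : DPoly 0 0 (fun q => G q i j)
| DPoly_H a i j : DPoly (size a) 1 (dxs a (H i j))
| DPoly_mul k l p q f g : DPoly k p f -> DPoly l q g -> DPoly (k + l) (p + q) (fun x => f x * g x)
| DPoly_add k p f g : DPoly k p f -> DPoly k p g -> DPoly k p (fun x => f x + g x)
| DPoly_weak k p f : DPoly k p.+1 f -> DPoly k p f.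

Lemma DPoly_smooth k p f : DPoly k p f -> smooth f.
Proof.
elim=> {k p f}.
- by move=> _ _; exact: smooth_cst.
- by move=> c; exact: smooth_cst.
- by move=> i j; exact: sG.
- by move=> a i j; apply: smooth_dxs; exact: sH.
- by move=> k l p q f g _ sf _ sg; exact: smoothM.
- by move=> k p f g _ sf _ sg; exact: smoothD.
- by move=> k p f _.
Qed.

Lemma DPoly_periodic k p f : DPoly k p f -> periodicx f.
Proof.
elim=> {k p f} //.
- by move=> a i j; apply: periodicx_dxs; exact: pH.
- by move=> k l p q f g _ pf _ qg s m x; rewrite pf qg.
- by move=> k p f g _ pf _ qg s m x; rewrite pf qg.
Qed.

Lemma DPoly_sum (I : Type) (r : seq I) (F : I -> V -> R) k p :
  (forall i, DPoly k p (F i)) -> DPoly k p (fun q => \sum_(i <- r) F i q).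
Proof.
move=> HF; elim: r => [|i r IH].
  have -> : (fun q => \sum_(i <- [::]) F i q) = (fun=> 0).
    by apply/funext => q; rewrite big_nil.
  exact: DPoly_zero.
have -> : (fun q => \sum_(j <- i :: r) F j q) = (fun q => F i q + \sum_(j <- r) F j q).
  by apply/funext => q; rewrite big_cons.
exact: DPoly_add.
Qed.

Lemma DPoly_scale (c : R) k p f : DPoly k p f -> DPoly k p (fun q => c * f q).
Proof. by move=> Pf; have := DPoly_mul (DPoly_cst c) Pf; rewrite !add0n. Qed.

Lemma DPoly_sandwich k p f i a b j : DPoly k p f ->
  DPoly k p (fun q => G q i a * f q * G q b j).
Proof.
move=> Pf; have := DPoly_mul (DPoly_mul (DPoly_G i a) Pf) (DPoly_G b j).
by rewrite !add0n !addn0.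
Qed.

Lemma DPoly_dG l i j : DPoly 1 1 (dx l (fun q => G q i j)).
Proof.
rewrite dG.
have -> : (fun p => - \sum_a \sum_b G p i a * dx l (H a b) p * G p b j) =
    (fun p => -1 * \sum_a \sum_b G p i a * dxs [:: l] (H a b) p * G p b j).
  by apply/funext => p; rewrite mulN1r.
apply: DPoly_scale; apply: DPoly_sum => a; apply: DPoly_sum => b.
by apply: DPoly_sandwich; exact: (DPoly_H [:: l]).
Qed.

Lemma DPoly_dx l k p f : DPoly k p f -> DPoly k.+1 p (dx l f).
Proof.
elim=> {k p f}.
- by move=> k p; rewrite dx_cst; exact: DPoly_zero.
- by move=> c; rewrite dx_cst; exact: DPoly_zero.
- by move=> i j; apply: DPoly_weak; exact: DPoly_dG.
- by move=> a i j; exact: (DPoly_H (l :: a)).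
- move=> k m p q f g Pf IHf Pg IHg.
  rewrite (dxM l (DPoly_smooth Pf) (DPoly_smooth Pg)); apply: DPoly_add.
    by rewrite -addnS; exact: DPoly_mul.
  by rewrite -addSn; exact: DPoly_mul.
- move=> k p f g Pf IHf Pg IHg.
  rewrite (dxD l (DPoly_smooth Pf) (DPoly_smooth Pg)); exact: DPoly_add.
- by move=> k p f _ IH; exact: DPoly_weak.
Qed.

(** The defect of D^a G = - G (D^a H) G, that is, the nonlinear part of the flow at order [a]. *)
Definition remainder (a : seq 'I_n) i j (p : V) : R :=
  dxs a (fun q => G q i j) p + \sum_c \sum_d G p i c * dxs a (H c d) p * G p d j.

Lemma remainder1 l i j p : remainder [:: l] i j p = 0.
Proof. by rewrite /remainder /= dG addNr. Qed.

(** Differentiating G (D^a H) G reproduces the leading term when the derivative falls on the middle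
    factor; falling on an outer G it creates a second factor of type H. *)
Lemma DPoly_remainder l a i j : DPoly (size a).+1 2 (remainder (l :: a) i j).
Proof.
elim: a l => [|m a IH] l.
  have -> : remainder [:: l] i j = (fun=> 0) by apply/funext => p; exact: remainder1.
  exact: DPoly_zero.
pose F c d q := G q i c * dxs (m :: a) (H c d) q * G q d j.
have sF c d : smooth (F c d).
  by apply: smoothM; [apply: smoothM; [exact: sG|apply: smooth_dxs; exact: sH]|exact: sG].
have sF2 : smooth (fun q => \sum_c \sum_d F c d q).
  by apply: smooth_sum => c _; apply: smooth_sum => d _; exact: sF.
have sR : smooth (remainder (m :: a) i j) := DPoly_smooth (IH m).
have E : dxs (m :: a) (fun q => G q i j) =
    (fun q => remainder (m :: a) i j q + -1 * \sum_c \sum_d F c d q).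
  by apply/funext => q; rewrite mulN1r addrK.
have dF c d : dx l (F c d) = (fun q => G q i c * dxs (l :: m :: a) (H c d) q * G q d j +
    (G q i c * dxs (m :: a) (H c d) q * dx l (fun r => G r d j) q +
     dx l (fun r => G r i c) q * dxs (m :: a) (H c d) q * G q d j)).
  have s1 : smooth (fun q => G q i c * dxs (m :: a) (H c d) q).
    by apply: smoothM; [exact: sG|apply: smooth_dxs; exact: sH].
  rewrite (dxM l s1 (sG d j)) (dxM l (sG i c) (smooth_dxs (m :: a) (sH c d))).
  by apply/funext => q; rewrite /=; ring.
have -> : remainder (l :: m :: a) i j = (fun q => dx l (remainder (m :: a) i j) q +
   -1 * \sum_c \sum_d
    (G q i c * dxs (m :: a) (H c d) q * dx l (fun r => G r d j) q +
     dx l (fun r => G r i c) q * dxs (m :: a) (H c d) q * G q d j)).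
  apply/funext => q; rewrite {1}/remainder.
  have -> : dxs (l :: m :: a) (fun r => G r i j) q = dx l (remainder (m :: a) i j) q +
      (0 * \sum_c \sum_d F c d q + -1 * \sum_c \sum_d dx l (F c d) q).
    rewrite -[dxs (l :: m :: a) _]/(dx l (dxs (m :: a) _)) E.
    rewrite (dxD l sR (smoothM (smooth_cst (-1 : R)) sF2)) (dxM l (smooth_cst (-1 : R)) sF2).
    rewrite dx_cst dx_sum; last by move=> c _; apply: smooth_sum => d _; exact: sF.
    rewrite [X in _ + X]addrC; congr (_ + (_ + -1 * _)); apply: eq_bigr => c _.
    rewrite dx_sum; first by [].
    by move=> d _; exact: sF.
  rewrite mul0r add0r !mulN1r -addrA; congr (_ + _).
  apply/eqP; rewrite addrC subr_eq addrC -subr_eq opprK -big_split /=; apply/eqP.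
  by apply: eq_bigr => c _; rewrite -big_split /=; apply: eq_bigr => d _; rewrite dF.
apply: DPoly_add; first exact: (DPoly_dx l (IH m)).
apply: DPoly_scale; apply: DPoly_sum => c; apply: DPoly_sum => d; apply: DPoly_add.
  have := DPoly_mul (DPoly_mul (DPoly_G i c) (DPoly_H (m :: a) c d)) (DPoly_dG l d j).
  by rewrite !add0n !addn1.
have := DPoly_mul (DPoly_mul (DPoly_dG l i c) (DPoly_H (m :: a) c d)) (DPoly_G d j).
by rewrite !addn0 !addn1 add1n.
Qed.

End Energy.

Lemma ler_term (R : numDomainType) (I : finType) (F : I -> R) i :
  (forall j, 0 <= F j) -> F i <= \sum_j F j.
Proof. by move=> F0; rewrite (bigD1 i) //= lerDl sumr_ge0. Qed.

Lemma ler_term2 (R : numDomainType) (I J : finType) (F : I -> J -> R) i j :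
  (forall i j, 0 <= F i j) -> F i j <= \sum_i \sum_j F i j.
Proof.
move=> F0; apply: (le_trans (ler_term j (F0 i))).
by apply: (ler_term (F := fun i => \sum_j F i j)) => k; exact: sumr_ge0.
Qed.

(** * Interpolation of differential polynomials *)

Section EnergyEstimates.
Context {R : realType} {n : nat}.
Notation S := 'rV[R]_n.
Notation V := (R * 'rV[R]_n)%type.
Variables (G : V -> 'M[R]_n) (h : V -> R).
Hypothesis sG : forall i j, smooth (fun p => G p i j).
Hypothesis pG : forall i j, periodicx (fun p => G p i j).
Hypothesis symG : forall p, (G p)^T = G p.
Hypothesis sh : smooth h.
Hypothesis ph : periodicx h.
Local Notation H a b := (dx a (dx b h)).
Hypothesis dG : forall l i j, dx l (fun p => G p i j) =
  (fun p => - \sum_a \sum_b G p i a * dx l (H a b) p * G p b j).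
Variable L : R.
Hypothesis L1 : 1 <= L.
Hypothesis G_lower : forall p w, dot w w <= L * quad (G p) w.
Hypothesis G_upper : forall p i j, `|G p i j| <= L.
Local Notation DPoly := (DPoly G h).
Local Notation remainder := (remainder G h).

Let sH a b : smooth (H a b).
Proof. by apply: smooth_dx; exact: smooth_dx. Qed.

Let pH a b : periodicx (H a b).
Proof. exact: (periodicx_dxs [:: a; b] ph). Qed.

Let L0 : 0 <= L.
Proof. exact: le_trans ler01 L1. Qed.

(** A homogeneity count: Z carries one power per derivative and M one per factor H. Factors beyond
    the p-th are harmless because M <= 1. *)
Lemma DPoly_le k p f : DPoly k p f -> exists2 C, 0 <= C & forall q (M Z : R),
  0 <= M -> M <= 1 -> 0 <= Z ->
  (forall a i j, (size a <= k)%N -> `|dxs a (H i j) q| <= M * Z ^+ size a) ->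
  `|f q| <= C * M ^+ p * Z ^+ k.
Proof.
elim=> {k p f}.
- move=> k p; exists 0; first by [].
  by move=> q M Z _ _ _ _; rewrite normr0 !mul0r.
- move=> c; exists `|c|; first by [].
  by move=> q M Z _ _ _ _; rewrite !mulr1.
- move=> i j; exists L; first exact: L0.
  by move=> q M Z _ _ _ _; rewrite !mulr1.
- move=> a i j; exists 1; first exact: ler01.
  by move=> q M Z _ _ _ hq; rewrite mul1r expr1; exact: hq.
- move=> k l p p' f g _ [C C0 HC] _ [D D0 HD]; exists (C * D); first exact: mulr_ge0.
  move=> q M Z M0 M1 Z0 hq; rewrite normrM !exprD.
  have -> : C * D * (M ^+ p * M ^+ p') * (Z ^+ k * Z ^+ l) =
    (C * M ^+ p * Z ^+ k) * (D * M ^+ p' * Z ^+ l) by ring.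
  apply: ler_pM => //.
    by apply: HC => // a i j ak; apply: hq; rewrite (leq_trans ak) // leq_addr.
  by apply: HD => // a i j ak; apply: hq; rewrite (leq_trans ak) // leq_addl.
- move=> k p f g _ [C C0 HC] _ [D D0 HD]; exists (C + D); first exact: addr_ge0.
  move=> q M Z M0 M1 Z0 hq; rewrite !mulrDl (le_trans (ler_normD _ _)) //.
  by apply: lerD; [exact: HC|exact: HD].
- move=> k p f _ [C C0 HC]; exists C; first by [].
  move=> q M Z M0 M1 Z0 hq; apply: le_trans (HC q M Z M0 M1 Z0 hq) _.
  apply: ler_wpM2r; first exact: exprn_ge0.
  by apply: ler_wpM2l => //; rewrite exprS ler_piMl // exprn_ge0.
Qed.

Lemma dxs_scale (c : R) a (f : V -> R) : smooth f -> dxs a (fun q => c * f q) = (fun q => c * dxs a f q).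
Proof.
move=> sf; elim: a => [//|i a IH] /=; rewrite IH.
rewrite (dxM i (smooth_cst c) (smooth_dxs a sf)) dx_cst.
by apply/funext => q; rewrite mul0r addr0.
Qed.

Definition Hnorm (k : nat) (s : R) : R :=
  sum_words k (fun a => \sum_i \sum_j Avg (fun x => dxs a (H i j) (s, x) ^+ 2)).

Lemma cp_dxs_sqr a (f : V -> R) s : smooth f -> periodicx f ->
  cont_periodic (fun x => dxs a f (s, x) ^+ 2).
Proof.
move=> sf pf; have c := cp_slice_smooth s (smooth_dxs a sf) (periodicx_dxs a pf).
exact: (cpM c c).
Qed.

Lemma cp_sum_words m (F : S -> seq 'I_n -> R) : (forall a, cont_periodic (fun x => F x a)) ->
  cont_periodic (fun x => sum_words m (F x)) /\
  Avg (fun x => sum_words m (F x)) = sum_words m (fun a => Avg (fun x => F x a)).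
Proof.
elim: m F => [|m IH] F HF; first by split; [exact: HF|].
have HF' i a : cont_periodic (fun x => F x (i :: a)) by exact: HF.
split => /=.
  by apply: cp_sum => i _; exact: (IH (fun x a => F x (i :: a)) (HF' i)).1.
rewrite Avg_sum; last by move=> i; exact: (IH (fun x a => F x (i :: a)) (HF' i)).1.
by apply: eq_bigr => i _; exact: (IH (fun x a => F x (i :: a)) (HF' i)).2.
Qed.

(* Interpolation: a term with k derivatives is controlled by the k-th
   derivatives of H alone, with a gain in sup |H|. *)
Lemma DPoly_Avg k f : DPoly k.+1 2 f -> exists2 C, 0 <= C & forall s M,
  0 < M -> M <= 1 -> (forall x i j, `|H i j (s, x)| <= M) ->
  Avg (fun x => f (s, x) ^+ 2) <= C * M ^+ 2 * Hnorm k.+1 s.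
Proof.
move=> Pf; have [C C0 HC] := DPoly_le Pf.
have [D D0 HD] := @gagliardo_nirenberg R n k.+1 isT.
exists (C ^+ 2 * (k.+1%:R * D)); first by rewrite !mulr_ge0 // exprn_ge0.
move=> s M M0 M1 HM; pose N := k.+1.
(* Normalised to |w| <= 1, as the interpolation inequality requires. *)
pose w i j q := M^-1 * H i j q.
have sw i j : smooth (w i j) by apply: smoothM; [exact: smooth_cst|exact: sH].
have pw i j : periodicx (w i j) by move=> r m x; rewrite /w (pH i j).
have w1 i j x : `|w i j (s, x)| <= 1.
  by rewrite normrM normfV (gtr0_norm M0) ler_pdivrMl // mulr1.
pose e (l : nat) : R := (2 * N)%:R / l%:R.
have e0 l : (0 < l)%N -> 0 < e l by move=> l0; rewrite divr_gt0 // ltr0n // muln_gt0.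
pose t (l : nat) x (a : seq 'I_n) := \sum_i \sum_j abs_pow (e l) (dxs a (w i j) (s, x)).
have t0 l x a : 0 <= t l x a.
  by apply: sumr_ge0 => i _; apply: sumr_ge0 => j _; exact: powR_ge0.
(* Collects |D^l w|^(2N/l) over all orders 1 <= l <= N, hence dominates each of them pointwise. *)
pose T x := \sum_(l < N) sum_words l.+1 (t l.+1 x).
have T0 x : 0 <= T x by apply: sumr_ge0 => l _; apply: sum_words_ge0.
have tT l x a i j : size a = l.+1 -> (l < N)%N ->
    abs_pow (e l.+1) (dxs a (w i j) (s, x)) <= T x.
  move=> al lN; apply: (@le_trans _ _ (t l.+1 x a)).
    apply: (ler_term2 (F := fun i j => abs_pow (e l.+1) (dxs a (w i j) (s, x)))) => *.
    exact: powR_ge0.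
  apply: (@le_trans _ _ (sum_words l.+1 (t l.+1 x))).
    by rewrite -al; apply: sum_words_term => b; rewrite al; exact: t0.
  apply: (ler_term (F := fun l : 'I_N => sum_words l.+1 (t l.+1 x)) (Ordinal lN)) => m.
  by apply: sum_words_ge0 => b _; exact: t0.
have fT x : f (s, x) ^+ 2 <= C ^+ 2 * M ^+ 4 * T x.
  (* This root gives |D^l w| <= Z^l at every order, the hypothesis of [DPoly_le], so f^2 <= C^2 M^4
     T. Interpolation returns a factor M^-2, and the net gain is M^2. *)
  pose Z := T x `^ (2 * N)%:R^-1.
  have Z0 : 0 <= Z by exact: powR_ge0.
  have ZT : Z ^+ (2 * N) = T x.
    by rewrite -powR_mulrn // -powRrM mulVf ?powRr1 // pnatr_eq0.
  have hq a i j : (size a <= N)%N -> `|dxs a (H i j) (s, x)| <= M * Z ^+ size a.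
    case: a => [_|b a]; first by rewrite mulr1; exact: HM.
    move=> ak; have := tT (size a) x (b :: a) i j erefl ak.
    rewrite (dxs_scale _ _ (sH i j)); set y := dxs _ _ _; set m := (size (b :: a)) => h1.
    suff : `|M^-1 * y| <= Z ^+ m by rewrite normrM normfV (gtr0_norm M0) ler_pdivrMl.
    rewrite -(@ler_pXn2r _ (2 * N)) ?nnegrE ?exprn_ge0 //.
    rewrite -exprM (mulnC m) (exprM Z) ZT.
    have -> : `|M^-1 * y| ^+ (2 * N) = abs_pow (e m) (M^-1 * y) ^+ m.
      rewrite -abs_powM /e divfK ?pnatr_eq0 // /abs_pow powR_mulrn //.
    by apply: lerXn2r; rewrite ?nnegrE ?powR_ge0 ?T0.
  have := HC (s, x) M Z (ltW M0) M1 Z0 hq.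
  have Y0 : 0 <= C * M ^+ 2 * Z ^+ N by rewrite !mulr_ge0 ?exprn_ge0 // ltW.
  rewrite -(@ler_pXn2r _ 2) ?nnegrE // real_normK ?num_real //.
  by rewrite !exprMn -!exprM (mulnC N) ZT -(exprD M 2 2).
have ct l a : (0 < l)%N -> cont_periodic (fun x => t l x a).
  move=> l0; apply: cp_sum => i _; apply: cp_sum => j _.
  exact: (cp_abs_pow s (smooth_dxs a (sw i j)) (periodicx_dxs a (pw i j)) (e0 _ l0)).
have cw m F := @cp_sum_words m F.
have cT : cont_periodic T.
  by apply: cp_sum => l _; exact: (cw l.+1 (t l.+1) (fun a => ct l.+1 a isT)).1.
have AT : Avg T <= k.+1%:R * D * (M ^- 2 * Hnorm N s).
  rewrite Avg_sum; last first.
    by move=> l; exact: (cw l.+1 (t l.+1) (fun a => ct l.+1 a isT)).1.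
  rewrite -mulrA; apply: ler_sum_cst => l.
  rewrite (cw l.+1 (t l.+1) (fun a => ct l.+1 a isT)).2.
  have -> : sum_words l.+1 (fun a => Avg (fun x => t l.+1 x a)) =
      \sum_i \sum_j pow_energy N (w i j) s l.+1.
    rewrite /pow_energy; under [RHS]eq_bigr do rewrite -sum_words_sum.
    rewrite -sum_words_sum; apply: eq_sum_words => a _.
    have cc i j : cont_periodic (fun x => abs_pow (e l.+1) (dxs a (w i j) (s, x))).
      exact: (cp_abs_pow s (smooth_dxs a (sw i j)) (periodicx_dxs a (pw i j)) (e0 l.+1 isT)).
    rewrite Avg_sum; last by move=> i; apply: cp_sum => j _; exact: cc.
    apply: eq_bigr => i _; rewrite Avg_sum //.
  have -> : D * (M ^- 2 * Hnorm N s) = \sum_i \sum_j D * pow_energy N (w i j) s N.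
    under [RHS]eq_bigr do rewrite -mulr_sumr.
    rewrite -mulr_sumr; congr (_ * _); rewrite /Hnorm -sum_wordsZ.
    rewrite /pow_energy; under [RHS]eq_bigr do rewrite -sum_words_sum.
    rewrite -sum_words_sum; apply: eq_sum_words => a _.
    rewrite mulr_sumr; apply: eq_bigr => i _; rewrite mulr_sumr; apply: eq_bigr => j _.
    rewrite -AvgZ; last exact: (cp_dxs_sqr a s (sH i j) (pH i j)).
    congr Avg; apply/funext => x; rewrite (dxs_scale _ _ (sH i j)).
    rewrite natrM mulfK ?pnatr_eq0 // /abs_pow powR_mulrn // real_normK ?num_real //.
    by rewrite exprMn exprVn.
  apply: ler_sum => i _; apply: ler_sum => j _.
  exact: (HD (w i j) s l.+1 (sw i j) (pw i j) (w1 i j) (ltn_ord l)).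
have cf : cont_periodic (fun x => f (s, x) ^+ 2).
  have c := cp_slice_smooth s (DPoly_smooth sG sh Pf) (DPoly_periodic pG ph Pf).
  exact: (cpM c c).
apply: (le_trans (Avg_le cf (cpZ _ cT) fT)); rewrite AvgZ //.
have MM : 0 <= C ^+ 2 * M ^+ 4 by rewrite mulr_ge0 // exprn_ge0 // ltW.
apply: (le_trans (ler_wpM2l MM AT)); rewrite le_eqVlt; apply/orP; left; apply/eqP.
have M4 : M ^+ 4 * M ^- 2 = M ^+ 2 by rewrite (exprD M 2 2 : M ^+ 4 = _) mulfK // expf_neq0 // gt_eqF.
by move: M4; set m := M ^- 2 => <-; ring.
Qed.

End EnergyEstimates.

Lemma bounded_sum (R : numDomainType) (I : finType) (T : Type) (Q : T -> Prop) (X : T -> R)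
    (F : I -> T -> R) :
  (forall i, exists2 C, 0 <= C & forall t, Q t -> F i t <= C * X t) ->
  exists2 C, 0 <= C & forall t, Q t -> \sum_i F i t <= C * X t.
Proof.
move=> HF; exists (\sum_i projT1 (cid2 (HF i))).
  by apply: sumr_ge0 => i _; case: (cid2 (HF i)).
move=> t Qt; rewrite mulr_suml; apply: ler_sum => i _.
by case: (cid2 (HF i)) => C C0 HC /=; exact: HC.
Qed.

Lemma bounded_sum_words (R : realType) (I : finType) (T : Type) (Q : T -> Prop) (X : T -> R)
    k (F : seq I -> T -> R) :
  (forall a, size a = k -> exists2 C, 0 <= C & forall t, Q t -> F a t <= C * X t) ->
  exists2 C, 0 <= C & forall t, Q t -> sum_words k (fun a => F a t) <= C * X t.
Proof.
elim: k F => [|k IH] F HF; first exact: HF.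
apply: bounded_sum => i; apply: (IH (fun a => F (i :: a))) => a ak.
by apply: HF; rewrite /= ak.
Qed.

Lemma is_derive_sum_words (R : realType) (I : finType) k (F : seq I -> R -> R)
    (dF : seq I -> R) (s : R) :
  (forall a, is_derive s (1 : R) (F a) (dF a)) ->
  is_derive s (1 : R) (fun r => sum_words k (fun a => F a r)) (sum_words k dF).
Proof.
elim: k F dF => [|k IH] F dF HF; first exact: HF.
apply: is_derive_bigsum => i _; apply: (IH (fun a => F (i :: a))) => a; exact: HF.
Qed.

Lemma nonincreasing_from (R : realType) (g dg : R -> R) (s0 a b : R) :
  (forall s : R, is_derive s (1 : R) g (dg s)) -> (forall s, s0 <= s -> dg s <= 0) ->
  s0 <= a -> a <= b -> g b <= g a.
Proof.
move=> hg dg0 sa ab; have [c /andP[hc _] E] := MVT_any a b hg.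
have sc : s0 <= c by rewrite (le_trans sa) // (le_trans _ hc) // le_min lexx ab.
by rewrite -subr_le0 E mulr_le0_ge0 ?dg0 // subr_ge0.
Qed.

Definition tends0 (R : realType) (g : R -> R) : Prop :=
  forall eps, 0 < eps -> exists s0, forall s, s0 <= s -> g s <= eps.

(** g multiplied by 1 + c (s - s0) is nonincreasing after s0; this linear weight is enough in place
    of an exponential. *)
Lemma decay (R : realType) (g dg : R -> R) (s0 c : R) : 0 < c ->
  (forall s : R, is_derive s (1 : R) g (dg s)) -> (forall s, 0 <= g s) ->
  (forall s, s0 <= s -> dg s <= - c * g s) -> tends0 g.
Proof.
move=> c0 hg g0 H eps eps0.
pose k s := g s * (1 + c * (s - s0)).
have dk (s : R) : is_derive s (1 : R) k (g s * c + dg s * (1 + c * (s - s0))).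
  have D : is_derive s (1 : R) (fun r => 1 + c * (r - s0)) c.
    have := is_derive_add (is_derive_cst (1 : R) s (1 : R)) (is_derive_mul
      (is_derive_cst c s (1 : R)) (is_derive_add (is_derive_id s (1 : R))
      (is_derive_cst (- s0) s (1 : R)))).
    by rewrite mul0r !addr0 add0r mulr1.
  exact: (is_derive_mul (hg s) D).
have k_le s : s0 <= s -> k s <= g s0.
  move=> hs; have -> : g s0 = k s0 by rewrite /k subrr mulr0 addr0 mulr1.
  apply: (nonincreasing_from dk _ (lexx s0) hs) => r hr.
  have h1 := H r hr; have h2 : 0 <= c * (r - s0) by rewrite mulr_ge0 ?subr_ge0 // ltW.
  have h3 : dg r * (1 + c * (r - s0)) <= - c * g r * (1 + c * (r - s0)).
    by rewrite ler_wpM2r // addr_ge0.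
  have h4 : 0 <= c * g r * (c * (r - s0)) by apply: mulr_ge0 => //; rewrite mulr_ge0 // ltW.
  move: h3 h4; set u := c * (r - s0); lra.
exists (s0 + g s0 / (c * eps)) => s hs.
have hs0 : s0 <= s.
  by rewrite (le_trans _ hs) // lerDl divr_ge0 // mulr_ge0 // ltW.
have h1 : g s0 <= c * eps * (s - s0).
  by rewrite -ler_pdivrMl ?mulr_gt0 // lerBrDl [_^-1 * _]mulrC.
have u0 : 0 <= c * (s - s0) by rewrite mulr_ge0 ?subr_ge0 // ltW.
have h2 := k_le s hs0; rewrite /k in h2.
rewrite -(@ler_pM2r _ (1 + c * (s - s0))); last by rewrite ltr_wpDr.
apply: (le_trans h2); apply: (le_trans h1).
rewrite -subr_ge0 (_ : _ - _ = eps); first exact: ltW.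
by ring.
Qed.

(** * Decay of the energies *)

Section EnergyDecay.
Context {R : realType} {n : nat}.
Notation S := 'rV[R]_n.
Notation V := (R * 'rV[R]_n)%type.
Variables (G : V -> 'M[R]_n) (h : V -> R).
Hypothesis sG : forall i j, smooth (fun p => G p i j).
Hypothesis pG : forall i j, periodicx (fun p => G p i j).
Hypothesis symG : forall p, (G p)^T = G p.
Hypothesis sh : smooth h.
Hypothesis ph : periodicx h.
Local Notation H a b := (dx a (dx b h)).
Hypothesis dG : forall l i j, dx l (fun p => G p i j) =
  (fun p => - \sum_a \sum_b G p i a * dx l (H a b) p * G p b j).
Variable L : R.
Hypothesis L1 : 1 <= L.
Hypothesis G_lower : forall p w, dot w w <= L * quad (G p) w.
Hypothesis G_upper : forall p i j, `|G p i j| <= L.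
Definition flow_rhs (p : V) : R := \sum_i \sum_j dx j (dx i (fun q => G q i j)) p.
Hypothesis flow : dt h = (fun p => expR p.1 * flow_rhs p).
Hypothesis H_bounded : forall p i j, `|H i j p| <= L.
Hypothesis H_lip : forall p l i j, `|dx l (H i j) p| <= L.
Local Notation Hnorm := (Hnorm h).
Local Notation DPoly := (DPoly G h).
Local Notation remainder := (remainder G h).

Let sH a b : smooth (H a b).
Proof. by apply: smooth_dx; exact: smooth_dx. Qed.

Let pH a b : periodicx (H a b).
Proof. exact: (periodicx_dxs [:: a; b] ph). Qed.

Let L0 : 0 <= L.
Proof. exact: le_trans ler01 L1. Qed.
Lemma Avg_parts i (u v : V -> R) s : smooth u -> periodicx u -> smooth v -> periodicx v ->
  Avg (fun x => u (s, x) * dx i v (s, x)) = - Avg (fun x => dx i u (s, x) * v (s, x)).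
Proof.
move=> su pu sv pv; have su' := smooth_dx i su; have sv' := smooth_dx i sv.
have pu' : periodicx (dx i u) by exact: (periodicx_dxs [:: i] pu).
have pv' : periodicx (dx i v) by exact: (periodicx_dxs [:: i] pv).
have c1 := cpM (cp_slice_smooth s su pu) (cp_slice_smooth s sv' pv').
have c2 := cpM (cp_slice_smooth s su' pu') (cp_slice_smooth s sv pv).
apply/eqP; rewrite -subr_eq0 opprK -AvgD //; apply/eqP.
apply: (Avg_derive0 (cpM (cp_slice_smooth s su pu) (cp_slice_smooth s sv pv)) (cpD c1 c2)) => x.
exact: (is_derive_mul (slice_derive s x i su) (slice_derive s x i sv)).
Qed.

Definition energy (k : nat) (s : R) : R :=
  sum_words k (fun a => Avg (fun x => dxs a h (s, x) ^+ 2)).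

Lemma Hnorm_energy k s : Hnorm k s = energy k.+2 s.
Proof.
rewrite /energy -addn2 sum_words_cat; apply: eq_sum_words => a _ /=.
by apply: eq_bigr => i _; apply: eq_bigr => j _; rewrite dxs_cat.
Qed.

Lemma energy_ge0 k s : 0 <= energy k s.
Proof.
apply: sum_words_ge0 => a _; apply: Avg_ge0; first exact: cp_dxs_sqr.
by move=> y; exact: sqr_ge0.
Qed.

(** Poincare in the direction of the outermost derivative. It starts at order 1 because h itself may
    have a nonzero mean. *)
Lemma energy_mono k s : energy k.+1 s <= energy k.+2 s.
Proof.
apply: (le_trans _ (sum_words_diag (F := fun a => Avg (fun x => dxs a h (s, x) ^+ 2)) k _)).
  rewrite /energy /=; apply: ler_sum => i _; apply: sum_words_le => a _ /=.
  have sa := smooth_dxs a sh; have pa := periodicx_dxs a ph.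
  have p1 : periodicx (dx i (dxs a h)) by exact: (periodicx_dxs (i :: a) ph).
  have p2 : periodicx (dx i (dx i (dxs a h))) by exact: (periodicx_dxs (i :: i :: a) ph).
  apply: (Avg_poincare (cp_slice_smooth s sa pa) (cp_slice_smooth s (smooth_dx i sa) p1)
    (cp_slice_smooth s (smooth_dx i (smooth_dx i sa)) p2)) => y.
    exact: slice_derive.
  by apply: slice_derive; exact: smooth_dx.
move=> a; apply: Avg_ge0; first exact: cp_dxs_sqr.
by move=> y; exact: sqr_ge0.
Qed.

Lemma energy_le k l s : (0 < k)%N -> (k <= l)%N -> energy k s <= energy l s.
Proof.
move=> k0 kl; rewrite -(subnKC kl); elim: (l - k)%N => [|m IH]; first by rewrite addn0.
rewrite (le_trans IH) // addnS; case: k k0 {kl IH} => [//|k _].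
by rewrite addSn; exact: energy_mono.
Qed.

Lemma dx_time (u : V -> R) i : smooth u ->
  dx i (fun p => expR p.1 * u p) = (fun p => expR p.1 * dx i u p).
Proof.
move=> su; apply: dxE => p.
have D : is_derive p ((0, delta_mx 0 i) : V) (fun q : V => expR q.1) (expR p.1 * 0).
  exact: (is_derive_comp1 (is_derive_coord st_coordinates None p (0, delta_mx 0 i))
    (is_derive_expR p.1)).
have := is_derive_mul D (is_derive_dx i p su).
by rewrite mulr0 mul0r addr0.
Qed.

Lemma dxs_time (u : V -> R) a : smooth u ->
  dxs a (fun p => expR p.1 * u p) = (fun p => expR p.1 * dxs a u p).
Proof. by move=> su; elim: a => [//|i a IH] /=; rewrite IH (dx_time i (smooth_dxs a su)). Qed.

Lemma dxs_sum a (I : Type) (r : seq I) (F : I -> V -> R) : (forall k, smooth (F k)) ->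
  dxs a (fun p => \sum_(k <- r) F k p) = (fun p => \sum_(k <- r) dxs a (F k) p).
Proof.
move=> sF; elim: a => [//|i a IH] /=; rewrite IH dx_sum; first by [].
by move=> k _; apply: smooth_dxs; exact: sF.
Qed.

(** Two integrations by parts move the double divergence in the flow from D^a G onto D^a h. *)
Lemma energy_derive k (s : R) : is_derive s (1 : R) (energy k)
  (2 * expR s * sum_words k (fun a => \sum_i \sum_j
     Avg (fun x => dxs a (H i j) (s, x) * dxs a (fun q => G q i j) (s, x)))).
Proof.
rewrite -sum_wordsZ; apply: is_derive_sum_words => a.
have sf := smooth_dxs a sh; have pf := periodicx_dxs a ph.
set f := dxs a h in sf pf *.
pose g i j := dxs a (fun q => G q i j).
have sg i j : smooth (g i j) by apply: smooth_dxs; exact: sG.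
have pg i j : periodicx (g i j) by apply: periodicx_dxs; exact: pG.
have pdx (i : 'I_n) (u : V -> R) : periodicx u -> periodicx (dx i u).
  by move=> pu; exact: (periodicx_dxs [:: i] pu).
have sgg i j : smooth (dx j (dx i (g i j))) by exact: (smooth_dx j (smooth_dx i (sg i j))).
have pgg i j : periodicx (dx j (dx i (g i j))) by exact: (pdx j _ (pdx i _ (pg i j))).
have sff : smooth (fun p => f p * f p) by exact: smoothM.
have pff : periodicx (fun p => f p * f p) by move=> r m x; rewrite pf.
have dtf p : dt f p = expR p.1 * \sum_i \sum_j dx j (dx i (g i j)) p.
  have sGG i j : smooth (dx j (dx i (fun q => G q i j))).
    exact: (smooth_dx j (smooth_dx i (sG i j))).
  have sF i : smooth (fun p => \sum_j dx j (dx i (fun q => G q i j)) p).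
    by apply: smooth_sum => j _; exact: sGG.
  rewrite /f -(dxs_dt a sh) flow dxs_time; last by apply: smooth_sum => i _; exact: sF.
  congr (_ * _); rewrite /flow_rhs (dxs_sum a _ sF); apply: eq_bigr => i _.
  rewrite (dxs_sum a _ (sGG i)); apply: eq_bigr => j _.
  by rewrite (dxs_dx a j (smooth_dx i (sG i j))) (dxs_dx a i (sG i j)).
have := Avg_time_derive s sff pff.
have -> : (fun r => Avg (fun x => f (r, x) * f (r, x))) =
    (fun r => Avg (fun x => f (r, x) ^+ 2)) by [].
suff -> : Avg (fun x => dt (fun p => f p * f p) (s, x)) = 2 * expR s * \sum_i \sum_j
     Avg (fun x => dxs a (H i j) (s, x) * g i j (s, x)) by [].
have -> : (fun x => dt (fun p => f p * f p) (s, x)) = (fun x => 2 * expR s *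
    \sum_i \sum_j f (s, x) * dx j (dx i (g i j)) (s, x)).
  apply/funext => x.
  have D := smooth_is_derive (s, x) ((1, 0) : V) sf.
  have [_] := is_derive_mul D D; rewrite -/(dt _ _) => ->; rewrite -/(dt f _) dtf /=.
  have -> : \sum_i \sum_j f (s, x) * dx j (dx i (g i j)) (s, x) =
      f (s, x) * \sum_i \sum_j dx j (dx i (g i j)) (s, x).
    by rewrite mulr_sumr; apply: eq_bigr => i _; rewrite mulr_sumr.
  by ring.
have cf := cp_slice_smooth s sf pf.
have c1 i j := cpM cf (cp_slice_smooth s (sgg i j) (pgg i j)).
rewrite AvgZ; last by apply: cp_sum => i _; apply: cp_sum => j _; exact: c1.
congr (_ * _); rewrite Avg_sum; last by move=> i; apply: cp_sum => j _; exact: c1.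
apply: eq_bigr => i _; rewrite Avg_sum; last by move=> j; exact: c1.
apply: eq_bigr => j _.
rewrite (Avg_parts j s sf pf (smooth_dx i (sg i j)) (pdx i _ (pg i j))).
rewrite (Avg_parts i s (smooth_dx j sf) (pdx j _ pf) (sg i j) (pg i j)) opprK.
congr Avg; apply/funext => x.
by rewrite /f (dxs_dx a i (smooth_dx j sh)) (dxs_dx a j sh).
Qed.

Definition remainder_norm (k : nat) (s : R) : R := sum_words k (fun a =>
  \sum_i \sum_j Avg (fun x => remainder a i j (s, x) ^+ 2)).

(** Write D^a G = r - G A G with A = D^a H. Ellipticity gives - L^-2 |A|^2, and half of it pays for
    A . r <= (L^-2 |A|^2 + L^2 |r|^2) / 2. *)
Lemma energy_derive_le k s : sum_words k (fun a => \sum_i \sum_j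
     Avg (fun x => dxs a (H i j) (s, x) * dxs a (fun q => G q i j) (s, x))) <=
  2^-1 * (- L ^- 2 * Hnorm k s + L ^+ 2 * remainder_norm k s).
Proof.
have Lp : 0 < L by exact: lt_le_trans ltr01 L1.
rewrite /Hnorm /remainder_norm -!sum_wordsZ -sum_wordsD -sum_wordsZ.
apply: sum_words_le => a _.
pose A x := \matrix_(i, j) dxs a (H i j) (s, x) : 'M[R]_n.
have AE x i j : A x i j = dxs a (H i j) (s, x) by rewrite mxE.
have cA i j : cont_periodic (fun x => dxs a (H i j) (s, x)).
  exact: (cp_slice_smooth s (smooth_dxs a (sH i j)) (periodicx_dxs a (pH i j))).
have cg i j : cont_periodic (fun x => dxs a (fun q => G q i j) (s, x)).
  exact: (cp_slice_smooth s (smooth_dxs a (sG i j)) (periodicx_dxs a (pG i j))).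
have cr i j : cont_periodic (fun x => remainder a i j (s, x)).
  have c1 c d : cont_periodic (fun x => G (s, x) c d).
    exact: (cp_slice_smooth s (sG c d) (pG c d)).
  apply: cpD; first exact: cg.
  by apply: cp_sum => c _; apply: cp_sum => d _; exact: (cpM (cpM (c1 _ _) (cA _ _)) (c1 _ _)).
have cs (F : 'I_n -> 'I_n -> S -> R) : (forall i j, cont_periodic (F i j)) ->
    cont_periodic (fun x => \sum_i \sum_j F i j x).
  by move=> cF; apply: cp_sum => i _; apply: cp_sum => j _; exact: cF.
have As (F : 'I_n -> 'I_n -> S -> R) : (forall i j, cont_periodic (F i j)) ->
    \sum_i \sum_j Avg (F i j) = Avg (fun x => \sum_i \sum_j F i j x).
  move=> cF; rewrite Avg_sum; last by move=> i; apply: cp_sum => j _; exact: cF.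
  apply: eq_bigr => i _; rewrite Avg_sum; first by [].
  by move=> j; exact: cF.
have cAg i j := cpM (cA i j) (cg i j).
have cAA i j : cont_periodic (fun x => dxs a (H i j) (s, x) ^+ 2) := cpM (cA i j) (cA i j).
have crr i j : cont_periodic (fun x => remainder a i j (s, x) ^+ 2) := cpM (cr i j) (cr i j).
rewrite (As _ cAg) (As _ cAA) (As _ crr) -(AvgZ _ (cs _ cAA)) -(AvgZ _ (cs _ crr)).
have cD := cpD (cpZ (- L ^- 2) (cs _ cAA)) (cpZ (L ^+ 2) (cs _ crr)).
rewrite -(AvgD (cpZ _ (cs _ cAA)) (cpZ _ (cs _ crr))) -(AvgZ _ cD).
apply: (Avg_le (cs _ cAg) (cpZ _ cD)) => x.
have symA : (A x)^T = A x.
  by apply/matrixP => i j; rewrite mxE !AE (dx_comm j i sh).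
have Gl w : L^-1 * dot w w <= quad (G (s, x)) w by rewrite ler_pdivrMl.
have Lp' : 0 < L^-1 by rewrite invr_gt0.
have := trace_lower_bound Lp' symA (symG (s, x)) Gl.
set Q := (G (s, x) *m A x *m G (s, x)); rewrite exprVn => hQ.
pose g i j := dxs a (fun q => G q i j) (s, x); pose r i j := remainder a i j (s, x).
have rE i j : r i j = g i j + Q i j.
  rewrite /r /remainder /Q mulmx3E; congr (_ + _).
  by apply: eq_bigr => c _; apply: eq_bigr => d _; rewrite AE.
have key i j : A x i j * g i j <=
    2^-1 * (L ^- 2 * A x i j ^+ 2 + L ^+ 2 * r i j ^+ 2) - A x i j * Q i j.
  have -> : g i j = r i j - Q i j by rewrite rE addrK.
  move: (A x i j) (r i j) (Q i j) => u v w.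
  have := sqr_ge0 (L^-1 * u - L * v); have : L^-1 * L = 1 by rewrite mulVf // gt_eqF.
  rewrite -exprVn; move: (L^-1) => m mL.
  have -> : (m * u - L * v) ^+ 2 = m ^+ 2 * u ^+ 2 - 2 * (m * L) * (u * v) + L ^+ 2 * v ^+ 2.
    by ring.
  rewrite mL mulrBr; move: (m ^+ 2 * u ^+ 2) (L ^+ 2 * v ^+ 2) (u * v) (u * w) => ? ? ? ?; lra.
have -> : \sum_i \sum_j dxs a (H i j) (s, x) * dxs a (fun q => G q i j) (s, x) =
    \sum_i \sum_j A x i j * g i j.
  by apply: eq_bigr => i _; apply: eq_bigr => j _; rewrite AE.
have -> : \sum_i \sum_j dxs a (H i j) (s, x) ^+ 2 = \sum_i \sum_j A x i j ^+ 2.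
  by apply: eq_bigr => i _; apply: eq_bigr => j _; rewrite AE.
rewrite -/(\sum_i \sum_j r i j ^+ 2).
apply: (@le_trans _ _ (\sum_i \sum_j
    (2^-1 * (L ^- 2 * A x i j ^+ 2 + L ^+ 2 * r i j ^+ 2) - A x i j * Q i j))).
  by apply: ler_sum => i _; apply: ler_sum => j _; exact: key.
have -> : \sum_i \sum_j
    (2^-1 * (L ^- 2 * A x i j ^+ 2 + L ^+ 2 * r i j ^+ 2) - A x i j * Q i j) =
    2^-1 * (L ^- 2 * (\sum_i \sum_j A x i j ^+ 2) + L ^+ 2 * (\sum_i \sum_j r i j ^+ 2))
    - \sum_i \sum_j A x i j * Q i j.
  rewrite !mulr_sumr -big_split /= mulr_sumr -sumrB; apply: eq_bigr => i _.
  by rewrite !mulr_sumr -big_split /= mulr_sumr -sumrB.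
move: hQ; set X := L ^- 2 * _; set Y := L ^+ 2 * _; set Z := \sum_i _.
rewrite mulNr -/X; lra.
Qed.

Lemma energy_derive_le1 (s : R) :
  2 * expR s * (2^-1 * (- L ^- 2 * Hnorm 1 s + L ^+ 2 * remainder_norm 1 s)) =
  - (expR s * (L ^- 2 * energy 3 s)).
Proof.
have -> : remainder_norm 1 s = 0.
  rewrite /remainder_norm /= big1 // => l _; rewrite big1 // => i _; rewrite big1 // => j _.
  rewrite (_ : (fun x => _) = fun=> 0) ?Avg_cst //; apply/funext => x.
  by rewrite (remainder1 dG) expr0n.
by rewrite mulr0 addr0 Hnorm_energy; move: (L ^- 2) => c; field.
Qed.

Lemma expR_ge1 (s : R) : 0 <= s -> 1 <= expR s.
Proof. by move=> s0; apply: le_trans (expR_ge1Dx s); rewrite lerDl. Qed.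

Lemma energy1_tends0 : tends0 (energy 1).
Proof.
have Lp : 0 < L by exact: lt_le_trans ltr01 L1.
have c0 : 0 < L ^- 2 by rewrite invr_gt0 exprn_gt0.
apply: (decay c0 (energy_derive 1) (energy_ge0 1) (s0 := 0)) => s s0.
apply: (@le_trans _ _ (2 * expR s *
    (2^-1 * (- L ^- 2 * Hnorm 1 s + L ^+ 2 * remainder_norm 1 s)))).
  by apply: ler_wpM2l (energy_derive_le 1 s); rewrite mulr_ge0 // expR_ge0.
rewrite energy_derive_le1 mulNr lerN2.
apply: (@le_trans _ _ (L ^- 2 * energy 3 s)).
  by rewrite ler_pM2l //; apply: energy_le.
by apply: ler_peMl; [rewrite mulr_ge0 ?energy_ge0 // ltW|exact: expR_ge1].
Qed.

Lemma energy3_bounded : exists2 B, 0 <= B & forall s, energy 3 s <= B.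
Proof.
exists (sum_words 3 (fun _ : seq 'I_n => L ^+ 2)).
  by apply: sum_words_ge0 => a _; exact: sqr_ge0.
move=> s; apply: sum_words_le => a a3.
rewrite -(Avg_cst (n := n) (L ^+ 2)); apply: Avg_le; first exact: cp_dxs_sqr.
  exact: cp_cst.
case: a a3 => [//|l [//|i [//|j [|//]]]] _ y /=.
rewrite -real_normK ?num_real //.
by apply: lerXn2r; rewrite ?nnegrE //; exact: H_lip.
Qed.

(** Interpolation between orders 1 and 3: the square of h_ij integrates to - h_iij h_j, which Young
    splits with weight d. The factor n counts the free direction i. *)
Lemma energy2_le (d s : R) : 0 < d ->
  energy 2 s <= 2^-1 * (n%:R * (d^-1 * energy 1 s) + d * energy 3 s).
Proof.
move=> d0.
have cf a := cp_slice_smooth s (smooth_dxs a sh) (periodicx_dxs a ph).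
have c2 a : cont_periodic (fun x => dxs a h (s, x) ^+ 2) by exact: cp_dxs_sqr.
have key i j : Avg (fun x => dxs [:: i; j] h (s, x) ^+ 2) <= 2^-1 *
   (d^-1 * Avg (fun x => dxs [:: j] h (s, x) ^+ 2) +
    d * Avg (fun x => dxs [:: i; i; j] h (s, x) ^+ 2)).
  have E : Avg (fun x => dxs [:: i; j] h (s, x) ^+ 2) =
      - Avg (fun x => dxs [:: i; i; j] h (s, x) * dxs [:: j] h (s, x)).
    exact: (Avg_parts i s (smooth_dxs [:: i; j] sh) (periodicx_dxs [:: i; j] ph)
      (smooth_dxs [:: j] sh) (periodicx_dxs [:: j] ph)).
  have cc := cpM (cf [:: i; i; j]) (cf [:: j]).
  have cD := cpD (cpZ d^-1 (c2 [:: j])) (cpZ d (c2 [:: i; i; j])).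
  have -> : 2^-1 * (d^-1 * Avg (fun x => dxs [:: j] h (s, x) ^+ 2) +
      d * Avg (fun x => dxs [:: i; i; j] h (s, x) ^+ 2)) =
      Avg (fun x => 2^-1 * (d^-1 * dxs [:: j] h (s, x) ^+ 2 +
                            d * dxs [:: i; i; j] h (s, x) ^+ 2)).
    apply: esym; apply: (etrans (AvgZ 2^-1 cD)); congr (_ * _).
    apply: (etrans (AvgD (cpZ d^-1 (c2 [:: j])) (cpZ d (c2 [:: i; i; j])))); congr (_ + _).
      exact: (AvgZ d^-1 (c2 [:: j])).
    exact: (AvgZ d (c2 [:: i; i; j])).
  rewrite [leLHS]E -[leLHS](AvgN cc).
  apply: (Avg_le (cpN cc) (cpZ _ cD)) => y.
  move: (dxs [:: i; i; j] h (s, y)) (dxs [:: j] h (s, y)) => u v.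
  have : 0 <= d * (u + d^-1 * v) ^+ 2 by rewrite mulr_ge0 ?sqr_ge0 // ltW.
  have -> : d * (u + d^-1 * v) ^+ 2 = d * u ^+ 2 + 2 * (d * d^-1) * (u * v) +
      d * d^-1 * (d^-1 * v ^+ 2) by ring.
  rewrite divff ?gt_eqF //; move: (d * u ^+ 2) (d^-1 * v ^+ 2) (u * v) => ? ? ?; lra.
apply: (@le_trans _ _ (\sum_i \sum_j (2^-1 *
   (d^-1 * Avg (fun x => dxs [:: j] h (s, x) ^+ 2) +
    d * Avg (fun x => dxs [:: i; i; j] h (s, x) ^+ 2))))).
  by apply: ler_sum => i _; apply: ler_sum => j _; exact: key.
under eq_bigr do rewrite -mulr_sumr big_split /= -!mulr_sumr.
rewrite -mulr_sumr ler_pM2l ?invr_gt0 // big_split /= sumr_const card_ord mulr_natl.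
apply: lerD; first by [].
rewrite -mulr_sumr ler_pM2l //.
apply: (@sum_words_diag R 'I_n 1 (fun a => Avg (fun x => dxs a h (s, x) ^+ 2))) => b.
by apply: Avg_ge0 => // y; exact: sqr_ge0.
Qed.

Lemma energy2_tends0 : tends0 (energy 2).
Proof.
have [B B0 HB] := energy3_bounded.
move=> eps eps0; pose d := eps / (B + 1).
have d0 : 0 < d by rewrite divr_gt0 // ltr_wpDl.
have n0 : 0 < n%:R * d^-1 + 1 by rewrite ltr_wpDl // mulr_ge0 // invr_ge0 ltW.
have [s0 H0] := energy1_tends0 (divr_gt0 eps0 n0).
exists s0 => s /H0; rewrite ler_pdivlMr // => h1.
apply: (le_trans (energy2_le s d0)).
have h2 : d * energy 3 s <= eps.
  rewrite /d -mulrA ler_piMr //; first exact: ltW.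
  by rewrite ler_pdivrMl ?ltr_wpDl // mulr1 (le_trans (HB s)) // lerDl.
have h3 := energy_ge0 1 s.
have -> : n%:R * (d^-1 * energy 1 s) = energy 1 s * (n%:R * d^-1 + 1) - energy 1 s by ring.
lra.
Qed.

Lemma H_tends0 i j eps : 0 < eps ->
  exists s0, forall s, s0 <= s -> forall x, `|H i j (s, x)| <= eps.
Proof.
(* The Lipschitz constant of the square of an entry of H: L for the difference times 2 L for the
   sum. *)
move=> eps0; have K0 : 0 <= 2 * L * L by rewrite !mulr_ge0.
have e2 : 0 < eps ^+ 2 by rewrite exprn_gt0.
have [eta eta0 Heta] := Avg_lipschitz (n := n) K0 e2.
have [s0 Hs0] := energy2_tends0 eta0.
exists s0 => s hs x.
have cH := cp_slice_smooth s (sH i j) (pH i j).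
have lip l (y : S) (r : R) : `|H i j (s, y + r *: delta_mx 0 l) ^+ 2 - H i j (s, y) ^+ 2| <=
    2 * L * L * `|r|.
  have D := line_dx l s y _ (sH i j).
  have [c _] := MVT_any 0 r D; rewrite scale0r addr0 subr0 => E.
  rewrite subr_sqr normrM E normrM (_ : 2 * L * L * `|r| = L * `|r| * (2 * L)); last by ring.
  apply: ler_pM => //.
    by rewrite ler_wpM2r.
  by rewrite (le_trans (ler_normD _ _)) // mulr_natl mulr2n lerD.
have := Heta (fun x => H i j (s, x) ^+ 2) (cpM cH cH) (fun x => sqr_ge0 _) lip.
have hA : Avg (fun x => H i j (s, x) ^+ 2) <= eta.
  apply: le_trans (Hs0 s hs).
  apply: (ler_term2 (F := fun i j => Avg (fun x => H i j (s, x) ^+ 2))) => k l.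
  by apply: Avg_ge0; [exact: (cp_dxs_sqr [:: k; l] s sh ph)|move=> y; exact: sqr_ge0].
move=> /(_ hA x) hx; rewrite -(@ler_pXn2r _ 2) ?nnegrE ?(ltW eps0) //.
by rewrite real_normK ?num_real.
Qed.

Lemma H_small (eps : R) : 0 < eps ->
  exists s0, forall s, s0 <= s -> forall x i j, `|H i j (s, x)| <= eps.
Proof.
move=> eps0; pose f i j := projT1 (cid (H_tends0 i j eps0)).
exists (\sum_i \sum_j `|f i j|) => s hs x i j.
have fs : f i j <= s.
  apply: le_trans (ler_norm _) _; apply: le_trans hs.
  by apply: (ler_term2 (F := fun i j => `|f i j|)).
by move: fs; rewrite /f; case: (cid _) => s0 /= Hs0 /Hs0; exact.
Qed.

Lemma remainder_norm_le k : exists2 C, 0 <= C & forall s M,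
  0 < M -> M <= 1 -> (forall x i j, `|H i j (s, x)| <= M) ->
  remainder_norm k.+1 s <= C * (M ^+ 2 * Hnorm k.+1 s).
Proof.
(* The time and the bound M form one parameter t, so the constant obtained by summing over words and
   indices depends on neither. *)
pose Q (t : R * R) := [/\ 0 < t.2, t.2 <= 1 & forall x i j, `|H i j (t.1, x)| <= t.2].
pose X (t : R * R) := t.2 ^+ 2 * Hnorm k.+1 t.1.
have [C C0 HC] : exists2 C, 0 <= C & forall t, Q t -> sum_words k.+1 (fun a =>
    \sum_i \sum_j Avg (fun x => remainder a i j (t.1, x) ^+ 2)) <= C * X t.
  apply: (@bounded_sum_words _ _ _ Q X k.+1 (fun a t =>
    \sum_i \sum_j Avg (fun x => remainder a i j (t.1, x) ^+ 2))) => -[//|l a] [ak].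
  apply: (bounded_sum (F := fun i t => \sum_j _)) => i.
  apply: (bounded_sum (F := fun j t => Avg _)) => j.
  have P := DPoly_remainder sG sh dG l a i j; rewrite ak in P.
  have [C C0 HC] := DPoly_Avg sG pG sh ph L1 G_upper P.
  exists C => // -[s M] [/= M0 M1 HM].
  by rewrite /X mulrA; exact: HC.
by exists C => // s M M0 M1 HM; exact: (HC (s, M)).
Qed.

Lemma energy_tends0 k : tends0 (energy k.+1).
Proof.
have Lp : 0 < L by exact: lt_le_trans ltr01 L1.
have [C C0 HC] := remainder_norm_le k.
(* Half of the dissipation rate: the other half absorbs the remainder. *)
pose c := 2^-1 * L ^- 2.
have c0 : 0 < c by rewrite mulr_gt0 // invr_gt0 exprn_gt0.
(* As M <= 1, M^2 <= M, so this choice yields L^2 C M^2 <= c. *)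
pose M := Num.min 1 (c / (L ^+ 2 * C + 1)).
have LC0 : 0 < L ^+ 2 * C + 1 by rewrite ltr_wpDl // mulr_ge0 // sqr_ge0.
have M0 : 0 < M by rewrite lt_min ltr01 divr_gt0.
have M1 : M <= 1 by rewrite ge_min lexx.
have MC : L ^+ 2 * (C * M ^+ 2) <= c.
  have h1 : M ^+ 2 <= M by rewrite expr2 ler_piMr // ltW.
  have h2 : M * (L ^+ 2 * C + 1) <= c by rewrite -ler_pdivlMr // ge_min lexx orbT.
  have h3 : 0 <= L ^+ 2 * C by rewrite mulr_ge0 // sqr_ge0.
  rewrite mulrA; move: (L ^+ 2 * C) h2 h3 => u h2 h3.
  have h4 := ler_wpM2l h3 h1; lra.
have [s1 Hs1] := H_small M0.
apply: (decay c0 (energy_derive k.+1) (energy_ge0 k.+1) (s0 := Num.max 0 s1)) => s.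
rewrite ge_max => /andP[s0 /Hs1 HM].
apply: (@le_trans _ _ (2 * expR s *
    (2^-1 * (- L ^- 2 * Hnorm k.+1 s + L ^+ 2 * remainder_norm k.+1 s)))).
  by apply: ler_wpM2l (energy_derive_le k.+1 s); rewrite mulr_ge0 // expR_ge0.
have hR := HC s M M0 M1 HM.
have H0 : 0 <= Hnorm k.+1 s by rewrite Hnorm_energy energy_ge0.
have h1 : - L ^- 2 * Hnorm k.+1 s + L ^+ 2 * remainder_norm k.+1 s <= - c * Hnorm k.+1 s.
  have h2 := ler_wpM2l (sqr_ge0 L) hR.
  have h3 : L ^+ 2 * (C * (M ^+ 2 * Hnorm k.+1 s)) <= c * Hnorm k.+1 s.
    by have := ler_wpM2r H0 MC; rewrite !mulrA.
  have Lc : L ^- 2 = 2 * c by rewrite /c mulrA divff ?mul1r.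
  move: (le_trans h2 h3) Lc; move: (L ^+ 2 * _) (L ^- 2) (Hnorm _ _) (c) => u l N d h4 ->.
  rewrite !mulNr -mulrA; move: (d * N) h4 => v h4; lra.
have h2 : energy k.+1 s <= Hnorm k.+1 s.
  by rewrite Hnorm_energy; exact: energy_le (leqW (leqnSn _)).
have e1 : 1 <= expR s by exact: expR_ge1.
have h3 : 2 * expR s * (2^-1 * (- L ^- 2 * Hnorm k.+1 s + L ^+ 2 * remainder_norm k.+1 s)) <=
   expR s * (- c * Hnorm k.+1 s).
  have -> : forall z, 2 * expR s * (2^-1 * z) = expR s * z by move=> z; field.
  by apply: ler_wpM2l h1; exact: expR_ge0.
apply: (le_trans h3); rewrite mulNr mulrN mulNr lerN2.
apply: (@le_trans _ _ (c * Hnorm k.+1 s)); first by rewrite ler_pM2l.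
by apply: ler_peMl => //; rewrite mulr_ge0 // ltW.
Qed.

End EnergyDecay.

(** * Uniform decay of all derivatives *)

Section UniformDecay.
Context {R : realType} {n : nat}.
Notation S := 'rV[R]_n.
Notation V := (R * 'rV[R]_n)%type.
Variables (G : V -> 'M[R]_n) (h : V -> R).
Hypothesis sG : forall i j, smooth (fun p => G p i j).
Hypothesis pG : forall i j, periodicx (fun p => G p i j).
Hypothesis symG : forall p, (G p)^T = G p.
Hypothesis sh : smooth h.
Hypothesis ph : periodicx h.
Local Notation H a b := (dx a (dx b h)).
Hypothesis dG : forall l i j, dx l (fun p => G p i j) =
  (fun p => - \sum_a \sum_b G p i a * dx l (H a b) p * G p b j).
Variable L : R.
Hypothesis L1 : 1 <= L.
Hypothesis G_lower : forall p w, dot w w <= L * quad (G p) w.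
Hypothesis G_upper : forall p i j, `|G p i j| <= L.
Hypothesis flow : dt h = (fun p => expR p.1 * flow_rhs G p).
Hypothesis H_bounded : forall p i j, `|H i j p| <= L.
Hypothesis H_lip : forall p l i j, `|dx l (H i j) p| <= L.
Local Notation Hnorm := (Hnorm h).
Local Notation DPoly := (DPoly G h).
Local Notation remainder := (remainder G h).

Let sH a b : smooth (H a b).
Proof. by apply: smooth_dx; exact: smooth_dx. Qed.

Let pH a b : periodicx (H a b).
Proof. exact: (periodicx_dxs [:: a; b] ph). Qed.

Let L0 : 0 <= L.
Proof. exact: le_trans ler01 L1. Qed.
Local Notation energy := (energy h).

Lemma avg1_scale_sum (I : Type) (r : seq I) (c : R) (F : I -> S -> R) i x :
  (forall k, cont_periodic (F k)) ->
  avg1 i (fun y => c * \sum_(k <- r) F k y) x = c * \sum_(k <- r) avg1 i (F k) x.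
Proof.
move=> cF; rewrite (avg1Z _ _ (cp_sum r (P := xpredT) (fun k _ => cF k))); congr (_ * _).
elim: r => [|k r IH].
  rewrite big_nil (_ : (fun y => _) = fun=> 0) ?avg1_cst //.
  by apply/funext => y; rewrite big_nil.
rewrite big_cons (_ : (fun y => _) = fun y => F k y + \sum_(l <- r) F l y); last first.
  by apply/funext => y; rewrite big_cons.
by rewrite (avg1D _ (cF k) (cp_sum r (P := xpredT) (fun k _ => cF k))) IH.
Qed.

(** The mixed derivatives produced when [sqr_le_avg1] is applied once per entry of the list. A new
    direction goes to the end of the word because it acts on f first. *)
Fixpoint sublists (l : seq 'I_n) : seq (seq 'I_n) :=
  if l is i :: l' then sublists l' ++ [seq a ++ [:: i] | a <- sublists l'] else [:: [::]].

Lemma size_sublists l a : a \in sublists l -> (size a <= size l)%N.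
Proof.
elim: l a => [|i l IH] a; first by rewrite inE => /eqP ->.
rewrite mem_cat => /orP[/IH al|/mapP[b /IH bl ->]]; first exact: leqW.
by rewrite size_cat addn1 ltnS.
Qed.

(** Each direction contributes f^2 <= 2 (mean of f^2 + mean of f_i^2) on its line, and the induction
    hypothesis is averaged over that line. With all directions listed this bounds the sup norm by
    L^2 norms. *)
Lemma sobolev l (f : V -> R) s x : smooth f -> periodicx f ->
  f (s, x) ^+ 2 <= 2 ^+ size l *
    \sum_(a <- sublists l) avg l (fun y => dxs a f (s, y) ^+ 2) x.
Proof.
elim: l f x => [|i l IH] f x sf pf; first by rewrite mul1r big_seq1.
have pf' : periodicx (dx i f) by exact: (periodicx_dxs [:: i] pf).
have sf' := smooth_dx i sf.
have cf := cp_slice_smooth s sf pf; have cf' := cp_slice_smooth s sf' pf'.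
have csq (u : V -> R) a : smooth u -> periodicx u ->
    cont_periodic (avg l (fun y => dxs a u (s, y) ^+ 2)).
  by move=> su pu; apply: cp_avg; exact: cp_dxs_sqr.
have key (u : V -> R) : smooth u -> periodicx u -> avg1 i (fun y => u (s, y) ^+ 2) x <=
    2 ^+ size l * \sum_(a <- sublists l) avg (i :: l) (fun y => dxs a u (s, y) ^+ 2) x.
  move=> su pu; rewrite -(avg1_scale_sum _ _ _ _ (fun a => csq u a su pu)).
  apply: avg1_le; first exact: (cp_dxs_sqr [::] s su pu).
    by apply: cpZ; apply: cp_sum => a _; exact: csq.
  by move=> y; exact: IH.
have h0 := sqr_le_avg1 (i := i) x cf cf' (fun y => slice_derive s y i sf).
have h1 := key f sf pf; have h2 := key (dx i f) sf' pf'.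
have h3 : 0 <= avg1 i (fun y => dx i f (s, y) ^+ 2) x.
  rewrite -[leLHS](congr1 (fun u => u x) (avg1_cst i 0)).
  apply: (avg1_le _ _ (cp_cst 0) (cp_dxs_sqr [::] s sf' pf')) => y.
  exact: sqr_ge0.
rewrite [sublists _]/= big_cat big_map -[size _]/((size l).+1) (exprS 2) -mulrA.
rewrite [X in _ <= 2 * X]mulrDr.
have -> : \sum_(a <- sublists l) avg (i :: l) (fun y => dxs (a ++ [:: i]) f (s, y) ^+ 2) x =
    \sum_(a <- sublists l) avg (i :: l) (fun y => dxs a (dx i f) (s, y) ^+ 2) x.
  by apply: eq_bigr => a _; rewrite dxs_cat.
apply: (le_trans h0); move: h1 h2 h3.
set u := avg1 i _ x; set v := avg1 i _ x; set y := 2 ^+ _ * _; set z := 2 ^+ _ * _.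
by move=> h1 h2 h3; lra.
Qed.

Lemma dxs_small k (eps : R) : 0 < eps -> exists s0, forall s, s0 <= s ->
  forall x a i j, (size a <= k)%N -> `|dxs a (H i j) (s, x)| <= eps.
Proof.
move=> eps0; pose l := enum 'I_n; pose C : R := 2 ^+ size l * (size (sublists l))%:R + 1.
have C0 : 0 < C by rewrite ltr_wpDl // mulr_ge0 // exprn_ge0.
have e2 : 0 < eps ^+ 2 / C by rewrite divr_gt0 // exprn_gt0.
(* The top order is |l| + k + 2: at most |l| derivatives from Sobolev, k from the word [a], and two
   inside H. Energies increase with the order, so this one controls all. *)
have [s0 Hs0] := energy_tends0 sG pG symG sh ph dG L1 G_lower G_upper flow H_bounded H_lip
  (size l + k).+1 e2.
exists s0 => s /Hs0; rewrite ler_pdivlMr // => hE x a i j ak.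
rewrite -(@ler_pXn2r _ 2) ?nnegrE ?(ltW eps0) // real_normK ?num_real //.
apply: (le_trans (sobolev l s x (smooth_dxs a (sH i j)) (periodicx_dxs a (pH i j)))).
have cE b : avg l (fun y => dxs b (dxs a (H i j)) (s, y) ^+ 2) x =
    Avg (fun y => dxs (b ++ a ++ [:: i; j]) h (s, y) ^+ 2).
  rewrite -(avg_const x); last exact: cp_dxs_sqr.
  by rewrite !dxs_cat.
apply: (@le_trans _ _ (2 ^+ size l *
    \sum_(b <- sublists l) energy (size l + k).+2 s)); last first.
  rewrite big_const_seq count_predT iter_addr_0 -(mulr_natr (energy _ s)); apply: le_trans hE.
  have := energy_ge0 sh ph (size l + k).+2 s.
  rewrite /C; move: (energy _ s) (2 ^+ size l) ((size (sublists l))%:R) => E q m E0.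
  by rewrite -subr_ge0 (_ : _ - _ = E) //; ring.
apply: ler_wpM2l; first exact: exprn_ge0.
rewrite !big_seq; apply: ler_sum => b /size_sublists bl; rewrite cE.
apply: (@le_trans _ _ (energy (size (b ++ a ++ [:: i; j])) s)).
  apply: (@sum_words_term R 'I_n _ (fun c => Avg (fun y => dxs c h (s, y) ^+ 2))) => c.
  by apply: Avg_ge0; [exact: cp_dxs_sqr|move=> y; exact: sqr_ge0].
apply: energy_le => //; rewrite !size_cat /= addn2 !addnS //.
by rewrite !ltnS leq_add.
Qed.

Lemma DPoly_small k p f (eps : R) : DPoly k p.+1 f -> 0 < eps ->
  exists s0, forall s, s0 <= s -> forall x, `|f (s, x)| <= eps.
Proof.
move=> Pf eps0; have [C C0 HC] := DPoly_le L1 G_upper Pf.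
have C1 : 0 < C + 1 by rewrite ltr_wpDl.
pose M := Num.min 1 (eps / (C + 1)).
have M0 : 0 < M by rewrite lt_min ltr01 divr_gt0.
have M1 : M <= 1 by rewrite ge_min lexx.
have MC : (C + 1) * M <= eps by rewrite mulrC -ler_pdivlMr // ge_min lexx orbT.
have [s0 Hs0] := dxs_small k M0; exists s0 => s hs x.
(* With all derivatives of H up to order k below M, the weight Z = 1 suffices and one factor H
   already makes f small. *)
have hq a i j : (size a <= k)%N -> `|dxs a (H i j) (s, x)| <= M * 1 ^+ size a.
  by move=> ak; rewrite expr1n mulr1; exact: Hs0.
apply: (le_trans (HC (s, x) M 1 (ltW M0) M1 ler01 hq)).
rewrite expr1n mulr1; apply: le_trans MC; apply: ler_pM => //; first exact: exprn_ge0 (ltW M0).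
  by rewrite lerDl.
by rewrite exprS ler_piMr ?exprn_ile1 // ltW.
Qed.

End UniformDecay.

(** * Return to the coordinates xi *)

Section MetricConvergence.
Context {R : realType} {n : nat}.
Notation S := 'rV[R]_n.
Notation V := (R * 'rV[R]_n)%type.
Variable psi : V -> R.
Hypothesis spsi : smooth psi.
Hypothesis ppsi : periodicx psi.
Hypothesis posV : forall p, posdef (Vmat psi p).
Variable K : R.
Hypothesis K0 : 0 <= K.
Hypothesis Rm_le : forall s x, Rm_norm (fun y => psi (s, y)) x <= K.
Local Notation G := (Gmat psi).
Local Notation h := (hpot psi).
Hypothesis flow : dt h = (fun p => expR p.1 * flow_rhs G p).
Local Notation H a b := (dx a (dx b h)).
Local Notation grad_kpot s := (grad (fun y => kpot psi (s, y))).

Let sG := smooth_Gmat spsi ppsi posV.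
Let pG := periodic_Gmat spsi ppsi posV.
Let sh := smooth_hpot spsi ppsi posV.

Lemma H_W a b p : H a b p = Wmat psi p a b - (b == a)%:R.
Proof. by rewrite (dx_dx_hpot spsi ppsi posV). Qed.

Lemma dH_W l a b : dx l (H a b) = dx l (fun q => Wmat psi q a b).
Proof.
have -> : H a b = (fun q => Wmat psi q a b + - (b == a)%:R).
  by apply/funext => q; rewrite H_W.
rewrite (dxD l (smooth_Wmat spsi ppsi posV a b) (smooth_cst (- (b == a)%:R))) dx_cst.
by apply/funext => q; rewrite addr0.
Qed.

Lemma dG_H l i j : dx l (fun p => G p i j) =
  (fun p => - \sum_a \sum_b G p i a * dx l (H a b) p * G p b j).
Proof.
apply/funext => p; rewrite (dx_G spsi ppsi posV) mulmx3E; congr (- _).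
by apply: eq_bigr => a _; apply: eq_bigr => b _; rewrite W3E dH_W.
Qed.

Lemma G_sub1 i j p : G p i j - (i == j)%:R = -1 * \sum_k G p i k * H k j p.
Proof.
have E : (G p *m Wmat psi p) i j = (i == j)%:R.
  have -> : G p *m Wmat psi p = 1%:M by apply: mulmxV; exact: unit_Vmat.
  by rewrite mxE.
have -> : \sum_k G p i k * H k j p = (i == j)%:R - G p i j.
  rewrite -E mxE.
  have -> : G p i j = \sum_k G p i k * (j == k)%:R.
    rewrite (bigD1 j) //= eqxx mulr1 big1 ?addr0 // => k /negPf kj.
    by rewrite eq_sym kj mulr0.
  by rewrite -sumrB; apply: eq_bigr => k _; rewrite H_W mulrBr.
by ring.
Qed.

(* The derivative in xi of f(s, grad v(xi)), as a function of (s, x). *)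
Definition xi_derive (w : S) (f : V -> R) (p : V) : R :=
  \sum_j (\sum_k w 0 k * G p k j) * dx j f p.

Lemma G_grad s xi i j : G (s, grad_kpot s xi) i j = Vmat psi (s, xi) i j.
Proof. by rewrite /Gmat /Theta /= (Xi_grad spsi ppsi posV). Qed.

Lemma derive_grad (f : V -> R) s w : smooth f ->
  'D_w (fun xi : S => f (s, grad_kpot s xi)) = (fun xi => xi_derive w f (s, grad_kpot s xi)).
Proof.
move=> sf; apply: derive_funE => xi.
have D0 : is_derive xi w (fun y : S => (s, grad_kpot s y).1) 0 by exact: is_derive_cst.
have D1 j : is_derive xi w (fun y : S => (s, grad_kpot s y).2 0 j)
    (\sum_k w 0 k * G (s, grad_kpot s xi) k j).
  have -> : (fun y : S => (s, grad_kpot s y).2 0 j) = (fun y => dx j (kpot psi) (s, y)).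
    by apply/funext => y; rewrite /= mxE partial_slice.
  have -> : \sum_k w 0 k * G (s, grad_kpot s xi) k j =
      \sum_k w 0 k * dx k (dx j (kpot psi)) (s, xi).
    by apply: eq_bigr => k _; rewrite G_grad Vmat_dx.
  have := is_derive_segment s xi w 0 (smooth_dx_pot spsi j).
  rewrite scale0r addr0 => /is_deriveP D; apply/is_deriveP => e /D[d d0 hd].
  exists d => // r r0 rd; have := hd r r0 rd.
  by rewrite add0r [r%:A]mulr1 scale0r addr0.
have := st_chain sf D0 D1.
by rewrite mul0r add0r.
Qed.

(** Passing to xi multiplies x-derivatives by entries of G, which cost neither derivatives nor
    factors H; at least p factors H survive. *)
Lemma DPoly_xi_derive k p w f : DPoly G h k p f -> DPoly G h k.+1 p (xi_derive w f).
Proof.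
move=> Pf; apply: DPoly_sum => j.
have := DPoly_mul (DPoly_sum (index_enum 'I_n) (fun k => DPoly_scale (w 0 k) (DPoly_G G h k j)))
  (DPoly_dx sG sh dG_H j Pf).
by [].
Qed.

Lemma metric_converges (c : 'I_n -> 'I_n -> R) (vs : seq S) (eps : R) : 0 < eps ->
  exists s0, forall s, s0 <= s -> forall xi,
  `|iter_derive vs (fun y => \sum_i \sum_j (Vmat psi (s, y) i j - (i == j)%:R) * c i j) xi|
    <= eps.
Proof.
pose f p := \sum_i \sum_j c i j * (G p i j - (i == j)%:R).
have Pf : DPoly G h 0 1 f.
  apply: DPoly_sum => i; apply: DPoly_sum => j; apply: DPoly_scale.
  have -> : (fun q => G q i j - (i == j)%:R) = (fun q => -1 * \sum_k G q i k * H k j q).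
    by apply/funext => q; exact: G_sub1.
  apply: DPoly_scale; apply: DPoly_sum => k.
  exact: (DPoly_mul (DPoly_G G h i k) (DPoly_H G h [::] k j)).
pose F := foldr xi_derive f vs.
have PF : DPoly G h (size vs) 1 F.
  by rewrite /F; elim: (vs) => [//|w ws IH] /=; exact: DPoly_xi_derive.
have FE s : iter_derive vs
    (fun y => \sum_i \sum_j (Vmat psi (s, y) i j - (i == j)%:R) * c i j) =
    (fun xi => F (s, grad_kpot s xi)).
  rewrite /F; elim: (vs) => [|w ws IH] /=.
    apply/funext => xi; apply: eq_bigr => i _; apply: eq_bigr => j _.
    by rewrite G_grad mulrC.
  rewrite IH; apply: derive_grad.
  have : DPoly G h (size ws) 1 (foldr xi_derive f ws).
    by elim: (ws) => [//|v vs' IH'] /=; exact: DPoly_xi_derive.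
  exact: (DPoly_smooth sG sh).
move=> eps0.
have [L L1 HL] := uniform_bounds spsi ppsi posV K0 Rm_le.
(* One more than [L], because H is W minus the identity. *)
have L2 : 1 <= L + 1 by lra.
have L3 : L <= L + 1 by lra.
have G_lower p w : dot w w <= (L + 1) * quad (G p) w.
  have [H1 _ _ _] := HL p; apply: (le_trans (H1 w)); rewrite ler_wpM2r //.
  have [->|w0] := eqVneq w 0; first by rewrite quad0.
  exact: ltW (quadG_gt0 posV p w0).
have G_upper p i j : `|G p i j| <= L + 1 by have [_ H1 _ _] := HL p; exact: le_trans (H1 i j) L3.
have H_bd p i j : `|H i j p| <= L + 1.
  have [_ _ H1 _] := HL p; rewrite H_W (le_trans (ler_normB _ _)) // lerD //.
  by case: (j == i); rewrite ?normr1 ?normr0.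
have H_lip p l i j : `|dx l (H i j) p| <= L + 1.
  by have [_ _ _ H1] := HL p; rewrite dH_W; exact: le_trans (H1 l i j) L3.
have [s0 Hs0] := DPoly_small sG pG (G_sym spsi) sh (periodic_hpot spsi ppsi posV) dG_H L2
  G_lower G_upper flow H_bd H_lip PF eps0.
by exists s0 => s hs xi; rewrite FE; exact: Hs0.
Qed.

End MetricConvergence.

(** * Logarithmic time *)

Section LogarithmicTime.
Context {R : realType} {n : nat}.
Notation S := 'rV[R]_n.
Notation V := (R * 'rV[R]_n)%type.

Definition exp_time (p : V) : V := (expR p.1, p.2).

Lemma is_derive_exp_time (F : V -> R) p (w : V) : smooth F ->
  is_derive p w (fun q => F (exp_time q))
    (w.1 * (exp_time p).1 * dt F (exp_time p) + \sum_j w.2 0 j * dx j F (exp_time p)).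
Proof.
move=> sF.
have D0 : is_derive p w (fun q => (exp_time q).1) (w.1 * expR p.1).
  have := is_derive_comp1 (is_derive_coord st_coordinates None p w) (is_derive_expR p.1).
  by rewrite mulrC.
exact: (st_chain sF D0 (fun j => is_derive_coord st_coordinates (Some j) p w)).
Qed.

Lemma cont_exp_time : continuous exp_time.
Proof.
move=> p; have h1 : (fun q : V => expR q.1) @ p --> expR p.1.
  by apply: (continuous_comp (f := fst) (g := expR)); [exact: cvg_fst|exact: continuous_expR].
have h2 : (fun q : V => q.2) @ p --> p.2 by exact: cvg_snd.
exact: cvg_pair h1 h2.
Qed.

(** The derivative of exp s is the time coordinate of the image point, so derivatives of F(exp_time)
    are again of this form. *)
Lemma smooth_exp_time (F : V -> R) : smooth F -> smooth (fun p => F (exp_time p)).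
Proof.
move=> sF.
pose T (f : V -> R) := exists2 F, smooth F & f = (fun p => F (exp_time p)).
apply: (@ring_closure_smooth _ _ T); last by apply: closure_gen; exists F.
move=> _ [f sf ->]; split.
  by move=> p; apply: continuous_comp; [exact: cont_exp_time|exact: smooth_cont].
move=> w; split; first by move=> p; have [] := is_derive_exp_time p w sf.
rewrite (derive_funE (fun p => is_derive_exp_time p w sf)); apply: closure_gen.
exists (fun q => w.1 * q.1 * dt f q + \sum_j w.2 0 j * dx j f q); last by [].
apply: smoothD.
  apply: smoothM; last exact: smooth_dt.
  by apply: smoothM; [exact: smooth_cst|exact: smooth_fst].
by apply: smooth_sum => j _; apply: smoothM; [exact: smooth_cst|exact: smooth_dx].
Qed.

Lemma dt_exp_time (F : V -> R) p : smooth F ->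
  dt (fun q => F (exp_time q)) p = expR p.1 * dt F (exp_time p).
Proof.
move=> sF; have [_] := is_derive_exp_time p (1, 0) sF.
rewrite -/(dt _ p) => ->; rewrite /= mul1r big1 ?addr0 // => j _.
by rewrite mxE mul0r.
Qed.

(** For t > 0 the quotients at t + r with small r > 0 lie in both limits. This identifies the
    derivative in the flow equation with the ordinary one of a smooth extension. *)
Lemma has_time_derivative_eq (f g : R -> R) (t d d' : R) : 0 < t ->
  is_derive t (1 : R) f d' -> (forall s, 0 <= s -> g s = f s) ->
  has_time_derivative g t d -> d = d'.
Proof.
move=> t0 /is_deriveP D gf H; apply/eqP; rewrite -subr_eq0 -normr_le0.
apply/ler_addgt0Pr => eps eps0; rewrite add0r.
have e2 : 0 < eps / 2 by rewrite divr_gt0.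
have [d1 d10 h1] := D _ e2.
move/cvgrPdist_lt : H => /(_ _ e2) /nbhs_ballP[d2 d20 h2].
pose r := Num.min (Num.min d1 d2) t / 2.
have m0 : 0 < Num.min (Num.min d1 d2) t by rewrite !lt_min d10 t0 andbT.
have r0 : 0 < r by rewrite divr_gt0.
have rm : r < Num.min (Num.min d1 d2) t by rewrite ltr_pdivrMr // ltr_pMr // ltr1n.
move: rm; rewrite !lt_min => /andP[/andP[r1 r2] rt].
have := h1 r (lt0r_neq0 r0); rewrite gtr0_norm // => /(_ r1).
have := h2 (t + r); rewrite /ball /= opprD addrA subrr add0r normrN gtr0_norm // => /(_ r2).
have tr : t + r != t by rewrite -subr_eq0 addrC addKr gt_eqF.
have tr0 : t + r \in `[0, +oo[ by rewrite in_itv /= andbT addr_ge0 // ltW.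
move=> /(_ tr tr0); rewrite [r%:A]mulr1 addrAC subrr add0r -[r^-1 * _]mulrC !gf ?(ltW t0) //; last first.
  by rewrite addr_ge0 // ltW.
move=> h3 h4.
rewrite (_ : d - d' = (d - (f (t + r) - f t) / r) + ((f (t + r) - f t) / r - d')); last by ring.
rewrite (le_trans (ler_normD _ _)) // [leRHS](splitr eps).
by apply: lerD; exact: ltW.
Qed.

Lemma iter_derive_fst (vs : seq (S * S)) (g : S -> R) :
  iter_derive vs (fun q : S * S => g q.1) = (fun q => iter_derive (map fst vs) g q.1).
Proof. by elim: vs => [//|w vs IH] /=; rewrite IH. Qed.

End LogarithmicTime.

Theorem theorem1p3 (R : realType) (n : nat) (hn : (1 <= n)%N)
    (phi : R -> 'rV[R]_n -> R)
    (hflow : calabi_flow phi)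
    (hRm : exists C : R, forall (t : R) (xi : 'rV[R]_n),
        0 <= t -> Rm_norm (phi t) xi <= C) :
  smoothly_converges (fun t => omega (phi t)) omega0.
Proof.
have [[Phi [sPhi EPhi]] inH htime] := hflow; have [C HC] := hRm.
(* Only times exp s > 0 are sampled, so the hypotheses, given for t >= 0, hold for psi at every real
   s. *)
pose psi (p : R * 'rV[R]_n) := Phi (exp_time p).
have spsi : smooth psi by exact: smooth_exp_time.
have Epsi s : (fun y => psi (s, y)) = phi (expR s).
  by apply/funext => y; rewrite EPhi // expR_ge0.
have ppsi : periodicx psi.
  by move=> s; rewrite Epsi; have [] := inH _ (expR_ge0 s).
have posV p : posdef (Vmat psi p).
  case: p => s x; have := congr1 (fun f => f x) (hessian_pot psi s) => /= <-.
  by rewrite Epsi; have [_ _] := inH _ (expR_ge0 s); exact.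
have Rm_le s x : Rm_norm (fun y => psi (s, y)) x <= `|C|.
  by rewrite Epsi (le_trans (HC _ _ (expR_ge0 s))) // ler_norm.
(* The envelope identity gives h_s = - psi_s = - exp s S, and by Abreu's formula - S is the double
   divergence of G. *)
have flow : dt (hpot psi) = (fun p => expR p.1 * flow_rhs (Gmat psi) p).
  rewrite (dt_hpot spsi ppsi posV); apply/funext => p.
  rewrite (dt_exp_time _ sPhi) -mulrN; congr (_ * _).
  have -> : dt Phi (exp_time (Theta psi p)) = scalar_curvature (phi (expR p.1)) (Xi psi p).
    have D := line_dt (expR p.1) (Xi psi p) sPhi.
    apply: esym; apply: (has_time_derivative_eq (expR_gt0 p.1) D _
      (htime _ (Xi psi p) (expR_ge0 p.1))) => s s0.
    exact: EPhi.
  rewrite -Epsi (scalar_curvatureE spsi posV) opprK /flow_rhs.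
  apply: esym; apply: (etrans (div_div_Gmat spsi ppsi posV p)).
  rewrite [RHS]exchange_big; apply: eq_bigr => j _; apply: eq_bigr => l _.
  by congr (_ * _); exact: (Umat_symE spsi).
move=> a b vs eps eps0.
(* Half of [eps] leaves room for the strict inequality. *)
have e2 : 0 < eps / 2 by rewrite divr_gt0.
have [s0 Hs0] := metric_converges spsi ppsi posV (normr_ge0 C) Rm_le flow
  (fun i j => dxi_deta i j a b) (map fst vs) e2.
near=> t.
have ts : expR s0 < t by near: t; exact: nbhs_pinfty_gt.
have t0 : 0 < t by rewrite (le_lt_trans _ ts) // expR_ge0.
have st : s0 <= ln t by rewrite -ler_expR lnK ?posrE // ltW.
move=> q.
have -> : (fun q => omega (phi t) q a b - omega0 q a b) = (fun q => \sum_i \sum_j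
    (Vmat psi (ln t, q.1) i j - (i == j)%:R) * dxi_deta i j a b).
  apply/funext => r; rewrite /omega /omega0 -sumrB; apply: eq_bigr => i _.
  have -> : phi t = (fun y => psi (ln t, y)) by rewrite Epsi lnK ?posrE.
  rewrite hessian_pot; under [RHS]eq_bigr do rewrite mulrBl.
  rewrite sumrB; congr (_ - _); rewrite (bigD1 i) //= eqxx mul1r big1 ?addr0 // => j /negPf ji.
  by rewrite eq_sym ji mul0r.
rewrite (iter_derive_fst vs (fun y => \sum_i \sum_j
    (Vmat psi (ln t, y) i j - (i == j)%:R) * dxi_deta i j a b)).
by apply: (le_lt_trans (Hs0 _ st _)); rewrite ltr_pdivrMr // ltr_pMr // ltr1n.
Unshelve. all: by end_near.
Qed.
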